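(* Let $(W,S)$ be a $2$-spherical Coxeter system of finite rank at least three, and let $\Delta=(\Delta_+,\Delta_-,\delta_* )$ and $\Delta'=(\Delta_+',\Delta_-',\delta_*')$ be thick twin buildings of type $(W,S)$, with $\Delta$ wall-connected. Let $(c_+,c_-)\in\mathcal C_+\times\mathcal C_-$ and $(c_+',c_-')\in\mathcal C_+'\times\mathcal C_-'$ be pairs of opposite chambers of $\Delta$ and $\Delta'$ respectively. Then any isometry $\varphi:E_2(c_+)\cup\{c_-\}\to E_2(c_+')\cup\{c_-'\}$ extends uniquely to an isometry from $\mathcal C_+\cup\mathcal C_-$ onto $\mathcal C_+'\cup\mathcal C_-'$.
   Context: **Coxeter systems.** $(W,S)$ is a Coxeter system with $S$ finite and length function $\ell$; its rank is $|S|$. $J\subseteq S$ is spherical if $\langle J\rangle$ is finite; then $r_J$ is the longest element of $\langle J\rangle$. $(W,S)$ is $2$-spherical if $m_{st}=o(st)<\infty$ for all $s,t\in S$. **Buildings.** A building of type $(W,S)$ is a pair $(\mathcal C,\delta)$, $\mathcal C\ne\emptyset$, $\delta:\mathcal C\times\mathcal C\to W$, such that for $x,y\in\mathcal C$, $w=\delta(x,y)$: (1) $w=1$ iff $x=y$; (2) if $\delta(y,z)=s\in S$ then $\delta(x,z)\in\{w,ws\}$, and $\delta(x,z)=ws$ if $\ell(ws)=\ell(w)+1$; (3) for $s\in S$ there is $z$ with $\delta(y,z)=s$, $\delta(x,z)=ws$. The $J$-residue of $x$ is $R_J(x)=\{y\mid\delta(x,y)\in\langle J\rangle\}$ (type $J$,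 rank $|J|$; spherical if $J$ is); panels are residues of rank $1$, $\mathcal P_s(x):=R_{\{s\}}(x)$. Thick: every panel has at least three chambers. $E_k(x)$ is the union of all residues of rank at most $k$ containing $x$. Inside a spherical residue $R$ of type $J$, chambers $x,y$ are opposite in $R$ if $\delta(x,y)=r_J$; residues $R_1,R_2\subseteq R$ of types $J_1,J_2$ are opposite in $R$ if some chamber of $R_1$ is opposite in $R$ to some chamber of $R_2$ and $J_1=r_JJ_2r_J$. **Twin buildings.** A twin building of type $(W,S)$ is $\Delta=(\Delta_+,\Delta_-,\delta_* )$ with $\Delta_\pm=(\mathcal C_\pm,\delta_\pm)$ buildings of type $(W,S)$ and $\delta_*:(\mathcal C_+\times\mathcal C_-)\cup(\mathcal C_-\times\mathcal C_+)\to W$ such that for $\epsilon\in\{+,-\}$, $x\in\mathcal C_\epsilon$, $y\in\mathcal C_{-\epsilon}$, $w=\delta_*(x,y)$: $\delta_*(y,x)=w^{-1}$; if $\delta_{-\epsilon}(y,z)=s\in S$ and $\ell(ws)=\ell(w)-1$, then $\delta_*(x,z)=ws$; for $s\in S$ there is $z\in\mathcal C_{-\epsilon}$ with $\delta_{-\epsilon}(y,z)=s$, $\delta_*(x,z)=ws$. Put $\mathcal C=\mathcal C_+\cup\mathcal C_-$ and let $\delta$ be the combination of $\delta_+,\delta_-,\delta_*$. Thick means both halves are thick. Chambers $x\in\mathcal C_\epsilon,y\in\mathcal C_{-\epsilon}$ are opposite if $\delta_*(x,y)=1$. Residues in different halves are opposite if they have the same type and contain a pair of opposite chambers. **Projections.**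 For a residue $R$ and a chamber $x$ in the same half, $\mathrm{proj}_Rx$ is the unique $z\in R$ with $\ell(\delta(x,y))=\ell(\delta(x,z))+\ell(\delta(z,y))$ for all $y\in R$. For $R$ spherical and $x$ in the other half, it is the unique $z\in R$ with $\ell(\delta_*(x,y))=\ell(\delta_*(x,z))-\ell(\delta(z,y))$ for all $y\in R$. For a set $X$ of chambers, $\mathrm{proj}_RX=\{\mathrm{proj}_Rx\mid x\in X\}$. **Compatible paths.** Two panels $P,Q$ of one half are adjacent if they are opposite in some (spherical) rank $2$ residue, which is then unique and denoted $R(P,Q)$. A sequence $(P_0,\dots,P_k)$ of panels of one half with consecutive panels adjacent is a compatible path if $\mathrm{proj}_{R(P_{i-1},P_i)}P_0=P_{i-1}$ for $1\le i\le k$; its length is $k$ and its type is $(J_1,\dots,J_k)$, $J_i$ the type of $R(P_{i-1},P_i)$. For a panel $P$ in the other half, a compatible path $(P_0,\dots,P_k)$ is $P$-compatible if $P_0$ is opposite to $P$ and $\mathrm{proj}_{R(P_{i-1},P_i)}P=P_i$ for $1\le i\le k$. **Wall-connected.** For $c\in\mathcal C_\epsilon$, $s\in S$, let $\Gamma_s(c)$ be the graph whose vertices are the panels of $\mathcal C_{-\epsilon}$ opposite to $\mathcal P_s(c)$, where $Q_1,Q_2$ are joined by an edge if they are wall-adjacent of type $(c,s)$, i.e. there are a panel $T\subseteq\mathcal C_{-\epsilon}$ and $\mathcal P_s(c)$-compatible paths from $Q_1$ to $T$ and from $Q_2$ to $T$ of the same length and type. $\Delta$ is wall-connected if $\Gamma_s(c)$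 is connected for all $(c,s)\in\mathcal C\times S$. **Isometries.** For $\mathcal X\subseteq\mathcal C$, $\mathcal X'\subseteq\mathcal C'$, an isometry $\mathcal X\to\mathcal X'$ is a bijection $\varphi$ with $\varphi(\mathcal X\cap\mathcal C_\epsilon)\subseteq\mathcal C'_\epsilon$ for $\epsilon\in\{+,-\}$ and $\delta'(\varphi(x),\varphi(y))=\delta(x,y)$ for all $x,y\in\mathcal X$. *)

(* Defs.v *)
From Stdlib Require Import Relation_Operators.
From mathcomp Require Import all_boot finmap.
From mathcomp Require Import mathcomp_extra boolp classical_sets functions cardinality.

Set Implicit Arguments.
Unset Strict Implicit.
Unset Printing Implicit Defensive.

Local Open Scope group_scope.
Local Open Scope classical_set_scope.

Section Coxeter.
Variables (W : groupType) (S : {fset W}).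

Definition has_order (G : groupType) (x : G) (n : nat) : Prop :=
  [/\ (0 < n)%N, x ^+ n = 1 & forall m : nat, (0 < m)%N -> x ^+ m = 1 -> (n <= m)%N].

Definition subgroup (H : set W) : Prop :=
  H 1 /\ forall x y, H x -> H y -> H (x * y^-1).

Definition generated (J : {fset W}) : set W := smallest subgroup [set` J].

(* The last clause is the universal property of the presentation
   < S | (s t)^m = 1 for all s, t in S such that o(s t) = m is finite >;
   uniqueness of [h] follows from [generated S = setT]. *)
Definition coxeter_system : Prop :=
  [/\ forall s, s \in S -> has_order s 2,
      generated S = setT
    & forall (G : groupType) (f : W -> G),
        (forall s t, s \in S -> t \in S ->
           forall m, has_order (s * t) m -> (f s * f t) ^+ m = 1) ->
        exists2 h : W -> G, {morph h : x y / x * y} & {in S, h =1 f}].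

Definition expresses (l : seq W) (w : W) : Prop :=
  {subset l <= S} /\ \big[*%g/1]_(s <- l) s = w.

Definition len (w : W) : nat :=
  xget 0%N [set n | (exists2 l, expresses l w & size l = n) /\
                    forall l, expresses l w -> (n <= size l)%N].

Definition spherical (J : {fset W}) : Prop :=
  (J `<=` S)%fset /\ finite_set (generated J).

(* r_J; the default value 1 is irrelevant when J is spherical. *)
Definition longest (J : {fset W}) : W :=
  xget 1 [set r | generated J r /\
                  forall w, generated J w -> (len w <= len r)%N].

Definition two_spherical : Prop :=
  forall s t, s \in S -> t \in S -> exists n, has_order (s * t) n.

Definition is_building (C : Type) (delta : C -> C -> W) : Prop :=
  [/\ inhabited C,
      forall x y, delta x y = 1 <-> x = y,
      forall x y z s, s \in S -> delta y z = s ->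
        (delta x z = delta x y \/ delta x z = delta x y * s) /\
        (len (delta x y * s) = (len (delta x y)).+1 ->
           delta x z = delta x y * s)
    & forall x y s, s \in S ->
        exists z, delta y z = s /\ delta x z = delta x y * s].

(* The union C_+ \cup C_- is the disjoint sum; [sign] sends C_+ to true. *)
Definition sign (Cp Cm : Type) (x : Cp + Cm) : bool :=
  if x is inl _ then true else false.

Definition union_dist (Cp Cm : Type) (dp : Cp -> Cp -> W) (dm : Cm -> Cm -> W)
    (dpm : Cp -> Cm -> W) (dmp : Cm -> Cp -> W) (x y : Cp + Cm) : W :=
  match x, y with
  | inl a, inl b => dp a b
  | inr a, inr b => dm a b
  | inl a, inr b => dpm a b
  | inr a, inl b => dmp a b
  end.

(* [dpm] and [dmp] are the restrictions of the codistance delta_* to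
   C_+ x C_- and C_- x C_+. *)
Record twin_building : Type := TwinBuilding {
  Cplus : Type;
  Cminus : Type;
  dist_plus : Cplus -> Cplus -> W;
  dist_minus : Cminus -> Cminus -> W;
  codist_pm : Cplus -> Cminus -> W;
  codist_mp : Cminus -> Cplus -> W;
  building_plus : is_building dist_plus;
  building_minus : is_building dist_minus;
  dist := union_dist dist_plus dist_minus codist_pm codist_mp;
  codist_sym : forall x y, sign x <> sign y -> dist y x = (dist x y)^-1;
  codist_down : forall x y z s, sign x <> sign y -> sign z = sign y ->
    s \in S -> dist y z = s ->
    (len (dist x y * s)).+1 = len (dist x y) ->
    dist x z = dist x y * s;
  codist_exists : forall x y s, sign x <> sign y -> s \in S ->
    exists z, [/\ sign z = sign y, dist y z = s
                & dist x z = dist x y * s]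
}.

Definition chamber (D : twin_building) : Type := (Cplus D + Cminus D)%type.

Section Twin.
Variable D : twin_building.
Implicit Types (x y z c : chamber D) (P Q R T : set (chamber D)).
Implicit Types (J : {fset W}) (Js : seq {fset W}) (Ps : seq (set (chamber D))).

Definition opposite x y : Prop := sign x <> sign y /\ dist x y = 1.

Definition residue J x : set (chamber D) :=
  [set y | sign y = sign x /\ generated J (dist x y)].

Definition is_residue J R : Prop :=
  (J `<=` S)%fset /\ exists x, R = residue J x.

Definition panel (s : W) x : set (chamber D) := residue [fset s]%fset x.

Definition is_panel P : Prop := exists s, is_residue [fset s]%fset P.

Definition thick : Prop := forall P, is_panel P ->
  exists x y z, [/\ P x, P y & P z] /\ [/\ x <> y, x <> z & y <> z].

Definition E_ (k : nat) x : set (chamber D) :=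
  \bigcup_(R in [set R | R x /\
     exists J, is_residue J R /\ (#|` J| <= k)%N]) R.

Definition opposite_residues Q P : Prop :=
  exists J, [/\ is_residue J Q, is_residue J P
              & exists x y, [/\ Q x, P y & opposite x y]].

(* R is a spherical residue of type J, and R1, R2 are opposite in R. *)
Definition opposite_in J R R1 R2 : Prop :=
  [/\ spherical J, is_residue J R, R1 `<=` R, R2 `<=` R
    & exists J1 J2, [/\ is_residue J1 R1, is_residue J2 R2,
        [set` J1] = [set longest J * u * longest J | u in [set` J2]]
      & exists x y, [/\ R1 x, R2 y & dist x y = longest J]]].

(* P and Q are adjacent panels, and R = R(P,Q) has type J. *)
Definition adjacent_via J R P Q : Prop :=
  [/\ is_panel P, is_panel Q, #|` J| = 2%N & opposite_in J R P Q].

(* [is_proj R x z]: z = proj_R x. In the second case the equation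
   l(x,y) = l(x,z) - l(z,y) is written additively because subtraction on nat
   is truncated. *)
Definition is_proj R x z : Prop :=
  R z /\ forall y, R y ->
    if sign x == sign z
    then len (dist x y) = (len (dist x z) + len (dist z y))%N
    else (len (dist x y) + len (dist z y))%N = len (dist x z).

Definition proj_set R (X : set (chamber D)) : set (chamber D) :=
  [set z | exists2 x, X x & is_proj R x z].

(* Ps = (P_0, ..., P_k) is a sequence of panels with consecutive panels
   adjacent via residues R_i = R(P_i,P_{i+1}) of type J_i (Js = (J_0, ...)),
   satisfying the condition [cond i R_i] for every i < k. As R(P_i,P_{i+1})
   is unique, quantifying over R existentially is harmless. *)
Definition panel_path (cond : nat -> set (chamber D) -> Prop) Ps Js : Prop :=
  [/\ size Ps = (size Js).+1,
      forall i, (i <= size Js)%N -> is_panel (nth set0 Ps i)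
    & forall i, (i < size Js)%N -> exists R,
        adjacent_via (nth fset0 Js i) R (nth set0 Ps i) (nth set0 Ps i.+1) /\
        cond i R].

Definition compatible_path Ps Js : Prop :=
  panel_path (fun i R => proj_set R (nth set0 Ps 0) = nth set0 Ps i) Ps Js.

Definition P_compatible_path P Ps Js : Prop :=
  [/\ compatible_path Ps Js, opposite_residues (nth set0 Ps 0) P
    & panel_path (fun i R => proj_set R P = nth set0 Ps i.+1) Ps Js].

Definition wall_adjacent c (s : W) Q1 Q2 : Prop :=
  exists T Ps1 Ps2 Js,
    [/\ P_compatible_path (panel s c) Ps1 Js,
        P_compatible_path (panel s c) Ps2 Js,
        nth set0 Ps1 0 = Q1 /\ nth set0 Ps1 (size Js) = T
      & nth set0 Ps2 0 = Q2 /\ nth set0 Ps2 (size Js) = T].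

Definition connected_graph (V : Type) (vertices : set V)
    (edge : V -> V -> Prop) : Prop :=
  forall u v, vertices u -> vertices v ->
    clos_refl_trans V
      (fun a b => [/\ vertices a, vertices b & edge a b]) u v.

Definition wall_connected : Prop := forall c s, s \in S ->
  connected_graph
    [set Q | is_panel Q /\ opposite_residues Q (panel s c)]
    (wall_adjacent c s).

End Twin.

(* An isometry X -> X' is represented by a total map, of which only the
   values on X matter. *)
Definition isometry (D D' : twin_building)
    (X : set (chamber D)) (X' : set (chamber D'))
    (phi : chamber D -> chamber D') : Prop :=
  [/\ set_bij X X' phi,
      forall x, X x -> sign (phi x) = sign x
    & forall x y, X x -> X y -> dist (phi x) (phi y) = dist x y].

End Coxeter.

(* Main.v *)
(* Call [f] a local isometry at an opposite pair (x, y) if it maps E_2(x) and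
   E_2(y) isometrically.  Such an [f] is determined by its values on E_2(y) and
   at x, or at x, y and the panels around x, because in a thick twin building
   every chamber near x is reached by alternately changing sides through common
   opposites; and it can be moved to an adjacent opposite pair.  Moving the
   given local isometry along minimal galleries from c_+ covers the half C_+.
   The outcome does not depend on the gallery: this is a question inside a
   rank 2 residue, settled by following two of its galleries simultaneously
   with a common opposite chamber.  So the map extends to C_+ without any
   connectivity assumption.  For a panel P on c_-, a panel Q opposite P
   prescribes the images of the chambers of P; compatible paths transport the
   prescription from Q to any wall-adjacent panel, so wall-connectedness makes
   it independent of Q, and C_- is covered panel by panel. *)

(* The given map says nothing about E_2(c_-). Its values there are forced because, for spherical
   [J], the [J]-residues of two opposite chambers determine each other: a chamber [z] of one is the
   only chamber of its residue at codistance [longest J] from its projection to the other. In a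
   2-spherical system this applies to every type of rank at most two; it is used both to construct
   images and to compare maps. The obstacle is that E_2 is not a residue: codistances between a
   [K]-residue of [x] and a [J]-residue of [y] are not given, and have to be controlled through the
   type [J] meet [K]. A local isometry forgets c_- once its base pair has moved away. So the
   codistance from c_- to the current pair is carried as a separate invariant; it yields all
   codistances from the image of c_- to the first half, which is where the crossing of walls starts.
   Rank at least three enters in proving that c_+ goes to c_+': an isometry is not assumed to
   respect the base chambers, and in rank two E_2(c_+) is a whole half, which does not single out
   c_+. *)
From HB Require Import structures.
Require Import Defs.
From mathcomp Require Import all_boot finmap zify.
From mathcomp Require Import boolp classical_sets functions cardinality.

Set Implicit Arguments.
Unset Strict Implicit.
Unset Printing Implicit Defensive.

Local Open Scope group_scope.
Local Open Scope classical_set_scope.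

(** * Exchange condition and parabolic subgroups *)

(* The semidirect product of (Z/2)^W by W.  Sending s to (indicator of s, s)
   defines a morphism on W whose first component records the reflections that
   a word crosses an odd number of times; this yields the exchange condition. *)
Definition refl_group (W : groupType) : Type := ((W -> bool) * W)%type.

Section ReflGroup.
Variable W : groupType.
HB.instance Definition _ := gen_eqMixin (refl_group W).
HB.instance Definition _ := gen_choiceMixin (refl_group W).

Definition rg_one : refl_group W := (fun=> false, 1).
Definition rg_mul (x y : refl_group W) : refl_group W :=
  (fun t => x.1 t (+) y.1 (t ^ x.2), x.2 * y.2).
Definition rg_inv (x : refl_group W) : refl_group W :=
  (fun t => x.1 (t ^ x.2^-1), x.2^-1).

Lemma rg_mulA : associative rg_mul.
Proof.
move=> x y z; rewrite /rg_mul /= mulgA; congr (_, _).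
by apply/funext => t; rewrite conjgM addbA.
Qed.

Lemma rg_mul1 : left_id rg_one rg_mul.
Proof.
case=> f w; rewrite /rg_mul /= mul1g; congr (_, _).
by apply/funext => t; rewrite conjg1.
Qed.

Lemma rg_mulg1 : right_id rg_one rg_mul.
Proof.
case=> f w; rewrite /rg_mul /= mulg1; congr (_, _).
by apply/funext => t; rewrite addbF.
Qed.

Lemma rg_mulV : left_inverse rg_one rg_inv rg_mul.
Proof.
case=> f w; rewrite /rg_mul /rg_inv /= mulVg; congr (_, _).
by apply/funext => t; rewrite addbb.
Qed.

Lemma rg_mulgV : right_inverse rg_one rg_inv rg_mul.
Proof.
case=> f w; rewrite /rg_mul /rg_inv /= mulgV; congr (_, _).
by apply/funext => t; rewrite -conjgM mulgV conjg1 addbb.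
Qed.

HB.instance Definition _ := isGroup.Build (refl_group W)
  rg_mulA rg_mul1 rg_mulg1 rg_mulV rg_mulgV.
End ReflGroup.

Lemma generated_min (W : groupType) (J : {fset W}) (A : set W) w :
  subgroup A -> (forall j, j \in J -> A j) -> generated J w -> A w.
Proof. by move=> sA JA; apply; split => // j; exact: JA. Qed.

Lemma generated_subgroup (W : groupType) (J : {fset W}) : subgroup (generated J).
Proof.
split=> [A [[A1 _] _] //|x y gx gy A hA].
by have := hA => -[[_ AM] _]; apply: AM; [exact: gx|exact: gy].
Qed.

Section GeneratedTheory.
Variables (W : groupType) (J : {fset W}).
Implicit Types (x y : W).
Lemma generated1 : generated J 1.
Proof. exact: (generated_subgroup J).1. Qed.

Lemma generatedV x : generated J x -> generated J x^-1.
Proof. by move=> gx; rewrite -[x^-1]mul1g; apply: (generated_subgroup J).2 => //; exact: generated1. Qed.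

Lemma generatedM x y : generated J x -> generated J y -> generated J (x * y).
Proof. by move=> gx gy; rewrite -[y]invgK; apply: (generated_subgroup J).2 => //; exact: generatedV. Qed.

Lemma generated_gen x : x \in J -> generated J x.
Proof. by move=> xJ A [_]; apply. Qed.

Lemma generatedMl x y : generated J x -> generated J (x * y) -> generated J y.
Proof. by move=> gx gxy; rewrite -(mulKg x y); apply: generatedM => //; apply: generatedV. Qed.

Lemma generatedMr x y : generated J y -> generated J (x * y) -> generated J x.
Proof. by move=> gy gxy; rewrite -(mulgK y x); apply: generatedM => //; apply: generatedV. Qed.

End GeneratedTheory.

Lemma generatedS (W : groupType) (J K : {fset W}) : (J `<=` K)%fset ->
  generated J `<=` generated K.
Proof.
move=> JK x; apply: generated_min; first exact: generated_subgroup.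
by move=> j jJ; apply: generated_gen; apply: (fsubsetP JK).
Qed.

Lemma rg_expg (W : groupType) (a : refl_group W) n :
  a ^+ n = ((fun t => \big[addb/false]_(i < n) a.1 (t ^ (a.2 ^+ i))), a.2 ^+ n).
Proof.
elim: n => [|n IHn].
  by rewrite !expg0; congr (_, _); apply/funext => t; rewrite big_ord0.
rewrite expgSr IHn; congr (_, _); last by rewrite expgSr.
by apply/funext => t; rewrite big_ord_recr.
Qed.

Section Coxeter.
Variables (W : groupType) (S : {fset W}).
Hypothesis hcox : coxeter_system S.
Implicit Types (s t u v w : W) (l : seq W) (J K : {fset W}).

Local Notation pr l := (\big[*%g/1]_(s <- l) s).
Local Notation len := (len S).

Lemma gen2 s : s \in S -> s * s = 1.
Proof. by case: hcox => h2 _ _ /h2 [_ + _]; rewrite expg2. Qed.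

Lemma genV s : s \in S -> s^-1 = s.
Proof. by move=> /gen2 ss; apply: mulg1_eq. Qed.

Lemma gen_neq1 s : s \in S -> s <> 1.
Proof.
case: hcox => h2 _ _ /h2 [_ _ h] s1.
by have := h 1%N isT; rewrite expg1 => /(_ s1).
Qed.

Lemma mulg_gen w s : s \in S -> w * s * s = w.
Proof. by move=> sS; rewrite -mulgA gen2 // mulg1. Qed.

Lemma mulgen_g w s : s \in S -> s * (s * w) = w.
Proof. by move=> sS; rewrite mulgA gen2 // mul1g. Qed.

Lemma generatedT w : generated S w.
Proof. by case: hcox => _ -> _. Qed.

Definition refl_gen s : refl_group W := (fun t => t == s, s).

(** The word [(s t)^m] crosses the reflections [g ^+ k * s] with [k < 2m]. Since [g ^+ m = 1], the
    second half of this list repeats the first, so every reflection is crossed an even number of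
    times. *)
Lemma refl_gen_rel s t m : s \in S -> t \in S -> has_order (s * t) m ->
  (refl_gen s * refl_gen t) ^+ m = 1.
Proof.
move=> sS tS [_ gm _]; set g := s * t in gm.
have conj_pow i : g ^+ i * s = s * g ^- i.
  elim: i => [|i IHi]; first by rewrite expg0 invg1 mul1g mulg1.
  rewrite [in LHS]expgS -mulgA IHi expgSr invgM /g invgM (genV sS) (genV tS).
  by rewrite !mulgA.
(* The letters [s] contribute the even exponents [k], the letters [t] (in [red2]) the odd ones. *)
have red1 (x : W) i : (x ^ (g ^+ i) == s) = (x == g ^+ (i.*2) * s).
  rewrite -addnn expgnDr -mulgA conj_pow mulgA.
  apply/eqP/eqP => [<-|->]; first by rewrite conjgE !mulgA mulgV mul1g mulgK.
  by rewrite conjgE !mulgA mulVg mul1g mulgVK.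
have red2 (x : W) i : ((x ^ (g ^+ i)) ^ s == t) = (x == g ^+ (i.*2.+1) * s).
  have -> : ((x ^ (g ^+ i)) ^ s == t) = (x ^ (g ^+ i) == s * t * s).
    move: (x ^ (g ^+ i)) => y; rewrite conjgE (genV sS) !mulgA.
    apply/eqP/eqP => [<-|->]; first by rewrite !mulgA (gen2 sS) mul1g mulg_gen.
    by rewrite !mulgA (gen2 sS) mul1g mulg_gen.
  have -> : g ^+ (i.*2.+1) * s = g ^+ i * (s * t * s) * g ^- i.
    transitivity (g ^+ i * g * (s * g ^- i)); last by rewrite /g !mulgA.
    by rewrite -conj_pow (mulgA _ (g ^+ i) s) -expgSr -expgnDr addSn addnn.
  apply/eqP/eqP => [<-|->]; first by rewrite conjgE !mulgA mulgV mul1g mulgK.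
  by rewrite conjgE !mulgA mulVg mul1g mulgVK.
rewrite rg_expg /=; congr (_, _); last exact: gm.
apply/funext => x.
have sum2 n : \big[addb/false]_(i < n)
    ((x ^ (g ^+ i) == s) (+) ((x ^ (g ^+ i)) ^ s == t))
  = \big[addb/false]_(i < n.*2) (x == g ^+ i * s).
  elim: n => [|n IHn]; first by rewrite !big_ord0.
  by rewrite doubleS !big_ord_recr /= IHn red1 red2 addbA.
rewrite [LHS]sum2 -addnn big_split_ord /=.
rewrite [X in _ (+) X](eq_bigr (fun i : 'I_m => x == g ^+ i * s)).
  by rewrite addbb.
by move=> i _; rewrite expgnDr gm mul1g.
Qed.

(** [eta w t] is the parity with which a word for [w] crosses the reflection [t]. It comes from the
    universal property as a function on [W], so it does not depend on the word. *)
Lemma eta_exists : exists eta : W -> W -> bool,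
  (forall u v t, eta (u * v) t = eta u t (+) eta v (t ^ u)) /\
  (forall s t, s \in S -> eta s t = (t == s)).
Proof.
case: hcox => _ gS univ.
have [h hM hs] := univ _ refl_gen (fun s t sS tS m => refl_gen_rel sS tS (m := m)).
have h2 w : (h w).2 = w.
  apply: (@generated_min _ S (fun w => (h w).2 = w) w) => [|s sS|].
  - have h1 : h 1 = 1 by apply: (mulgI (h 1)); rewrite -hM !mulg1.
    split; first by rewrite /= h1.
    move=> x y /= hx hy; rewrite hM.
    have -> : h y^-1 = (h y)^-1.
      by apply/esym/mulg1_eq; rewrite -hM mulgV.
    by rewrite -[in RHS]hx -[in RHS]hy.
  - by rewrite hs.
  - by rewrite gS.
exists (fun w => (h w).1); split=> [u v t|s t sS]; last by rewrite hs.
by rewrite hM -{3}(h2 u).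
Qed.

Lemma prV l : {subset l <= S} -> pr (rev l) = (pr l)^-1.
Proof.
elim: l => [|s l IHl] lS; first by rewrite big_nil invg1.
have sS : s \in S by apply: lS; rewrite inE eqxx.
have l'S : {subset l <= S} by move=> x xl; apply: lS; rewrite inE xl orbT.
by rewrite rev_cons -cats1 big_cat /= big_seq1 big_cons invgM IHl // (genV sS).
Qed.

Lemma expressible J w : (J `<=` S)%fset -> generated J w ->
  exists l, {subset l <= J} /\ pr l = w.
Proof.
move=> /fsubsetP JS.
apply: (@generated_min _ J (fun w => exists l, {subset l <= J} /\ pr l = w)) => [|j jJ].
  split; first by exists [::]; rewrite big_nil.
  move=> x y [l1 [l1J <-]] [l2 [l2J <-]]; exists (l1 ++ rev l2); split.
    by move=> z; rewrite mem_cat mem_rev => /orP[/l1J|/l2J].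
  by rewrite big_cat /= prV // => z /l2J /JS.
by exists [:: j]; rewrite big_seq1; split=> // z; rewrite inE => /eqP ->.
Qed.

(** Generation by [S] provides a word for [w], hence a shortest one, so the default value in [len]
    is never taken. *)
Lemma lenP w : (exists2 l, expresses S l w & size l = len w) /\
  forall l, expresses S l w -> (len w <= size l)%N.
Proof.
rewrite /len /Defs.len; set A := [set n | _].
suff [n An] : exists n, A n by have := @xgetPex _ 0%N A (ex_intro _ n An).
have [l0 [l0S l0w]] := expressible (fsubset_refl S) (generatedT w).
pose B n := `[< exists2 l, expresses S l w & size l = n >].
have exB : exists n, B n by exists (size l0); apply/asboolP; exists l0.
exists (ex_minn exB); case: ex_minnP => n /asboolP Bn minn; split=> // l lw.
by apply: minn; apply/asboolP; exists l.
Qed.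

Lemma len_expr w : exists l, [/\ {subset l <= S}, pr l = w & size l = len w].
Proof. by have [[l [lS lw] ls] _] := lenP w; exists l. Qed.

Lemma len_min l : {subset l <= S} -> (len (pr l) <= size l)%N.
Proof. by move=> lS; have [_ ->] := lenP (pr l). Qed.

Lemma len1 : len 1 = 0%N.
Proof. by apply/eqP; rewrite -leqn0; have := @len_min [::]; rewrite big_nil; apply. Qed.

Lemma len_eq0 w : len w = 0%N -> w = 1.
Proof. by have [l [_ <- <-]] := len_expr w; move/size0nil ->; rewrite big_nil. Qed.

Lemma lenM u v : (len (u * v) <= len u + len v)%N.
Proof.
have [l1 [l1S <- <-]] := len_expr u; have [l2 [l2S <- <-]] := len_expr v.
rewrite -size_cat -big_cat; apply: len_min => x.
by rewrite mem_cat => /orP[/l1S|/l2S].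
Qed.

Lemma lenV w : len w^-1 = len w.
Proof.
have le_len v : (len v^-1 <= len v)%N.
  have [l [lS <- <-]] := len_expr v; rewrite -prV // -size_rev.
  by apply: len_min => x; rewrite mem_rev => /lS.
by apply/eqP; rewrite eqn_leq le_len /= -{1}(invgK w) le_len.
Qed.

Lemma len_gen s : s \in S -> len s = 1%N.
Proof.
move=> sS; apply/eqP; rewrite eqn_leq; apply/andP; split.
  have := @len_min [:: s]; rewrite big_seq1; apply.
  by move=> x; rewrite inE => /eqP ->.
by rewrite lt0n; apply/eqP => /len_eq0; apply: gen_neq1.
Qed.

Lemma len_le1 w : len w = 1%N -> w \in S.
Proof.
have [l [lS <- <-]] := len_expr w.
by case: l lS => [|s [|]] // lS _; rewrite big_seq1; apply: lS; rewrite inE eqxx.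
Qed.

Definition deletion l l' := exists l1 s l2, l = l1 ++ s :: l2 /\ l' = l1 ++ l2.

Lemma deletion_sub l l' J : deletion l l' -> {subset l <= J} -> {subset l' <= J}.
Proof.
move=> [l1 [s [l2 [-> ->]]]] lJ x; rewrite mem_cat => xl; apply: lJ.
by rewrite mem_cat inE; case/orP: xl => ->; rewrite ?orbT.
Qed.

Lemma deletion_size l l' : deletion l l' -> size l = (size l').+1.
Proof. by move=> [l1 [s [l2 [-> ->]]]]; rewrite !size_cat /= addnS. Qed.

(** The exchange condition. The parity [eta w s] decides between the two cases, and passing from [w]
    to [s * w] flips it. *)
Lemma len_dich s w : s \in S ->
  (len (s * w) = (len w).+1) \/
  (len w = (len (s * w)).+1 /\ forall l, {subset l <= S} -> pr l = w ->
     exists l', deletion l l' /\ s * w = pr l').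
Proof.
move=> sS; have [eta [etaM etas]] := eta_exists.
(* A reflection of odd parity occurs among those crossed by the word, and multiplying by it erases
   the letter where it is crossed. *)
have eta_word l t : {subset l <= S} -> eta (pr l) t ->
    exists l', deletion l l' /\ t * pr l = pr l'.
  elim: l t => [|r l IHl] t lS.
    rewrite big_nil.
    have -> : eta 1 t = false by have := etaM 1 1 t; rewrite mulg1 conjg1; case: (eta 1 t).
    by [].
  have rS : r \in S by apply: lS; rewrite inE eqxx.
  have lS' : {subset l <= S} by move=> x xl; apply: lS; rewrite inE xl orbT.
  rewrite big_cons etaM (etas _ _ rS); case: eqP => [-> _|_ /=].
    by exists l; split; [exists [::], r, l|rewrite mulgen_g].
  move/(IHl _ lS') => [l' [[l1 [q [l2 [-> ->]]]] lq]].
  exists (r :: l1 ++ l2); split; first by exists (r :: l1), q, l2.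
  by rewrite big_cons -lq conjgE (genV rS) !mulgA (gen2 rS) mul1g.
have down v : eta v s -> (len (s * v) < len v)%N.
  have [l [lS <- <-]] := len_expr v.
  move=> /(eta_word _ _ lS) [l' [ll' ->]]; rewrite (deletion_size ll') ltnS.
  exact: len_min (deletion_sub ll' lS).
have up v : ((len (s * v)) <= (len v).+1)%N.
  by apply: (leq_trans (lenM _ _)); rewrite len_gen.
case Ews : (eta w s).
  right; split.
    apply/eqP; rewrite eqn_leq (down _ Ews) andbT.
    by have := up (s * w); rewrite mulgen_g.
  by move=> l lS lw; rewrite -lw; apply: eta_word => //; rewrite lw.
left; apply/eqP; rewrite eqn_leq up /=.
have := down (s * w); rewrite mulgen_g // etaM etas // eqxx.
have -> : s ^ s = s by rewrite conjgE mulKg.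
by rewrite Ews; apply.
Qed.

Lemma deletion_rev l l' : deletion l l' -> deletion (rev l) (rev l').
Proof.
move=> [l1 [s [l2 [-> ->]]]]; exists (rev l2), s, (rev l1).
by rewrite !rev_cat rev_cons cat_rcons.
Qed.

Lemma len_mulr w s : s \in S ->
  (len (w * s) = (len w).+1) \/
  (len w = (len (w * s)).+1 /\ forall l, {subset l <= S} -> pr l = w ->
     exists l', deletion l l' /\ w * s = pr l').
Proof.
move=> sS; have eqV : s * w^-1 = (w * s)^-1 by rewrite invgM (genV sS).
have := len_dich w^-1 sS; rewrite eqV !lenV.
case=> [?|[? h]]; [by left|right; split=> // l lS lw].
have lS' : {subset rev l <= S} by move=> x; rewrite mem_rev => /lS.
have [] := h (rev l) lS'; first by rewrite prV // lw.
move=> l' [ll' e]; exists (rev l'); split.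
  by rewrite -(revK l); apply: deletion_rev.
by rewrite prV -?e ?invgK //; apply: deletion_sub ll' lS'.
Qed.

End Coxeter.

Section Parabolic.
Variables (W : groupType) (S : {fset W}).
Hypothesis hcox : coxeter_system S.
Implicit Types (s t u v w : W) (l : seq W) (J K : {fset W}).

Local Notation pr l := (\big[*%g/1]_(s <- l) s).
Local Notation len := (len S).

Lemma len_mulr_or w s : s \in S ->
  len (w * s) = (len w).+1 \/ len w = (len (w * s)).+1.
Proof. by move=> sS; case: (len_mulr hcox w sS) => [|[]]; [left|right]. Qed.

Lemma len_mull_or s w : s \in S ->
  len (s * w) = (len w).+1 \/ len w = (len (s * w)).+1.
Proof. by move=> sS; case: (len_dich hcox w sS) => [|[]]; [left|right]. Qed.

Lemma generated_pr J l : {subset l <= J} -> generated J (pr l).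
Proof.
elim: l => [|s l IHl] lJ; first by rewrite big_nil; exact: generated1.
rewrite big_cons; apply: generatedM.
  by apply: generated_gen; apply: lJ; rewrite inE eqxx.
by apply: IHl => x xl; apply: lJ; rewrite inE xl orbT.
Qed.

(** Exchange shortens a word by deleting letters only, so a word in [J] can be made shortest without
    leaving [J]. *)
Lemma gen_word J w : (J `<=` S)%fset -> generated J w ->
  exists l, [/\ {subset l <= J}, pr l = w & size l = len w].
Proof.
move=> JS /(expressible hcox JS) [l [lJ <-]]; move/fsubsetP: JS => JS.
elim: l lJ => [|s l IHl] lJ.
  by exists [::]; rewrite big_nil (len1 hcox).
have [|l' [l'J l'w l'len]] := IHl.
  by move=> x xl; apply: lJ; rewrite inE xl orbT.
have sJ : s \in J by apply: lJ; rewrite inE eqxx.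
rewrite big_cons; set v := pr l in l'w l'len *.
case: (len_dich hcox v (JS _ sJ)) => [e|[e /(_ l')]].
  exists (s :: l'); rewrite big_cons l'w /= e l'len; split => //.
  by move=> x; rewrite inE => /orP[/eqP ->|/l'J].
case=> // [x /l'J /JS //|l2 [dl l2w]]; exists l2; split=> //.
  exact: deletion_sub dl l'J.
by apply: succn_inj; rewrite -(deletion_size dl) l'len e.
Qed.

Lemma gen_descent J w : (J `<=` S)%fset -> generated J w -> w <> 1 ->
  exists j, [/\ j \in J, generated J (w * j) & len w = (len (w * j)).+1].
Proof.
move=> JS gw w1; have [l [lJ lw llen]] := gen_word JS gw.
case/lastP: l lJ lw llen => [|l j] lJ lw llen.
  by case: w1; rewrite -lw big_nil.
have jJ : j \in J by apply: lJ; rewrite mem_rcons inE eqxx.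
have l'J : {subset l <= J} by move=> x xl; apply: lJ; rewrite mem_rcons inE xl orbT.
have jS : j \in S by apply: (fsubsetP JS).
have ew : w * j = pr l.
  by rewrite -lw -cats1 big_cat /= big_seq1 (mulg_gen hcox).
exists j; rewrite ew; split=> //; first exact: generated_pr.
have : (len (w * j) < len w)%N.
  rewrite ew -llen size_rcons ltnS; apply: (len_min hcox).
  by move=> x /l'J; apply: (fsubsetP JS).
by rewrite -ew; case: (len_mulr_or w jS) => ->; lia.
Qed.

(** Induction on length, splitting off a descent. With [J = S] and [generatedT] it is induction over
    [W], the form used for arguments along reduced galleries. *)
Lemma gen_ind J (P : W -> Prop) : (J `<=` S)%fset -> P 1 ->
  (forall u j, generated J u -> j \in J -> len (u * j) = (len u).+1 ->
     P u -> P (u * j)) ->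
  forall w, generated J w -> P w.
Proof.
move=> JS P1 Pj w; move: {2}(len w) (erefl (len w)) => n.
elim: n w => [|n IHn] w wn gw; first by rewrite (len_eq0 hcox wn).
have w1 : w <> 1 by move=> w1; rewrite w1 (len1 hcox) in wn.
have [j [jJ gwj ewj]] := gen_descent JS gw w1.
have jS : j \in S by apply: (fsubsetP JS).
rewrite -(mulg_gen hcox w jS); apply: Pj => //.
  by rewrite (mulg_gen hcox).
by apply: IHn => //; apply: succn_inj; rewrite -ewj.
Qed.

Lemma gen_simple J s : (J `<=` S)%fset -> s \in S -> generated J s -> s \in J.
Proof.
move=> JS sS /(gen_word JS) [l [lJ ls]]; rewrite (len_gen hcox sS).
case: l lJ ls => [|j [|]] // lJ; rewrite big_seq1 => <- _.
by apply: lJ; rewrite inE eqxx.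
Qed.

(** Exchange applied to a shortest word in [J] writes [w * s] as a word in [J], so [s] lies in the
    subgroup. *)
Lemma descent_in J w s : (J `<=` S)%fset -> generated J w -> s \in S ->
  (len (w * s) < len w)%N -> s \in J.
Proof.
move=> JS gw sS ls; have [l [lJ lw llen]] := gen_word JS gw.
case: (len_mulr hcox w sS) => [e|[_ /(_ l)]]; first by rewrite e in ls; lia.
case=> // [x /lJ|l' [dl ew]]; first exact: (fsubsetP JS).
apply: gen_simple => //; apply: (generatedMl gw); rewrite ew.
exact: generated_pr (deletion_sub dl lJ).
Qed.

(** The last letter in [J] of a common element is a descent, hence lies in [K] as well; splitting it
    off preserves both memberships. *)
Lemma generatedI J K w : (J `<=` S)%fset -> (K `<=` S)%fset ->
  generated J w -> generated K w -> generated (J `&` K)%fset w.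
Proof.
move=> JS KS gJ; apply: (@gen_ind J (fun w => generated K w ->
  generated (J `&` K)%fset w)) gJ => // [_|u j _ jJ lj IHu gKuj].
  exact: generated1.
have jS : j \in S by apply: (fsubsetP JS).
have jK : j \in K.
  apply: (@descent_in K (u * j)) => //.
  by rewrite (mulg_gen hcox) // lj.
apply: generatedM; last by apply: generated_gen; rewrite !inE jJ.
by apply: IHu; apply: (generatedMr (generated_gen jK)).
Qed.

Lemma deletion_cat l1 l2 l : deletion (l1 ++ l2) l ->
  (exists k, deletion l1 k /\ l = k ++ l2) \/
  (exists k, deletion l2 k /\ l = l1 ++ k).
Proof.
case=> k1 [k [k2 [e ->]]].
elim: l1 k1 e => [|x l1 IHl] [|y k1] /=.
- by move=> ->; right; exists k2; split=> //; exists [::], k, k2.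
- by move=> ->; right; exists (y :: k1 ++ k2); split=> //; exists (y :: k1), k, k2.
- by case=> _ <-; left; exists l1; split=> //; exists [::], x, l1.
case=> <- /IHl [] [m [[m1 [q [m2 [e1 e2]]]] e]].
  by left; exists (x :: m); rewrite e; split=> //; exists (x :: m1), q, m2; rewrite e1 e2.
by right; exists m; rewrite e; split=> //; exists m1, q, m2.
Qed.

(** If a further letter [j] shortened [w * u], exchange would delete a letter from the word of [w],
    against minimality in the coset, or from the word of [u], against [u * j] being longer than
    [u]. *)
Lemma len_min_coset J w : (J `<=` S)%fset ->
  (forall u, generated J u -> (len w <= len (w * u))%N) ->
  forall u, generated J u -> len (w * u) = (len w + len u)%N.
Proof.
move=> JS minw.
apply: (@gen_ind J (fun u => len (w * u) = (len w + len u)%N)) => // [|u j gu jJ luj IHu].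
  by rewrite mulg1 (len1 hcox) addn0.
have jS : j \in S by apply: (fsubsetP JS).
rewrite luj addnS -IHu mulgA.
case: (len_mulr hcox (w * u) jS) => // -[e hex]; exfalso.
have [l1 [l1S l1w l1len]] := len_expr hcox w.
have [l2 [l2J l2u l2len]] := gen_word JS gu.
have subS : {subset l1 ++ l2 <= S}.
  by move=> x; rewrite mem_cat => /orP[/l1S //|/l2J]; apply: (fsubsetP JS).
have [||l' [/deletion_cat dl el']] := hex (l1 ++ l2) => //.
  by rewrite big_cat /= l1w l2u.
case: dl => -[k [dk el]]; move: el'; rewrite el big_cat /=.
  rewrite l2u => el'; have ew : w * (u * j * u^-1) = pr k.
    by rewrite !mulgA el' mulgK.
  have : (len (pr k) < len w)%N.
    rewrite -l1len (deletion_size dk) ltnS.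
    exact: (len_min hcox) (deletion_sub dk l1S).
  rewrite -ew ltnNge minw //.
  apply: generatedM; last exact: generatedV.
  by apply: generatedM => //; apply: generated_gen.
rewrite l1w -mulgA => /mulgI el'.
have : (len (u * j) <= size k)%N.
  rewrite el'; apply: (len_min hcox) => x /(deletion_sub dk l2J).
  exact: (fsubsetP JS).
by rewrite luj -l2len (deletion_size dk); lia.
Qed.

(** A reduced word of [v] is taken off the right end of [w] letter by letter: exchange on the word
    of [w * v^-1] followed by that of [v] deletes a letter of the first part, since deleting one of
    the second would shorten [v * j]. This governs codistances, for which projections are the
    farthest chambers. *)
Lemma len_max_coset J w : (J `<=` S)%fset ->
  (forall j, j \in J -> (len (w * j) < len w)%N) ->
  forall u, generated J u -> (len (w * u) + len u)%N = len w.
Proof.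
move=> JS maxw u gu.
have lowb v : (len w <= len (w * v) + len v)%N.
  have := lenM hcox (w * v) v^-1; rewrite mulgK (lenV hcox); lia.
apply/eqP; rewrite eqn_leq lowb andbT.
suff h : forall v, generated J v -> (len (w * v^-1) + len v <= len w)%N.
  by have := h _ (generatedV gu); rewrite invgK (lenV hcox).
apply: (@gen_ind J (fun v => (len (w * v^-1) + len v <= len w)%N)) => // [|v j gv jJ lvj IHv].
  by rewrite invg1 mulg1 (len1 hcox) addn0.
have jS : j \in S by apply: (fsubsetP JS).
have [l1 [l1S l1w l1len]] := len_expr hcox (w * v^-1).
have [l2 [l2J l2u l2len]] := gen_word JS gv.
case: (len_mulr hcox w jS) => [e|[_ /(_ (l1 ++ l2))]].
  by have := maxw _ jJ; rewrite e; lia.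
have subS : {subset l1 ++ l2 <= S}.
  by move=> x; rewrite mem_cat => /orP[/l1S //|/l2J]; apply: (fsubsetP JS).
case=> // [|l' [/deletion_cat dl el']]; first by rewrite big_cat /= l1w l2u mulgVK.
case: dl => -[k [dk el]]; move: el'; rewrite el big_cat /=.
  rewrite l2u => el'; have -> : w * (v * j)^-1 = pr k.
    by rewrite invgM (genV hcox jS) mulgA el' mulgK.
  rewrite lvj; have := len_min hcox (deletion_sub dk l1S).
  have := deletion_size dk; lia.
rewrite l1w => el'.
have ev : v * j = pr k by apply: (mulgI (w * v^-1)); rewrite -el' !mulgA mulgVK.
have : (len (v * j) <= size k)%N.
  rewrite ev; apply: (len_min hcox) => x /(deletion_sub dk l2J).
  exact: (fsubsetP JS).
by rewrite lvj -l2len (deletion_size dk); lia.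
Qed.

(** Finiteness bounds the lengths (crudely, by their sum), so a longest element exists and the
    default value in [longest] is not taken. *)
Lemma longestP J : spherical S J ->
  generated J (longest S J) /\ forall w, generated J w -> (len w <= len (longest S J))%N.
Proof.
case=> JS /finite_setP; rewrite /longest.
set A := [set r | _]; case=> n fn.
suff [r Ar] : exists r, A r by have := @xgetPex _ 1 A (ex_intro _ r Ar).
have [X eX] : exists X : {fset W}, generated J = [set` X].
  by apply/finite_fsetP; apply/finite_setP; exists n.
pose B k := `[< exists2 w, generated J w & len w = k >].
have exB : exists k, B k.
  by exists 0%N; apply/asboolP; exists 1; [exact: generated1|rewrite (len1 hcox)].
have ubB k : B k -> (k <= \sum_(w <- X) len w)%N.
  move=> /asboolP [w]; rewrite eX /= => wX <-.
  by rewrite (big_rem _ wX) /= leq_addr.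
case: (ex_maxnP exB ubB) => m /asboolP [r gr lr] maxm; exists r; split=> // w gw.
by rewrite lr; apply: maxm; apply/asboolP; exists w.
Qed.

Lemma longest_gen J : spherical S J -> generated J (longest S J).
Proof. by move=> /longestP []. Qed.

Lemma longest_descent J j : spherical S J -> j \in J ->
  (len (longest S J * j) < len (longest S J))%N.
Proof.
move=> sJ jJ; have [gr maxr] := longestP sJ; have [JS _] := sJ.
have := maxr _ (generatedM gr (generated_gen jJ)).
by case: (len_mulr_or (longest S J) (fsubsetP JS _ jJ)) => ->; lia.
Qed.

Lemma len_longest J u : spherical S J -> generated J u ->
  (len (longest S J * u) + len u)%N = len (longest S J).
Proof.
move=> sJ; have [JS _] := sJ.
by apply: len_max_coset => // j jJ; apply: longest_descent.
Qed.

(** By [len_max_coset] each of [r] and [longest S J] exceeds the other by the length of their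
    quotient, which is therefore 1. *)
Lemma longest_uniq J r : spherical S J -> generated J r ->
  (forall j, j \in J -> (len (r * j) < len r)%N) -> r = longest S J.
Proof.
move=> sJ gr maxr; have [JS _] := sJ; have gl := longest_gen sJ.
have gx : generated J (r^-1 * longest S J) by apply: generatedM => //; apply: generatedV.
have e : longest S J * (r^-1 * longest S J)^-1 = r by rewrite invgM invgK mulVKg.
have := len_max_coset JS maxr gx; rewrite mulVKg.
have := len_longest sJ (generatedV gx); rewrite e (lenV hcox).
have := @len_eq0 _ _ hcox (r^-1 * longest S J); move: (len (_ * longest S J)) => n h.
move=> e1 e2; have n0 : n = 0%N by lia.
by rewrite -[RHS](mulVKg r) h // mulg1.
Qed.

Lemma longestV J : spherical S J -> (longest S J)^-1 = longest S J.
Proof.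
move=> sJ; apply: mulg1_eq; apply: (len_eq0 hcox).
have := len_longest sJ (longest_gen sJ); lia.
Qed.

Lemma longest2 J : spherical S J -> longest S J * longest S J = 1.
Proof. by move=> sJ; rewrite -{1}(longestV sJ) mulVg. Qed.

Lemma len_longest_l J u : spherical S J -> generated J u ->
  (len (u * longest S J) + len u)%N = len (longest S J).
Proof.
move=> sJ gu; have := len_longest sJ (generatedV gu).
by rewrite -{1}(longestV sJ) -invgM !(lenV hcox).
Qed.

Definition adm J := (J `<=` S)%fset /\ (#|` J| <= 2)%N.

(** The elements [g ^+ i * s ^+ b] with [g = s * t] are closed under products and inverses, and [i]
    matters only modulo the order of [g]. *)
Lemma dihedral_finite s t : two_spherical S -> s \in S -> t \in S ->
  finite_set (generated [fset s; t]%fset).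
Proof.
move=> h2 sS tS; have [n [n0 gn _]] := h2 _ _ sS tS; set g := s * t in gn.
have sg i : s * g ^+ i = g ^- i * s.
  elim: i => [|i IHi]; first by rewrite expg0 invg1 mul1g mulg1.
  rewrite [in LHS]expgSr mulgA IHi -mulgA expgS invgM -mulgA; congr (_ * _).
  by rewrite /g invgM (genV hcox sS) (genV hcox tS) (mulg_gen hcox) // (mulgen_g hcox).
pose A := [set w | exists i (b : bool), w = g ^+ i * s ^+ b].
have gV i : exists k, g ^- i = g ^+ k.
  exists (n.-1 * i)%N; apply: mulg1_eq; rewrite -expgnDr -mulSn prednK //.
  by rewrite expgnA gn expg1n.
have AV x : A x -> A x^-1.
  case=> i [b ->]; have [k ek] := gV i; exists (if b then i else k), b.
  case: b; last by rewrite !expg0 !mulg1.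
  rewrite !expg1 invgM (genV hcox sS).
  by apply: (mulIg (g ^+ i)); rewrite mulgVK -mulgA sg mulgA mulgV mul1g.
have AM x y : A x -> A y -> A (x * y).
  case=> i [b ->] [j [c ->]]; have [k ek] := gV j; case: b.
    exists (i + k)%N, (~~ c); rewrite expg1 -mulgA [s * _]mulgA sg ek expgnDr -!mulgA.
    by case: c; rewrite /= ?expg0 ?expg1 ?(gen2 hcox sS) ?mulg1.
  by exists (i + j)%N, c; rewrite expg0 mulg1 mulgA expgnDr.
have gA : generated [fset s; t]%fset `<=` A.
  move=> w0; apply: (@generated_min _ _ A).
    by split; [exists 0%N, false; rewrite !expg0 mulg1|move=> x y Ax /AV; apply: AM].
  have As : A s by exists 0%N, true; rewrite expg0 mul1g expg1.
  move=> j; rewrite !inE => /orP[/eqP -> //|/eqP ->].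
  by rewrite -(mulgen_g hcox t sS); apply: (AM) => //; exists 1%N, false; rewrite expg1 expg0 mulg1.
apply: (sub_finite_set gA).
apply: (@sub_finite_set _ _ ((fun p : 'I_n * bool => g ^+ p.1 * s ^+ p.2) @` setT)).
  move=> x [i [b ->]]; exists (Ordinal (ltn_pmod i n0), b) => //=.
  by rewrite {2}(divn_eq i n) expgnDr mulnC expgnA gn expg1n mul1g.
exact/finite_image/finite_finset.
Qed.

Lemma adm_spherical J : two_spherical S -> adm J -> spherical S J.
Proof.
move=> h2 [JS cJ]; split=> //; move/fsubsetP: JS => JS.
have sub s t : s \in S -> t \in S -> (J `<=` [fset s; t])%fset -> finite_set (generated J).
  by move=> sS tS Jst; apply: sub_finite_set (generatedS Jst) _; apply: dihedral_finite.
have memJ x : (x \in J) = (x \in (enum_fset J)) by [].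
case eJ : (enum_fset J) cJ => [|s [|t [|]]] // _.
- apply: (@sub_finite_set _ _ [set 1]) => // w0; apply: (@generated_min _ _ [set 1]) => [|j].
    by split=> // x y -> ->; rewrite /= invg1 mulg1.
  by rewrite memJ eJ.
- have sS : s \in S by apply: JS; rewrite memJ eJ inE.
  by apply: (sub s s) => //; apply/fsubsetP => x; rewrite memJ eJ !inE => ->.
have sS : s \in S by apply: JS; rewrite memJ eJ !inE eqxx.
have tS : t \in S by apply: JS; rewrite memJ eJ !inE eqxx orbT.
by apply: (sub s t) => //; apply/fsubsetP => x; rewrite memJ eJ !inE.
Qed.

End Parabolic.

(** * Twin buildings *)

Section TwinBasics.
Variables (W : groupType) (S : {fset W}).
Hypothesis hcox : coxeter_system S.
Variable D : twin_building S.
Implicit Types (s t u v w : W) (J K : {fset W}) (x y z : chamber D).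

Local Notation len := (len S).

(* [mulgA] goes through a more general structure, whose product [lia] does not
   identify with the product of [W]. *)
Lemma mulA (a b c : W) : a * (b * c) = a * b * c.
Proof. exact: mulgA. Qed.

Lemma dist_eq1 x y : sign x = sign y -> dist x y = 1 <-> x = y.
Proof.
case: (building_plus D) (building_minus D) => _ hp _ _ [_ hm _ _].
case: x y => x [] y //= _; rewrite /dist /=.
  by rewrite hp; split=> [->|[]].
by rewrite hm; split=> [->|[]].
Qed.

Lemma distxx x : dist x x = 1.
Proof. exact/dist_eq1. Qed.

Lemma step_same x y z s : sign y = sign x -> sign z = sign x -> s \in S ->
  dist y z = s ->
  (dist x z = dist x y \/ dist x z = dist x y * s) /\
  (len (dist x y * s) = (len (dist x y)).+1 -> dist x z = dist x y * s).
Proof.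
case: (building_plus D) (building_minus D) => _ _ hp _ [_ _ hm _].
by case: x y z => x [] y [] z //= _ _ sS; rewrite /dist /= => e; [apply: hp|apply: hm].
Qed.

Lemma ex_adj x y s : s \in S ->
  exists z, [/\ sign z = sign y, dist y z = s & dist x z = dist x y * s].
Proof.
move=> sS; have [e|ne] := boolP (sign x == sign y); last first.
  by apply: codist_exists => //; apply/eqP.
move/eqP: e.
case: (building_plus D) (building_minus D) => _ _ _ hp [_ _ _ hm].
case: x y => x [] y //= _.
  by have [z [h1 h2]] := hp x y s sS; exists (inl z).
by have [z [h1 h2]] := hm x y s sS; exists (inr z).
Qed.

Lemma adj_sym y z s : s \in S -> sign z = sign y -> dist y z = s -> dist z y = s.
Proof.
move=> sS e ys; have [+ _] := step_same (esym e) (erefl (sign z)) sS ys.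
rewrite distxx => -[/esym /dist_eq1 h|/esym h].
  by move: ys; rewrite h // distxx.
by rewrite -(genV hcox sS) -(mulg1_eq (x := dist z y) h) invgK.
Qed.

Lemma adj_neq y z s : s \in S -> dist y z = s -> y <> z.
Proof. by move=> sS + e; rewrite e distxx => /esym; apply: (gen_neq1 hcox). Qed.

Lemma adj_tri y z (a : chamber D) s : s \in S -> sign z = sign y -> sign a = sign y ->
  dist y z = s -> dist y a = s -> z = a \/ dist z a = s.
Proof.
move=> sS ez ea yz ya; have zy := adj_sym sS ez yz.
have [||+ _] := @step_same z y a s _ _ sS ya; rewrite ?ez ?ea //.
rewrite zy => -[h|h]; first by right.
by left; apply/dist_eq1; rewrite ?ez ?ea // h (gen2 hcox sS).
Qed.

(** For [x] in the other half no axiom applies directly when [s] lengthens both codistances. The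
    existence axiom then gives a farther chamber [z2] of the panel, from which [z], and also [y]
    unless it equals [z2], is one step down. *)
Lemma step x y z s : sign z = sign y -> s \in S -> dist y z = s ->
  dist x z = dist x y \/ dist x z = dist x y * s.
Proof.
move=> ez sS yz; have [e|/eqP ne] := boolP (sign x == sign y).
  by move/eqP: e => e; have [||+ _] := @step_same x y z s _ _ sS yz; rewrite ?ez ?e //.
case: (len_mulr_or hcox (dist x y) sS) => [l1|l1]; last first.
  by right; apply: codist_down (esym l1).
case: (len_mulr_or hcox (dist x z) sS) => [l2|l2]; last first.
  right; have zy := adj_sym sS ez yz.
  have -> : dist x y = dist x z * s by apply: codist_down (esym l2); rewrite ?ez.
  by rewrite (mulg_gen hcox).
have [z2 [ez2 zz2 xz2]] := ex_adj x z sS.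
have [e|yz2] := adj_tri sS (etrans (esym ez) (erefl _)) ez2 (adj_sym sS ez yz) zz2.
  by right; rewrite e xz2 (mulg_gen hcox).
left; have : dist x y = dist x z2 * s.
  apply: codist_down => //; rewrite ?ez2 ?ez //.
    by apply: adj_sym => //; rewrite ez2 ez.
  by rewrite xz2 (mulg_gen hcox) // l2.
by rewrite xz2 (mulg_gen hcox).
Qed.

Lemma step_down x y z s : sign x <> sign y -> sign z = sign y -> s \in S ->
  dist y z = s -> (len (dist x y * s) < len (dist x y))%N ->
  dist x z = dist x y * s.
Proof.
move=> ne ez sS yz lt; apply: codist_down => //.
by case: (len_mulr_or hcox (dist x y) sS) => e; lia.
Qed.

Lemma step_up x y z s : sign x = sign y -> sign z = sign y -> s \in S ->
  dist y z = s -> (len (dist x y) < len (dist x y * s))%N ->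
  dist x z = dist x y * s.
Proof.
move=> ex ez sS yz lt; have [||_ h] := @step_same x y z s _ _ sS yz; rewrite ?ex ?ez //.
by apply: h; case: (len_mulr_or hcox (dist x y) sS) => e; lia.
Qed.

(** Repeats [ex_adj] along a reduced word: reducedness gives [dist z y = v], while the distance from
    [x] is multiplied by [v] whichever half contains [x]. *)
Lemma ex_chain x z v :
  exists y, [/\ sign y = sign z, dist z y = v & dist x y = dist x z * v].
Proof.
pose P v := exists y, [/\ sign y = sign z, dist z y = v & dist x y = dist x z * v].
apply: (@gen_ind _ _ hcox S P) (generatedT hcox v) => // [|u s _ sS ls [y [ey zy xy]]].
  by exists z; rewrite distxx mulg1.
have [y' [ey' yy' xy']] := ex_adj x y sS.
exists y'; split; [by rewrite ey'| |by rewrite xy' xy mulgA].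
by rewrite (@step_up z y y' s) // ?zy ?ls.
Qed.

Lemma dist_ind_last y z u s : sign z = sign y -> s \in S -> dist y z = u * s ->
  exists z', [/\ sign z' = sign y, dist y z' = u, dist z' z = s & dist z z' = s].
Proof.
move=> ez sS yz; have [z' [ez' zz' yz']] := ex_adj y z sS.
exists z'; split=> //; [by rewrite ez'|by rewrite yz' yz (mulg_gen hcox)|].
exact: adj_sym.
Qed.

Lemma dist_coset J x y z : (J `<=` S)%fset -> sign z = sign y ->
  generated J (dist y z) -> generated J ((dist x y)^-1 * dist x z).
Proof.
move=> JS ez gw.
pose P v := forall z, dist y z = v -> sign z = sign y -> generated J ((dist x y)^-1 * dist x z).
apply: (@gen_ind _ _ hcox J P JS _ _ _ gw z (erefl _) ez) => [z' h e|u j gu jJ lj IHu z' yz e].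
  by move/dist_eq1: h => <- //; rewrite mulVg; exact: generated1.
have jS : j \in S by apply: (fsubsetP JS).
have [z2 [ez2 yz2 z2z _]] := dist_ind_last e jS yz.
have := IHu _ yz2 ez2; have [|->|->] := @step x z2 z' j _ jS z2z; [by rewrite ez2|by []|].
by rewrite mulgA => h; apply: generatedM => //; apply: generated_gen.
Qed.

Lemma chain_add x y z : sign y = sign x -> sign z = sign x ->
  len (dist x y * dist y z) = (len (dist x y) + len (dist y z))%N ->
  dist x z = dist x y * dist y z.
Proof.
move=> ey ez.
pose P v := forall z, dist y z = v -> sign z = sign y ->
  len (dist x y * v) = (len (dist x y) + len v)%N -> dist x z = dist x y * v.
apply: (@gen_ind _ _ hcox S P _ _ _ _ (generatedT hcox _) z (erefl _)) => //; last by rewrite ey.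
  by move=> z' /dist_eq1 h e _; rewrite mulg1 h.
move=> u s gu sS lus IHu z' yz e lw.
have [z2 [ez2 yz2 z2z _]] := dist_ind_last e sS yz.
have lu : len (dist x y * u) = (len (dist x y) + len u)%N.
  have := lenM hcox (dist x y) u.
  by move: lw; rewrite mulA lus; case: (len_mulr_or hcox (dist x y * u) sS) => -> *; lia.
have xz2 := IHu _ yz2 ez2 lu.
rewrite (@step_up x z2 z' s) ?xz2 ?mulgA // ?ez2 ?e //.
by rewrite lu -mulgA lw lus; lia.
Qed.

Lemma chain_sub x y z : sign x <> sign y -> sign z = sign y ->
  (len (dist x y * dist y z) + len (dist y z))%N = len (dist x y) ->
  dist x z = dist x y * dist y z.
Proof.
move=> ey ez.
pose P v := forall z, dist y z = v -> sign z = sign y ->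
  (len (dist x y * v) + len v)%N = len (dist x y) -> dist x z = dist x y * v.
apply: (@gen_ind _ _ hcox S P _ _ _ _ (generatedT hcox _) z (erefl _)) => //.
  by move=> z' /dist_eq1 h e _; rewrite mulg1 h.
move=> u s gu sS lus IHu z' yz e lw.
have [z2 [ez2 yz2 z2z _]] := dist_ind_last e sS yz.
have lu : (len (dist x y * u) + len u)%N = len (dist x y).
  have := lenM hcox (dist x y * u) u^-1; rewrite mulgK (lenV hcox).
  by move: lw; rewrite mulA lus; case: (len_mulr_or hcox (dist x y * u) sS) => -> *; lia.
have xz2 := IHu _ yz2 ez2 lu.
rewrite (@step_down x z2 z' s) ?xz2 ?mulgA // ?ez2 ?e //.
by move: lw; rewrite mulA lus; case: (len_mulr_or hcox (dist x y * u) sS) => -> *; lia.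
Qed.

(** Within one half symmetry is not an axiom; it comes from reading a reduced gallery backwards. *)
Lemma dist_sym x y : dist y x = (dist x y)^-1.
Proof.
have [/eqP e|/eqP ne] := boolP (sign x == sign y); last exact: codist_sym.
pose P v := forall y, dist x y = v -> sign y = sign x -> dist y x = v^-1.
apply: (@gen_ind _ _ hcox S P _ _ _ _ (generatedT hcox _) y (erefl _)) => //.
  by move=> y' /dist_eq1 h e'; rewrite invg1 h ?distxx.
move=> u s gu sS lus IHu z yz ez.
have [y' [ey' xy' y'z zy']] := dist_ind_last ez sS yz.
rewrite invgM (genV hcox sS) -(IHu _ xy' ey') -zy'; apply: chain_add; rewrite ?ez ?ey' //.
have eu : len (s * u^-1) = (len u).+1.
  by rewrite -lus -(lenV hcox (u * s)) invgM (genV hcox sS).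
by rewrite zy' (IHu _ xy' ey') eu (len_gen hcox sS) (lenV hcox).
Qed.

Lemma residue_refl J x : residue J x x.
Proof. by split=> //; rewrite distxx; exact: generated1. Qed.

Lemma residue_sym J x y : residue J x y -> residue J y x.
Proof. by case=> e g; split=> //; rewrite dist_sym; apply: generatedV. Qed.

Lemma residue_trans J x y z : (J `<=` S)%fset -> residue J x y -> residue J y z -> residue J x z.
Proof.
move=> JS [e1 g1] [e2 g2]; split; first by rewrite e2.
have := @dist_coset J x y z JS e2 g2; move/(generatedM g1).
by rewrite mulVKg.
Qed.

Lemma residue_eq J x y : (J `<=` S)%fset -> residue J x y -> residue J x = residue J y.
Proof.
move=> JS xy; apply/seteqP; split=> z h; last exact: residue_trans xy h.
by apply: residue_trans h => //; apply: residue_sym.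
Qed.

Lemma residueS J K x : (J `<=` K)%fset -> residue J x `<=` residue K x.
Proof. by move=> JK y [e g]; split=> //; apply: generatedS g. Qed.

Lemma residue_sign J x y : residue J x y -> sign y = sign x.
Proof. by case. Qed.

Lemma residueI J K x y : (J `<=` S)%fset -> (K `<=` S)%fset ->
  residue J x y -> residue K x y -> residue (J `&` K)%fset x y.
Proof. by move=> JS KS [e gJ] [_ gK]; split=> //; exact: (generatedI hcox JS KS gJ gK). Qed.

Lemma generated1P s w : s \in S -> generated [fset s]%fset w <-> w = 1 \/ w = s.
Proof.
move=> sS; split=> [|[->|->]]; last 2 first.
- exact: generated1.
- by apply: generated_gen; rewrite !inE.
apply: (@generated_min _ _ [set w | w = 1 \/ w = s]) => [|j]; last by rewrite inE => /eqP ->; right.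
split=> /= [|a b]; first by left.
have sV := genV hcox sS; have ss := gen2 hcox sS.
by move=> [->|->] [->|->]; rewrite ?invg1 ?mulg1 ?mul1g ?sV ?ss; [left|right|right|left].
Qed.

Lemma panelP s x y : s \in S ->
  residue [fset s]%fset x y <-> x = y \/ (sign y = sign x /\ dist x y = s).
Proof.
move=> sS; split=> [[e g]|].
  have [d|d] := (generated1P _ sS).1 g; last by right.
  by left; apply/dist_eq1.
by case=> [->|[e d]]; [exact: residue_refl|split=> //; apply/generated1P => //; right].
Qed.

(** Takes a chamber of the residue at greatest length from [x], which exists since [J] is spherical.
    For [x] in the other half it is the projection of [x]. *)
Lemma proj_opp_ex J x y : spherical S J ->
  exists q, residue J y q /\ forall j, j \in J -> (len (dist x q * j) < len (dist x q))%N.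
Proof.
move=> sJ; have [JS _] := sJ; have [_ maxr] := longestP hcox sJ.
set w := dist x y.
pose B k := `[< exists2 u, generated J u & len (w * u) = k >].
have exB : exists k, B k.
  by exists (len (w * 1)); apply/asboolP; exists 1 => //; exact: generated1.
have ubB k : B k -> (k <= len w + len (longest S J))%N.
  move=> /asboolP [u gu <-]; have := maxr _ gu; have := lenM hcox w u; lia.
case: (ex_maxnP exB ubB) => m /asboolP [u gu lu] maxm.
have [q [eq yq xq]] := ex_chain x y u.
exists q; split; first by split=> //; rewrite yq.
move=> j jJ; rewrite xq -/w.
have jS : j \in S by apply: (fsubsetP JS).
have : (len (w * u * j) <= m)%N.
  apply: maxm; apply/asboolP; exists (u * j); last by rewrite mulgA.
  by apply: generatedM => //; apply: generated_gen.
by case: (len_mulr_or hcox (w * u) jS) => ->; rewrite -lu => *; lia.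
Qed.

(** For [x] in the other half this says that [q] is the projection of [x] to the [J]-residue of [q]
    (see [coproj_dist]). As it depends on a single codistance, it is easily transported to
    images. *)
Definition coproj J x q := forall j, j \in J -> (len (dist x q * j) < len (dist x q))%N.

Lemma coproj_dist J x q z : (J `<=` S)%fset -> sign x <> sign q -> coproj J x q ->
  residue J q z -> dist x z = dist x q * dist q z /\
  (len (dist x z) + len (dist q z))%N = len (dist x q).
Proof.
move=> JS ne mq [ez g]; have := len_max_coset hcox JS mq g => l.
by have e := chain_sub ne ez l; rewrite e.
Qed.

Lemma proj_same_ex J x y : (J `<=` S)%fset -> sign x = sign y ->
  exists p, residue J y p /\ forall z, residue J p z ->
    dist x z = dist x p * dist p z /\ len (dist x z) = (len (dist x p) + len (dist p z))%N.
Proof.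
move=> JS e; set w := dist x y.
pose B k := `[< exists2 u, generated J u & len (w * u) = k >].
have exB : exists k, B k.
  by exists (len (w * 1)); apply/asboolP; exists 1 => //; exact: generated1.
case: (ex_minnP exB) => m /asboolP [u gu lu] minm.
have [p [ep yp xp]] := ex_chain x y u.
exists p; split; first by split=> //; rewrite yp.
move=> z [ez gz].
have l : len (dist x p * dist p z) = (len (dist x p) + len (dist p z))%N.
  apply: (len_min_coset hcox JS) gz => v gv; rewrite xp -/w lu.
  apply: minm; apply/asboolP; exists (u * v); last by rewrite mulgA.
  exact: generatedM.
have -> : dist x z = dist x p * dist p z by apply: chain_add; rewrite ?ez ?ep ?e.
by [].
Qed.

End TwinBasics.

(** * Opposite spherical residues and their projections *)

Section Opposition.
Variables (W : groupType) (S : {fset W}).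
Hypothesis hcox : coxeter_system S.
Variable D : twin_building S.
Implicit Types (s t u v w : W) (J K : {fset W}).
Implicit Types (x y z q e h a b c k m : chamber D).

Local Notation longest := (longest S).

Lemma opposite_sym x y : opposite x y -> opposite y x.
Proof. by case=> ne d; split; [exact: nesym|rewrite dist_sym // d invg1]. Qed.

(** Codistances between the [J]-residues of opposite chambers stay in the subgroup of [J]. For
    spherical [J], projections between such residues are therefore at codistance [longest J]. *)
Lemma opp_gen J x y z m : (J `<=` S)%fset -> opposite x y ->
  residue J x z -> residue J y m -> generated J (dist z m).
Proof.
move=> JS [ne xy] [ez gz] [em gm].
have gzy : generated J (dist z y).
  rewrite (dist_sym hcox y z); apply: generatedV.
  have := dist_coset hcox y JS ez gz; rewrite (dist_sym hcox x y) xy !invg1.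
  by rewrite mul1g.
by have := generatedM gzy (dist_coset hcox z JS em gm); rewrite mulVKg.
Qed.

Lemma opp_sign J x y z m : opposite x y -> residue J x z -> residue J y m ->
  sign z <> sign m.
Proof. by case=> ne _ [-> _] [-> _]. Qed.

(** A chamber [q] at codistance [longest J] is the projection of [z], so it encodes the codistances
    from [z] to the whole residue. *)
Lemma long_dist J z q m : spherical S J -> sign z <> sign q -> dist z q = longest J ->
  residue J q m -> dist z m = longest J * dist q m.
Proof.
move=> sJ ne d rm; have [JS _] := sJ; rewrite -d.
apply: (coproj_dist hcox JS ne _ rm).1 => j jJ; rewrite d.
exact: (longest_descent hcox sJ).
Qed.

Lemma long_uniq J z q m : spherical S J -> sign z <> sign q -> residue J q m ->
  dist z q = longest J -> dist z m = longest J -> q = m.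
Proof.
move=> sJ ne rm dq dm; apply/dist_eq1; first by rewrite (residue_sign rm).
by apply: (mulgI (longest J)); rewrite -(long_dist sJ ne dq rm) dm mulg1.
Qed.

Lemma opp_proj J x y z : spherical S J -> opposite x y -> residue J x z ->
  exists q, residue J y q /\ dist z q = longest J.
Proof.
move=> sJ xy rz; have [JS _] := sJ.
have [q [rq mq]] := proj_opp_ex hcox z y sJ.
exists q; split=> //; apply: longest_uniq => //; exact: opp_gen rz rq.
Qed.

(* The projections of e and a to the J-residue of y differ by an element of both
   W_J and W_K, hence of W_(J `&` K), which counting lengths shows to be 1. *)
Lemma opp_extend J K y e a : spherical S J -> spherical S K ->
  spherical S (J `&` K)%fset ->
  residue K e a -> opposite e y ->
  (forall m, residue (J `&` K)%fset y m -> dist e m = dist a m) ->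
  forall m, residue J y m -> dist e m = dist a m.
Proof.
move=> sJ sK sI ra ey agree; have [JS _] := sJ; have [KS _] := sK; have [IS _] := sI.
have ay : opposite a y.
  split; first by rewrite (residue_sign ra); case: ey.
  by rewrite -agree ?(ey.2) //; exact: residue_refl.
have [q [rq dq]] := opp_proj sJ ey (residue_refl J e).
have [q1 [rq1 dq1]] := opp_proj sJ ay (residue_refl J a).
have neq : sign e <> sign q := opp_sign ey (residue_refl J e) rq.
have neq1 : sign a <> sign q1 := opp_sign ay (residue_refl J a) rq1.
have rqq1 : residue J q1 q by apply: residue_trans rq; [exact: hcox|exact: JS|exact: residue_sym].
have rq1q := residue_sym hcox rqq1.
set i := longest J * dist q a.
have gi : generated (J `&` K)%fset i.
  apply: (generatedI hcox JS KS).
    apply: generatedM; first exact: (longest_gen hcox sJ).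
    rewrite (dist_sym hcox); apply: generatedV.
    exact: opp_gen ay (residue_refl J a) rq.
  have := dist_coset hcox q KS ra.1 ra.2.
  by rewrite (dist_sym hcox e q) dq invgK.
have [v ev gv] : exists2 v : W, v = i^-1 & generated (J `&` K)%fset v.
  by exists i^-1 => //; exact: generatedV.
have dqa : dist q a = longest J * i by rewrite /i mulA longest2 // mul1g.
have dq1q : dist q1 q = longest J * (v * longest J).
  have := long_dist sJ neq1 dq1 rqq1.
  rewrite (dist_sym hcox q a) dqa invgM longestV // -ev => ->.
  by rewrite mulA longest2 // mul1g.
have [z [rz dz]] := opp_proj sI ey (residue_refl _ e).
have rzJ : residue J y z by apply: residueS rz; exact: fsubsetIl.
have dqz : dist q z = longest J * longest (J `&` K)%fset.
  have rqz : residue J q z by apply: residue_trans rzJ; [exact: hcox|exact: JS|exact: residue_sym].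
  by rewrite -dz (long_dist sJ neq dq rqz) mulA longest2 // mul1g.
have dq1z : dist q1 z = longest J * longest (J `&` K)%fset.
  have rqz : residue J q1 z by apply: residue_trans rzJ; [exact: hcox|exact: JS|exact: residue_sym].
  by rewrite -dz agree // (long_dist sJ neq1 dq1 rqz) mulA longest2 // mul1g.
have gvJ : generated J v by apply: generatedS gv; exact: fsubsetIl.
have gI := longest_gen hcox sI.
have gIJ : generated J (longest (J `&` K)%fset) by apply: generatedS gI; exact: fsubsetIl.
have e0 : dist q1 q * dist q z = longest J * (v * longest (J `&` K)%fset).
  rewrite dq1q dqz -!mulA; congr (_ * (_ * _)).
  by rewrite mulA longest2 // mul1g.
(* The element [longest J * v * longest J] has the length of [v], so lengths add from [q1] through
   [q] to [z]. But [q] and [q1] have the same distance to [z], because [e] and [a] have the same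
   codistance to it, and cancelling leaves [v = 1]. *)
have chain : dist q1 z = dist q1 q * dist q z.
  apply: (chain_add hcox); [exact: residue_sign rqq1| |].
    by rewrite (residue_sign rzJ) (residue_sign rq1).
  rewrite e0 dq1q dqz.
  have := len_longest hcox sJ (generatedM gvJ gIJ).
  have := len_longest hcox sJ (generatedM gvJ (longest_gen hcox sJ)).
  have := len_longest hcox sJ gIJ; have := len_longest_l hcox sJ gvJ.
  have := len_longest_l hcox sI gv.
  by move=> *; lia.
have v1 : v = 1.
  have := chain; rewrite dq1z e0 => /mulgI h.
  by apply: (mulIg (longest (J `&` K)%fset)); rewrite -h mul1g.
have qq1 : q1 = q.
  apply/dist_eq1; first exact/esym/(residue_sign rqq1).
  by rewrite dq1q v1 mul1g longest2.
move=> m rm; have rqm : residue J q m.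
  by apply: residue_trans rm; [exact: hcox|exact: JS|exact: residue_sym].
by rewrite (long_dist sJ neq dq rqm) (long_dist sJ neq1 dq1) qq1.
Qed.

Lemma panel_opp s x y e k : s \in S -> opposite x y ->
  residue [fset s]%fset x e -> residue [fset s]%fset y k ->
  dist e k = 1 \/ dist e k = s.
Proof.
move=> sS xy re rk; apply/(generated1P hcox _ sS).
by apply: opp_gen re rk => //; apply/fsubsetP => j; rewrite inE => /eqP ->.
Qed.

(** Codistance [s] marks the projection of [e] to the panel; every other chamber of the panel is
    opposite [e]. *)
Lemma panel_opp_uniq s y e k k2 : s \in S -> sign e <> sign y ->
  residue [fset s]%fset y k -> residue [fset s]%fset y k2 ->
  dist e k = s -> dist e k2 = s -> k = k2.
Proof.
move=> sS ne rk rk2 d1 d2.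
have sub : ([fset s] `<=` S)%fset by rewrite fsub1set.
have : residue [fset s]%fset k k2 by apply: residue_trans rk2; [exact: hcox|exact: sub|exact: residue_sym].
move/(panelP hcox _ _ sS) => [//|[e1 dk]]; exfalso.
have := @step_down W S hcox D e k k2 s; rewrite (residue_sign rk) e1 (residue_sign rk) => h.
have := h ne (erefl _) sS dk; rewrite d1 (gen2 hcox sS) (len1 hcox) (len_gen hcox sS) d2.
by move=> /(_ isT); apply: (gen_neq1 hcox).
Qed.

Lemma panel_opp_ex s x y e : s \in S -> opposite x y ->
  residue [fset s]%fset x e -> exists k, residue [fset s]%fset y k /\ dist e k = s.
Proof.
move=> sS xy re; have [d|d] := panel_opp sS xy re (residue_refl _ y); last first.
  by exists y; split=> //; exact: residue_refl.
have [k [ek yk dk]] := ex_adj e y sS.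
by exists k; split; [apply/(panelP hcox _ _ sS); right|rewrite dk d mul1g].
Qed.

Lemma panel_third s y a b : thick D -> s \in S ->
  exists k, [/\ residue [fset s]%fset y k, k <> a & k <> b].
Proof.
move=> hth sS; have [] := hth (residue [fset s]%fset y).
  exists s; split; last by exists y.
  by rewrite fsub1set.
move=> k1 [k2 [k3 [[r1 r2 r3] [n12 n13 n23]]]].
have [e1|n1] := pselect (k1 = a); last first.
  have [e1|n1'] := pselect (k1 = b); last by exists k1.
  have [e2|n2] := pselect (k2 = a); last by exists k2; split=> //; rewrite -e1; exact: nesym.
  by exists k3; split=> //; rewrite -?e1 -?e2; exact: nesym.
have [e2|n2] := pselect (k2 = b); last by exists k2; split=> //; rewrite -e1; exact: nesym.
by exists k3; split=> //; rewrite -?e1 -?e2; exact: nesym.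
Qed.

(** Each of [e] and [c] excludes only its projection, and a thick panel has a third chamber. *)
Lemma third_opp s x y e c : thick D -> s \in S -> opposite x y ->
  residue [fset s]%fset x e -> residue [fset s]%fset x c ->
  exists k, [/\ residue [fset s]%fset y k, opposite e k & opposite c k].
Proof.
move=> hth sS xy re rc.
have [a [ra da]] := panel_opp_ex sS xy re; have [b [rb db]] := panel_opp_ex sS xy rc.
have [k [rk ka kb]] := panel_third y a b hth sS.
exists k; split=> //.
  split; first exact: opp_sign re rk.
  have [//|d] := panel_opp sS xy re rk; case: ka.
  by apply: (panel_opp_uniq sS (e := e) (y := y)) => //; case: xy re => ne _ [-> _].
split; first exact: opp_sign rc rk.
have [//|d] := panel_opp sS xy rc rk; case: kb.
by apply: (panel_opp_uniq sS (e := c) (y := y)) => //; case: xy rc => ne _ [-> _].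
Qed.

Lemma residue_ind K x (P : chamber D -> Prop) : (K `<=` S)%fset -> P x ->
  (forall a b s, residue K x a -> s \in K -> residue [fset s]%fset a b -> P a -> P b) ->
  forall z, residue K x z -> P z.
Proof.
move=> KS Px Pk z [ez gz].
pose Q v := forall z, sign z = sign x -> dist x z = v -> P z.
apply: (@gen_ind _ _ hcox K Q KS _ _ _ gz z ez (erefl _)) => [z' e /dist_eq1 <- //|].
move=> u j gu jK _ IHu z' e d; have jS : j \in S by apply: (fsubsetP KS).
have [z2 [e2 d2 d2' _]] := dist_ind_last hcox e jS d.
apply: (Pk z2 z' j) => //; last exact: IHu.
  by split=> //; rewrite d2.
by apply/(panelP hcox _ _ jS); right; rewrite e2.
Qed.

End Opposition.

(** * Local isometries *)

Section Local.
Variables (W : groupType) (S : {fset W}).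
Hypothesis hcox : coxeter_system S.
Hypothesis h2 : two_spherical S.
Variables D D' : twin_building S.
Implicit Types (s t u v w : W) (J K : {fset W}).
Implicit Types (x y z q e h a b c k m : chamber D).
Implicit Types (f g psi : chamber D -> chamber D').

Local Notation longest := (longest S).
Local Notation adm := (adm S).

(** Surjectivity has to be required: panels may be infinite, and then an isometric image of a
    residue need not be a whole residue. *)
Definition loc J x y f : Prop :=
 [/\ forall a, residue J x a \/ residue J y a -> sign (f a) = sign a,
     forall a b, residue J x a \/ residue J y a -> residue J x b \/ residue J y b ->
       dist (f a) (f b) = dist a b,
     forall a' : chamber D', residue J (f x) a' -> exists2 a, residue J x a & f a = a'
   & forall a' : chamber D', residue J (f y) a' -> exists2 a, residue J y a & f a = a'].

(* Local isometries between E_2(x) and E_2(y).  Distances are prescribed only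
   within residues of a common type J; [LI_dist] recovers the mixed ones that
   matter. *)
Definition LI x y f : Prop := opposite x y /\ forall J, adm J -> loc J x y f.

Lemma loc_sym J x y f : loc J x y f -> loc J y x f.
Proof.
case=> h1 h2' h3 h4; split=> //.
  by move=> a ra; apply: h1; case: ra; [right|left].
by move=> a b ra rb; apply: h2'; [case: ra|case: rb]; [right|left|right|left].
Qed.

Lemma LI_sym x y f : LI x y f -> LI y x f.
Proof.
by case=> o l; split; [exact: opposite_sym|move=> J /l; exact: loc_sym].
Qed.

Lemma loc_res J x y f a : loc J x y f -> residue J x a -> residue J (f x) (f a).
Proof.
case=> h1 h2' _ _ ra; have rx := residue_refl J x.
split; first by rewrite !h1; [exact: residue_sign ra|left|left].
by rewrite h2'; [case: ra|left|left].
Qed.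

Lemma loc_resr J x y f a : loc J x y f -> residue J y a -> residue J (f y) (f a).
Proof. by move/loc_sym; exact: loc_res. Qed.

Lemma loc_base J x y e h f : (J `<=` S)%fset -> residue J x e -> residue J y h ->
  loc J x y f -> loc J e h f.
Proof.
move=> JS re rh l; have [h1 h2' h3 h4] := l.
rewrite /loc -(residue_eq hcox JS re) -(residue_eq hcox JS rh).
rewrite -(residue_eq hcox JS (loc_res l re)).
by rewrite -(residue_eq hcox JS (loc_resr l rh)).
Qed.

Lemma adm_sub J : adm J -> (J `<=` S)%fset. Proof. by case. Qed.

Lemma adm_sph J : adm J -> spherical S J. Proof. exact: adm_spherical. Qed.

Lemma admI J K : adm J -> adm K -> adm (J `&` K)%fset.
Proof.
move=> [JS cJ] _; split; first by apply: fsubset_trans JS; exact: fsubsetIl.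
by apply: leq_trans cJ; apply: fsubset_leq_card; exact: fsubsetIl.
Qed.

Lemma adm1 s : s \in S -> adm [fset s]%fset.
Proof.
by move=> sS; split; [apply/fsubsetP => j; rewrite inE => /eqP ->|rewrite cardfs1].
Qed.

Lemma adm2 s t : s \in S -> t \in S -> adm [fset s; t]%fset.
Proof.
move=> sS tS; split; first by apply/fsubsetP => j; rewrite !inE => /orP[/eqP ->|/eqP ->].
by rewrite cardfs2; case: (s != t).
Qed.

Lemma adm0 : adm fset0.
Proof. by split; [exact: fsub0set|rewrite cardfs0]. Qed.

(** [f z] is the only chamber of its residue at codistance [longest J] from [f q], where [q] is the
    projection of [z]. The common value at [z0] ensures that [f] and [g] map to the same residue. *)
Lemma loc_det J x y f g z0 : spherical S J -> opposite x y -> loc J x y f -> loc J x y g ->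
  (forall m, residue J y m -> f m = g m) -> residue J x z0 -> f z0 = g z0 ->
  forall z, residue J x z -> f z = g z.
Proof.
move=> sJ xy lf lg agree rz0 e0 z rz; have [JS _] := sJ.
have [q [rq dq]] := opp_proj hcox sJ xy rz.
have dqz : dist q z = longest J by rewrite (dist_sym hcox) dq longestV.
have [f1 f2 _ _] := lf; have [g1 g2 _ _] := lg.
have fx : residue J (f x) (g z).
  apply: (residue_trans hcox JS (loc_res lf rz0)); rewrite e0.
  apply: (residue_trans hcox JS _ (loc_res lg rz)).
  exact: (residue_sym hcox (loc_res lg rz0)).
apply: (@long_uniq _ _ hcox _ J (f q)) => //.
- rewrite (f1 q); last by right.
  rewrite (f1 z); last by left.
  by rewrite (residue_sign rq) (residue_sign rz); case: xy => ne _; exact: nesym.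
- exact: (residue_trans hcox JS (residue_sym hcox (loc_res lf rz)) fx).
- by rewrite f2 //; [right|left].
- by rewrite agree // g2 //; [right|left].
Qed.

Definition half_loc J y psi : Prop :=
 [/\ forall a, residue J y a -> sign (psi a) = sign a,
     forall a b, residue J y a -> residue J y b -> dist (psi a) (psi b) = dist a b
   & forall a' : chamber D', residue J (psi y) a' -> exists2 a, residue J y a & psi a = a'].

Lemma loc_half J x y f : loc J x y f -> half_loc J y f.
Proof.
by case=> h1 h2' h3 h4; split=> // *; [apply: h1; right|apply: h2'; right].
Qed.

(** The image of [z] is the chamber near [x'] at codistance [longest J] from [psi q], with [q] the
    projection of [z] to the [J]-residue of [y]. By [long_dist] it has the right codistances to the
    whole [J]-residue of [psi y], and the distances near [x'] and surjectivity follow from these. *)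
Lemma ext_local x y psi (x' : chamber D') : opposite x y ->
  (forall J, adm J -> half_loc J y psi) -> sign x' = sign x ->
  (forall J m, adm J -> residue J y m -> dist x' (psi m) = dist x m) ->
  exists f, [/\ LI x y f, f x = x' & forall J m, adm J -> residue J y m -> f m = psi m].
Proof.
move=> xy V ex' dx'.
have sy : sign (psi y) = sign y by have [h1 _ _] := V _ adm0; apply: h1; exact: residue_refl.
have xy' : opposite x' (psi y).
  split; first by rewrite ex' sy; case: xy.
  by rewrite (dx' _ _ adm0 (residue_refl _ y)); case: xy.
pose MJ J z (z' : chamber D') := [/\ residue J x z, residue J x' z' &
   forall m, residue J y m -> dist z' (psi m) = dist z m].
have sgn J a : adm J -> residue J y a -> sign (psi a) = sign a.
  by move=> aJ ra; have [h1 _ _] := V _ aJ; apply: h1.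
have psir J a : adm J -> residue J y a -> residue J (psi y) (psi a).
  move=> aJ ra; have [_ h2' _] := V _ aJ.
  split; first by rewrite (sgn J) // sy (residue_sign ra).
  by rewrite h2' //; [case: ra|exact: residue_refl].
have neq (z : chamber D) m J : residue J x z -> residue J y m -> sign z <> sign m.
  exact: opp_sign xy.
have Mex J (z : chamber D) : adm J -> residue J x z -> exists z' : chamber D', MJ J z z'.
  move=> aJ rz; have sJ := adm_sph aJ; have [JS _] := sJ.
  have [q [rq dq]] := opp_proj hcox sJ xy rz.
  have [z' [rz' dz']] := opp_proj hcox sJ (opposite_sym hcox xy') (psir _ _ aJ rq).
  exists z'; split=> // m rm; have [_ hd _] := V _ aJ.
  have JSr := residue_trans hcox JS (residue_sym hcox rq) rm.
  have dz'q : dist z' (psi q) = longest J by rewrite (dist_sym hcox) dz' longestV.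
  rewrite (long_dist hcox sJ _ dq JSr); last exact: neq rz rq.
  rewrite (long_dist hcox sJ (q := psi q)) // ?hd //.
    by rewrite (residue_sign rz') (sgn J) // ex' -(residue_sign rz); exact: neq rz rq.
  apply: residue_trans (psir _ _ aJ rm) => //; apply: residue_sym => //; exact: psir.
have Mdist J z (z' : chamber D') b (b' : chamber D') : adm J -> MJ J z z' -> MJ J b b' -> dist z' b' = dist z b.
  move=> aJ [rz rz' hz] [rb rb' hb]; have sJ := adm_sph aJ; have [JS _] := sJ.
  have [q [rq dq]] := opp_proj hcox sJ xy rz.
  have dqz : dist q z = longest J by rewrite (dist_sym hcox) dq longestV.
  have dqz' : dist (psi q) z' = longest J by rewrite (dist_sym hcox) hz // dq longestV.
  have rzb := residue_trans hcox JS (residue_sym hcox rz) rb.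
  have rzb' := residue_trans hcox JS (residue_sym hcox rz') rb'.
  (* Multiplying by [longest J] turns the distance from [z] to [b] into the codistance from [q] to
     [b], and likewise for the images. *)
  apply: (mulgI (longest J)).
  rewrite -(long_dist hcox sJ _ dqz rzb); last exact: nesym (neq _ _ _ rz rq).
  rewrite -(long_dist hcox sJ _ dqz' rzb'); last first.
    by rewrite (residue_sign rz') (sgn J) // ex' -(residue_sign rz); exact: nesym (neq _ _ _ rz rq).
  by rewrite (dist_sym hcox b' _) (dist_sym hcox b _) hb.
have Mx J : adm J -> MJ J x x'.
  by move=> aJ; split; [exact: residue_refl|exact: residue_refl|move=> m; exact: dx'].
(* A chamber reached through two types lies in the residue of their intersection, and its projection
   at that type already determines the image. *)
have Mfun J K z (z' z'' : chamber D') : adm J -> adm K -> MJ J z z' -> MJ K z z'' -> z' = z''.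
  move=> aJ aK M1 M2; have aI := admI aJ aK; have sI := adm_sph aI.
  have [r1 r1' h1] := M1; have [r2 r2' h2'] := M2.
  have rI : residue (J `&` K)%fset x z by apply: residueI => //; exact: adm_sub.
  have rI' : residue (J `&` K)%fset x' z'.
    split; first by rewrite (residue_sign r1').
    by rewrite (Mdist J x x' z z' aJ (Mx _ aJ) M1); case: rI.
  have rI'' : residue (J `&` K)%fset x' z''.
    split; first by rewrite (residue_sign r2').
    by rewrite (Mdist K x x' z z'' aK (Mx _ aK) M2); case: rI.
  have [q [rq dq]] := opp_proj hcox sI xy rI.
  have rqJ : residue J y q by apply: residueS rq; exact: fsubsetIl.
  have rqK : residue K y q by apply: residueS rq; exact: fsubsetIr.
  apply: (@long_uniq _ _ hcox _ (J `&` K)%fset (psi q)) => //.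
  - rewrite (residue_sign rI') (sgn J) // ex' -(residue_sign rI); exact: nesym (neq _ _ _ rI rq).
  - by apply: (residue_trans hcox (adm_sub aI) _ rI''); apply: residue_sym.
  - by rewrite (dist_sym hcox) h1 // dq longestV.
  - by rewrite (dist_sym hcox) h2' // dq longestV.
have exf z : exists z' : chamber D', (sign z = sign y -> z' = psi z) /\
    (forall J, adm J -> residue J x z -> MJ J z z').
  have [e|ne] := pselect (sign z = sign y).
    by exists (psi z); split=> // J _ rz; case: (neq z y J rz (residue_refl _ _)).
  have [[J [aJ rz]]|nJ] := pselect (exists J, adm J /\ residue J x z); last first.
    by exists x'; split=> // J aJ rz; case: nJ; exists J.
  have [z' Mz'] := Mex J z aJ rz; exists z'; split=> // K aK rK.
  have [z2 Mz2] := Mex K z aK rK.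
  by rewrite (Mfun J K z z' z2 aJ aK Mz' Mz2).
have [f hf] := choice exf.
have fy J m : adm J -> residue J y m -> f m = psi m.
  by move=> _ rm; apply: (hf m).1; exact: residue_sign rm.
have fx J z : adm J -> residue J x z -> MJ J z (f z) by apply: (hf z).2.
have fxx : f x = x' by apply: (Mfun _ _ x _ _ adm0 adm0 (fx _ _ adm0 (residue_refl _ x)) (Mx _ adm0)).
exists f; split=> //; split=> // J aJ; have sJ := adm_sph aJ; have [JS _] := sJ.
have fsgn a : residue J x a -> sign (f a) = sign a.
  by move=> ra; have [_ ra' _] := fx J a aJ ra; rewrite (residue_sign ra') ex' (residue_sign ra).
split.
- by move=> a [ra|ra]; [exact: fsgn|rewrite (fy J) // (sgn J)].
- move=> a b [ra|ra] [rb|rb].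
  + by apply: (Mdist J) => //; exact: fx.
  + by have [_ _ h] := fx J a aJ ra; rewrite (fy J b) // h.
  + have [_ _ h] := fx J b aJ rb; rewrite (fy J a) // (dist_sym hcox _ (psi a)) h //.
    by rewrite -(dist_sym hcox).
  + by rewrite !(fy J) //; have [_ hd _] := V _ aJ; apply: hd.
- rewrite fxx => a' ra'.
  have [m' [rm' dm']] := opp_proj hcox sJ xy' ra'.
  have [_ _ /(_ _ rm') [m rm em]] := V _ aJ.
  have [z [rz dz]] := opp_proj hcox sJ (opposite_sym hcox xy) rm.
  exists z => //; have [_ rz' hz] := fx J z aJ rz.
  apply: (@long_uniq _ _ hcox _ J m') => //.
  + rewrite (residue_sign rm') sy (fsgn _ rz) (residue_sign rz); case: xy => ne _; exact: nesym.
  + by apply: (residue_trans hcox JS _ ra'); apply: residue_sym.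
  + by rewrite -em (dist_sym hcox) hz // (dist_sym hcox m) dz invgK.
  + by rewrite (dist_sym hcox) dm' longestV.
- rewrite (fy J y aJ (residue_refl J y)) => a' ra'.
  have [_ _ /(_ _ ra') [m rm em]] := V _ aJ; exists m => //.
  by rewrite (fy J).
Qed.

End Local.

(** * Rigidity, and changes of the base pair of a local isometry *)

Section Switch.
Variables (W : groupType) (S : {fset W}).
Hypothesis hcox : coxeter_system S.
Hypothesis h2 : two_spherical S.
Variables D D' : twin_building S.
Implicit Types (s t u v w : W) (J K : {fset W}).
Implicit Types (x y z q e h a b c k m : chamber D).
Implicit Types (f g psi : chamber D -> chamber D').

Local Notation longest := (longest S).
Local Notation adm := (adm S).

Lemma loc_sign J x y f a : loc J x y f -> residue J x a \/ residue J y a -> sign (f a) = sign a.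
Proof. by case=> h _ _ _; exact: h. Qed.

Lemma loc_dist J x y f a b : loc J x y f -> residue J x a \/ residue J y a ->
  residue J x b \/ residue J y b -> dist (f a) (f b) = dist a b.
Proof. by case=> _ h _ _; exact: h. Qed.

Lemma loc_opp J x y f a b : (J `<=` S)%fset -> loc J x y f -> residue J x a -> residue J y b ->
  opposite a b -> opposite (f a) (f b).
Proof.
move=> JS l ra rb [ne d]; split.
  by rewrite !(loc_sign l); [|right|left].
by rewrite (loc_dist l); [|left|right].
Qed.

Lemma sub1 s : s \in S -> ([fset s] `<=` S)%fset.
Proof. by move=> sS; apply/fsubsetP => j; rewrite inE => /eqP ->. Qed.

(** [e] is traded for a chamber [a] of the residue of [x] of type [J] meet [K] that has the same
    codistances to the residue of [y] of that type. By [opp_extend], [e] and [a] then agree on the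
    [J]-residue of [y], as do their images, and the pair of [a] and [u] is covered by the single
    type [J]. *)
Lemma LI_dist x y f K J e (u : chamber D) : LI x y f -> adm K -> residue K x e -> opposite e y ->
  adm J -> residue J y u -> dist (f e) (f u) = dist e u.
Proof.
move=> [xy lf] aK re ey aJ ru; have aI := admI aJ aK.
have sI := adm_sph hcox h2 aI; have sJ := adm_sph hcox h2 aJ; have sK := adm_sph hcox h2 aK.
have [JS _] := sJ; have [KS _] := sK; have [IS _] := sI.
have IJ : (J `&` K `<=` J)%fset := fsubsetIl J K.
have IK : (J `&` K `<=` K)%fset := fsubsetIr J K.
have [m [rm dm]] := opp_proj hcox sI ey (residue_refl _ e).
have [a [ra dma]] := opp_proj hcox sI (opposite_sym hcox xy) rm.
have dam : dist a m = longest (J `&` K)%fset by rewrite (dist_sym hcox m) dma longestV.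
have nem := opp_sign ey (residue_refl _ e) rm; have nam := opp_sign xy ra rm.
have agree k : residue (J `&` K)%fset y k -> dist e k = dist a k.
  move=> rk; have rmk := residue_trans hcox IS (residue_sym hcox rm) rk.
  by rewrite (long_dist hcox sI nem dm rmk) (long_dist hcox sI nam dam rmk).
have raK := residueS IK ra; have raJ := residueS IJ ra.
have rea := residue_trans hcox KS (residue_sym hcox re) raK.
have lK := lf _ aK; have lI := lf _ aI; have lJ := lf _ aJ.
have eau := opp_extend hcox sJ sK sI rea ey agree ru.
have ey' : opposite (f e) (f y) by apply: (loc_opp KS lK) => //; exact: residue_refl.
have rea' : residue K (f e) (f a).
  exact: (residue_trans hcox KS (residue_sym hcox (loc_res lK re)) (loc_res lK raK)).
rewrite (opp_extend hcox sJ sK sI rea' ey' _ (loc_resr lJ ru)).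
  by rewrite (loc_dist lJ) ?eau //; [left|right].
(* Surjectivity of [f] brings the comparison of the images back to the known agreement of [e] and
   [a]. *)
move=> m' rm'; have [_ _ _ /(_ _ rm') [k rk <-]] := lI.
have rkK := residueS IK rk.
rewrite (loc_dist lK); [|by left|by right].
by rewrite (loc_dist lK); [exact: agree|left|right].
Qed.

Lemma LI_switch x y f K e : LI x y f -> adm K -> residue K x e -> opposite e y ->
  exists g, [/\ LI e y g, g e = f e & forall J m, adm J -> residue J y m -> g m = f m].
Proof.
move=> lf aK re ey; have [xy l] := lf.
apply: (ext_local hcox h2) => // [J aJ| |J m aJ rm].
- by apply: loc_half; exact: l.
- by apply: (loc_sign (l _ aK)); left.
- exact: (LI_dist lf aK re ey aJ rm).
Qed.

(** Weaker than [loc], and [K] may have any rank. With [K = S] it covers both halves, so that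
    rigidity also yields the uniqueness of the extension. *)
Definition iso_on K x y f := forall a b, residue K x a \/ residue K y a ->
  residue K x b \/ residue K y b -> sign (f a) = sign a /\ dist (f a) (f b) = dist a b.

Lemma iso_on_sym K x y f : iso_on K x y f -> iso_on K y x f.
Proof. by move=> h a b /or_comm ra /or_comm rb; exact: h. Qed.

Lemma loc_iso K x y f : loc K x y f -> iso_on K x y f.
Proof. by move=> l a b ra rb; split; [exact: loc_sign l ra|exact: loc_dist l ra rb]. Qed.

(** A chamber [e] in a panel on [b] is the projection of a chamber [k] of the panel of the same type
    on [a]. As [f] and [g] agree at [b] and [k], both images of [e] are the projection of one
    chamber to one panel. *)
Lemma rigid_flip K x y f g a b : (K `<=` S)%fset -> opposite a b ->
  iso_on K x y f -> iso_on K x y g -> residue K x a -> residue K y b -> f b = g b ->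
  (forall s e, s \in K -> residue [fset s]%fset a e -> f e = g e) ->
  forall s e, s \in K -> residue [fset s]%fset b e -> f e = g e.
Proof.
move=> KS ab fi gi ra rb eb agree s e sK re; have sS := fsubsetP KS s sK.
have [k [rk dk]] := panel_opp_ex hcox sS (opposite_sym hcox ab) re.
have sK1 : ([fset s] `<=` K)%fset by rewrite fsub1set.
have reK : residue K y e := residue_trans hcox KS rb (residueS sK1 re).
have rkK : residue K x k := residue_trans hcox KS ra (residueS sK1 rk).
have ek := agree s k sK rk.
have ne : sign k <> sign e := opp_sign ab rk re.
have res (h : chamber D -> chamber D') : iso_on K x y h -> residue [fset s]%fset (h b) (h e).
  move=> hi; have [s1 _] := hi e b (or_intror reK) (or_intror rb).
  have [s2 d2] := hi b e (or_intror rb) (or_intror reK).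
  by split; [rewrite s1 s2 (residue_sign re)|rewrite d2; case: re].
have ds (h : chamber D -> chamber D') : iso_on K x y h -> dist (h k) (h e) = s.
  move=> hi; have [s1 ->] := hi k e (or_introl rkK) (or_intror reK).
  by rewrite (dist_sym hcox e) dk (genV hcox sS).
have [s1 _] := fi k e (or_introl rkK) (or_intror reK).
have [s2 _] := fi b e (or_intror rb) (or_intror reK).
apply: (@panel_opp_uniq _ _ hcox _ s (f b) (f k)) => //.
- by rewrite s1 s2 -(residue_sign re).
- exact: res.
- by rewrite eb; exact: res.
- exact: ds.
- by rewrite ek; exact: ds.
Qed.

(** The induction carries agreement on all panels around a chamber, since agreement at the chamber
    alone does not propagate. To pass from [c] to [e], a flip to [b] gives the value at some [k]
    opposite both; then flip from [c] to [k] and from [k] to [e]. *)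
Lemma rigid_half K x y f g : thick D -> (K `<=` S)%fset -> opposite x y ->
  iso_on K x y f -> iso_on K x y g -> f x = g x -> f y = g y ->
  (forall s e, s \in K -> residue [fset s]%fset x e -> f e = g e) ->
  forall a, residue K x a -> f a = g a.
Proof.
move=> hth KS xy fi gi ex ey agree a ra.
pose P a := exists b, [/\ residue K x a, residue K y b, opposite a b & f a = g a /\ f b = g b] /\
  forall s e, s \in K -> residue [fset s]%fset a e -> f e = g e.
suff [b [[_ _ _ []]]] : P a by [].
have fi' := iso_on_sym fi; have gi' := iso_on_sym gi.
apply: (residue_ind hcox KS _ _ ra) => [|c e s _ sK re].
  by exists y; split=> //; split=> //; exact: residue_refl.
move=> [b [[rc rb cb [ec eb]] agc]]; have sS := fsubsetP KS s sK.
have sK1 : ([fset s] `<=` K)%fset by rewrite fsub1set.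
have [k [rk ck ek]] := third_opp hcox hth sS cb (residue_refl _ c) re.
have rkK := residue_trans hcox KS rb (residueS sK1 rk).
have reK := residue_trans hcox KS rc (residueS sK1 re).
have agb := rigid_flip KS cb fi gi rc rb eb agc.
have agk := rigid_flip KS ck fi gi rc rkK (agb s k sK rk) agc.
exists k; split; first by split=> //; split; [exact: (agc s)|exact: (agb s)].
apply: (rigid_flip KS (opposite_sym hcox ek) fi' gi' rkK reK) => //.
exact: (agc s).
Qed.

Lemma rigid K x y f g : thick D -> (K `<=` S)%fset -> opposite x y ->
  iso_on K x y f -> iso_on K x y g -> f x = g x -> f y = g y ->
  (forall s e, s \in K -> residue [fset s]%fset x e -> f e = g e) ->
  forall a, residue K x a \/ residue K y a -> f a = g a.
Proof.
move=> hth KS xy fi gi ex ey agree a [ra|ra]; first exact: (rigid_half hth KS xy fi gi).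
have agy := rigid_flip KS xy fi gi (residue_refl _ x) (residue_refl _ y) ey agree.
exact: (rigid_half hth KS (opposite_sym hcox xy) (iso_on_sym fi) (iso_on_sym gi)).
Qed.

(** Three switches through a chamber [k] opposite both [x] and [e]: replace [y] by [k], [x] by [e],
    [k] by [h]. For [s] in [J] none of them leaves the two [J]-residues, where [loc_det] shows that
    nothing changes. *)
Lemma LI_move x y f s e h : thick D -> LI x y f -> s \in S -> residue [fset s]%fset x e ->
  residue [fset s]%fset y h -> opposite e h ->
  exists g, LI e h g /\ forall J, adm J -> s \in J ->
    forall a, residue J x a \/ residue J y a -> g a = f a.
Proof.
move=> hth lf sS re rh eh; have [xy _] := lf.
have [k [rk xk ek]] := third_opp hcox hth sS xy (residue_refl _ x) re.
have as1 := adm1 sS; have s1S := sub1 sS.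
have rkh := residue_trans hcox s1S (residue_sym hcox rk) rh.
have [f1 [l1 e1 a1]] := LI_switch (LI_sym hcox lf) as1 rk (opposite_sym hcox xk).
have [f2 [l2 e2 a2]] := LI_switch (LI_sym hcox l1) as1 re ek.
have [f3 [l3 e3 a3]] := LI_switch (LI_sym hcox l2) as1 rkh (opposite_sym hcox eh).
exists f3; split; first exact: (LI_sym hcox l3).
move=> J aJ sJ; have [JS _] := aJ; have sJs := adm_sph hcox h2 aJ.
have sJ1 : ([fset s] `<=` J)%fset by rewrite fsub1set.
have rxe := residueS sJ1 re; have ryh := residueS sJ1 rh; have ryk := residueS sJ1 rk.
have rkhJ := residueS sJ1 rkh.
have lJ := lf.2 _ aJ.
have lyx := loc_sym lJ; have JSx (z : chamber D) : residue J z z by exact: residue_refl.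
have lfk : loc J k x f := loc_base hcox JS ryk (JSx x) lyx.
have b1 a : residue J k a -> f1 a = f a.
  move=> ra; apply: (loc_det hcox sJs l1.1 (l1.2 _ aJ) lfk _ (JSx k) e1 ra).
  by move=> m; apply: a1.
have l1' : loc J e k f1.
  by apply: (loc_base hcox JS rxe (JSx k)); apply: loc_sym; exact: l1.2.
have b2 a : residue J e a -> f2 a = f1 a.
  move=> ra; apply: (loc_det hcox sJs l2.1 (l2.2 _ aJ) l1' _ (JSx e) e2 ra).
  by move=> m; apply: a2.
have l2' : loc J h e f2.
  by apply: (loc_base hcox JS rkhJ (JSx e)); apply: loc_sym; exact: l2.2.
have b3 a : residue J h a -> f3 a = f2 a.
  move=> ra; apply: (loc_det hcox sJs l3.1 (l3.2 _ aJ) l2' _ (JSx h) e3 ra).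
  by move=> m; apply: a3.
move=> a [ra|ra].
  have rea := residue_trans hcox JS (residue_sym hcox rxe) ra.
  by rewrite (a3 J) // b2 // (a1 J).
have rka := residue_trans hcox JS (residue_sym hcox ryk) ra.
have rha := residue_trans hcox JS (residue_sym hcox ryh) ra.
by rewrite b3 // (a2 J) // b1.
Qed.

End Switch.

Section PanelStep.
Variables (W : groupType) (S : {fset W}).
Hypothesis hcox : coxeter_system S.
Variable D : twin_building S.
Implicit Types (s t u v w : W) (x y z q e h a b k m d : chamber D).
Local Notation len := (len S).

(** Going from [q] through [d] to [y] shortens the codistance until [s] is left. Thus a chamber
    singled out by the remote [d] can be recognized from [y] alone. *)
Lemma codist_up_opp d x y q s : s \in S -> sign x <> sign y -> sign d = sign y ->
  residue [fset s]%fset x q -> dist d q = dist d y * s ->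
  (len (dist d y) < len (dist d y * s))%N -> dist y q = s.
Proof.
move=> sS ne sd rq dq lt; have sq := residue_sign rq.
have e : dist q d * dist d y = s.
  by rewrite (dist_sym hcox d q) dq invgM (genV hcox sS) -mulA mulVg mulg1.
have l : len (dist q d) = (len (dist d y)).+1.
  rewrite (dist_sym hcox d q) dq (lenV hcox).
  by case: (len_mulr_or hcox (dist d y) sS); move: lt; clear=> *; lia.
have := chain_sub hcox (x := q) (y := d) (z := y); rewrite e l (len_gen hcox sS).
by rewrite (dist_sym hcox q y) => -> //; rewrite ?sd ?sq ?(genV hcox sS).
Qed.

Lemma codist_down_opp d x y q s : s \in S -> sign x <> sign y -> sign d = sign y ->
  residue [fset s]%fset y q -> dist d q = dist d x * s ->
  (len (dist d x * s) < len (dist d x))%N -> dist x q = s.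
Proof.
move=> sS ne sd rq dq lt; have sq := residue_sign rq.
have e : dist x d * dist d q = s.
  by rewrite (dist_sym hcox d x) dq mulKg.
have l : len (dist x d) = (len (dist d q)).+1.
  rewrite (dist_sym hcox d x) dq (lenV hcox).
  by case: (len_mulr_or hcox (dist d x) sS) => *; lia.
have := chain_sub hcox (x := x) (y := d) (z := q); rewrite e l (len_gen hcox sS).
by move=> -> //; rewrite ?sd ?sq.
Qed.

Lemma shorter_uniq x y q s : s \in S -> sign q = sign x -> residue [fset s]%fset x y ->
  (len (dist q x) < len (dist q x * s))%N -> dist q y = dist q x -> x = y.
Proof.
move=> sS sq /(panelP hcox _ _ sS) [//|[sy dxy]] lt e; exfalso.
have := step_up hcox (x := q) sq sy sS dxy lt; rewrite e => e2.
by move: lt; rewrite -e2 ltnn.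
Qed.

End PanelStep.

(** * Extension to one half *)

Section HalfExtension.
Variables (W : groupType) (S : {fset W}).
Hypothesis hcox : coxeter_system S.
Hypothesis h2 : two_spherical S.
Variables D D' : twin_building S.
Hypothesis hth : thick D.
Implicit Types (s t u v w i : W) (J K : {fset W}).
Implicit Types (x y z q e h a b k m n : chamber D).
Implicit Types (f g psi fx fz fa fb fe fh fq ga gb : chamber D -> chamber D').

Local Notation len := (len S).
Local Notation longest := (longest S).
Local Notation adm := (adm S).

Variables (c d : chamber D) (f0 : chamber D -> chamber D').
Hypothesis h0 : LI c d f0.

(* y is the chamber at position v in the twin apartment of (c, d). *)
Definition apt v y := [/\ sign y = sign d, dist d y = v & dist c y = v].

Lemma apt_ex v : exists y, apt v y.
Proof.
have [y [sy dy cy]] := ex_chain hcox c d v.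
by exists y; split=> //; rewrite cy; case: h0 => -[_ ->] _; rewrite mul1g.
Qed.

Lemma cd_sign : sign c <> sign d. Proof. by case: h0 => -[]. Qed.

Lemma longer_uniq x y z s : sign x <> sign y -> s \in S -> residue [fset s]%fset y z ->
  (len (dist x y * s) < len (dist x y))%N -> dist x z = dist x y -> y = z.
Proof.
move=> ne sS /(panelP hcox _ _ sS) [//|[ez yz]] lt e; exfalso.
have := step_down hcox ne ez sS yz lt; rewrite e => e2; move: lt; rewrite -e2 ltnn //.
Qed.

(** By induction both chambers have the same predecessor, hence share a panel, in which only one
    chamber is farthest from [c]. *)
Lemma apt_uniq v y z : apt v y -> apt v z -> y = z.
Proof.
pose P v := forall y z, apt v y -> apt v z -> y = z.
apply: (@gen_ind _ _ hcox S P _ _ _ v (generatedT hcox v)) => // [|u s _ sS lus IHu {}y {}z].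
  move=> y' z' [s1 d1 _] [s2 d2 _]; have <- := (dist_eq1 (esym s1)).1 d1.
  exact: (dist_eq1 (esym s2)).1.
have pre h : apt (u * s) h -> exists2 k, apt u k & residue [fset s]%fset k h.
  move=> [sh dh ch]; have [k [sk dk kh hk]] := dist_ind_last hcox sh sS dh.
  exists k; last by apply/(panelP hcox _ _ sS); right; rewrite sk.
  split=> //; have := step_down hcox (x := c) (y := h) (z := k) _ _ sS hk.
  rewrite ch (mulg_gen hcox) // sh sk lus; apply=> //; exact: cd_sign.
move=> ay az; have [k ak rk] := pre y ay; have [k2 ak2 rk2] := pre z az.
have ek := IHu _ _ ak ak2; rewrite -ek in rk2.
have ryz := residue_trans hcox (sub1 sS) (residue_sym hcox rk) rk2.
have [sy dy cy] := ay; have [sz dz cz] := az.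
apply: (@longer_uniq c y z s) => //; rewrite ?cy ?cz ?sy //; first exact: cd_sign.
by rewrite (mulg_gen hcox) // lus.
Qed.

Variable apt_chamber : W -> chamber D.
Hypothesis hyy : forall v, apt v (apt_chamber v).

(** The retraction to the twin apartment of [c] and [d] centred at [d], read in the half of [d]. It
    chooses opposite chambers coherently: adjacent chambers get adjacent or equal partners. *)
Definition partner x := apt_chamber (dist d x).

Lemma apt_chamber_adj v s : s \in S -> residue [fset s]%fset (apt_chamber v) (apt_chamber (v * s)).
Proof.
move=> sS.
have up u : (len u < len (u * s))%N -> residue [fset s]%fset (apt_chamber u) (apt_chamber (u * s)).
  move=> lt; have [su du cu] := hyy u.
  have [z [sz dz cz]] := ex_adj c (apt_chamber u) sS.
  have -> : apt_chamber (u * s) = z.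
    apply: apt_uniq (hyy _) _; split; rewrite ?sz ?cz ?cu //.
    rewrite (step_up hcox (y := apt_chamber u) _ _ sS dz) ?du //.
  by apply/(panelP hcox _ _ sS); right.
case: (len_mulr_or hcox v sS) => l; first by apply: up; rewrite l.
have := up (v * s); rewrite (mulg_gen hcox) // l => /(_ (ltnSn _)).
exact: residue_sym.
Qed.

(** A gallery of type [dist d x] starting at [d] brings the codistance from [x] down from its
    inverse to 1. *)
Lemma partner_opp x : sign x = sign c -> opposite x (partner x).
Proof.
move=> sx; have [sy dy cy] := hyy (dist d x).
have ne : sign x <> sign d by rewrite sx; exact: cd_sign.
split; first by rewrite sy.
have e : dist x d * dist d (partner x) = 1 by rewrite dy (dist_sym hcox d x) mulVg.
rewrite (chain_sub hcox ne sy) // e (len1 hcox) add0n dy (dist_sym hcox d x) (lenV hcox).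
by [].
Qed.

Lemma partner_adj x e s : sign x = sign c -> s \in S -> residue [fset s]%fset x e ->
  residue [fset s]%fset (partner x) (partner e).
Proof.
move=> sx sS /(panelP hcox _ _ sS) [<-|[se de]]; first exact: residue_refl.
rewrite /partner; have [->|->] := step hcox d se sS de; first exact: residue_refl.
exact: apt_chamber_adj.
Qed.

Local Notation d' := (f0 d).

(** The last two clauses retain the position relative to [d'], which values near [x] and its partner
    alone do not record. *)
Definition good x f := [/\ sign x = sign c, LI x (partner x) f, dist d' (f x) = dist d x
  & dist d' (f (partner x)) = dist d x].

Lemma d'_sign : sign d' = sign d.
Proof. by apply: (loc_sign (h0.2 _ (adm0 S))); right; exact: residue_refl. Qed.

(** In the panels of [x] and of its partner, the chambers distinguished by [d] are also projections
    of the opposite chamber. [f] preserves projections, and so sends them to the chambers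
    distinguished by [d']. *)
Lemma good_step x f s e : good x f -> s \in S -> residue [fset s]%fset x e ->
  dist d' (f e) = dist d e /\ dist d' (f (partner e)) = dist d e.
Proof.
move=> [sx lf dfx dfy] sS re; have l := lf.2 _ (adm1 sS).
set y := partner x in dfy l; have [sy dy _] := hyy (dist d x); rewrite -/(partner x) -/y in sy dy.
have reY : residue [fset s]%fset y (partner e) := partner_adj sx sS re.
have rxx := residue_refl [fset s]%fset x; have ryy := residue_refl [fset s]%fset y.
have sfx : sign (f x) = sign x by apply: (loc_sign l); left.
have sfy : sign (f y) = sign y by apply: (loc_sign l); right.
have xy : sign x <> sign y by case: lf => -[].
have xy' : sign (f x) <> sign (f y) by rewrite sfx sfy.
have sdy : sign d = sign y by [].
have sdy' : sign d' = sign (f y) by rewrite sfy d'_sign.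
have dx : sign d <> sign x by rewrite sdy; exact: nesym.
have dx' : sign d' <> sign (f x) by rewrite sfx d'_sign.
have sdist a b : residue [fset s]%fset x a \/ residue [fset s]%fset y a ->
   residue [fset s]%fset x b \/ residue [fset s]%fset y b ->
   dist (f a) (f b) = dist a b by exact: loc_dist.
have ss a : residue [fset s]%fset x a -> sign (f a) = sign (f x).
  by move=> ra; rewrite (loc_sign l) ?(residue_sign ra) //; left.
case: (len_mulr_or hcox (dist d x) sS) => lw.
  (* Upward case: [q] is the chamber of the panel farthest from [d] and the projection of
     [partner x]. All other chambers of the panel share the partner of [x]. *)
  have [q [sq xq dq]] := ex_adj d x sS.
  have rq : residue [fset s]%fset x q by apply/(panelP hcox _ _ sS); right.
  have yq : dist y q = s by apply: (codist_up_opp hcox sS xy sdy rq); rewrite ?dy // lw.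
  have [q' [sq' xq' dq']] := ex_adj d' (f x) sS.
  have rq' : residue [fset s]%fset (f x) q' by apply/(panelP hcox _ _ sS); right.
  have yq' : dist (f y) q' = s.
    by apply: (codist_up_opp hcox sS xy' sdy' rq'); rewrite ?dfy ?dq' ?dfx // lw.
  have eq : q' = f q.
    apply: (panel_opp_uniq hcox sS (nesym xy') rq' (loc_res l rq) yq').
    by rewrite sdist //; [right|left].
  have rqe := residue_trans hcox (sub1 sS) (residue_sym hcox rq) re.
  case: ((panelP hcox _ _ sS).1 rqe) => [<-|[se qe]].
    split; first by rewrite -eq dq' dfx dq.
    have [su du _] := hyy (dist d q); rewrite -/(partner q) in su du.
    have : residue [fset s]%fset y (partner q) := partner_adj sx sS rq.
    case/(panelP hcox _ _ sS) => [e1|[e1 yu]].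
      by have := du; rewrite -e1 dy dq => h; move: lw; rewrite -h; lia.
    have ru : residue [fset s]%fset y (partner q) := partner_adj sx sS rq.
    rewrite (step_up hcox (x := d') (y := f y) (z := f (partner q)) (s := s)) //.
    - by rewrite dfy dq.
    - by rewrite (loc_sign l) ?sfy //; right.
    - by rewrite sdist //; right.
    - by rewrite dfy lw.
  have de : dist d e = dist d x.
    rewrite (step_down hcox (x := d) (y := q) (z := e) (s := s)) ?dq ?(mulg_gen hcox) ?lw //.
    by rewrite sq.
  have rfqe : residue [fset s]%fset (f q) (f e).
    exact: (residue_trans hcox (sub1 sS) (residue_sym hcox (loc_res l rq)) (loc_res l re)).
  split.
    rewrite de (step_down hcox (x := d') (y := f q) (z := f e) (s := s)) -?eq ?dq' ?dfx ?(mulg_gen hcox) ?lw //.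
    - by rewrite sq'.
    - by rewrite eq (residue_sign rfqe).
    - by rewrite eq sdist //; left.
  by rewrite /partner de -/(partner x) -/y dfy.
(* Downward case: [x] itself is farthest from [d], and [partner e] for any other [e] is the
   projection of [x]. *)
case: ((panelP hcox _ _ sS).1 re) => [<-|[se xe]]; first by [].
have de : dist d e = dist d x * s.
  by rewrite (step_down hcox (x := d) (y := x) (z := e) (s := s)) ?lw.
split.
  rewrite (step_down hcox (x := d') (y := f x) (z := f e) (s := s)) ?dfx ?lw //.
  - exact: ss.
  - by rewrite sdist //; left.
have [su du _] := hyy (dist d e); rewrite -/(partner e) in su du.
have xu : dist x (partner e) = s.
  by apply: (codist_down_opp hcox sS xy sdy reY); rewrite ?du ?de ?lw.
have [u' [su' yu' du']] := ex_adj d' (f y) sS.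
have ru' : residue [fset s]%fset (f y) u' by apply/(panelP hcox _ _ sS); right.
have xu' : dist (f x) u' = s.
  by apply: (codist_down_opp hcox sS xy' sdy' ru'); rewrite ?du' ?dfy ?dfx ?lw.
rewrite -(panel_opp_uniq hcox sS xy' ru' (loc_resr l reY) xu').
  by rewrite du' dfy de.
by rewrite sdist //; [left|right].
Qed.

Definition moved s x f e g := LI e (partner e) g /\ forall J, adm J -> s \in J ->
  forall a, residue J x a \/ residue J (partner x) a -> g a = f a.

(* The local isometries obtained from f0 by moving along minimal galleries from c. *)
Inductive reach : chamber D -> (chamber D -> chamber D') -> Prop :=
| reach0 : reach c f0
| reachS x f s e g : reach x f -> s \in S -> sign e = sign x -> dist x e = s ->
    dist c e = dist c x * s -> len (dist c e) = (len (dist c x)).+1 ->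
    moved s x f e g -> reach e g.

Lemma partner_c : partner c = d.
Proof. by apply: apt_uniq (hyy _) _; split; rewrite ?distxx // (dist_sym hcox c) ; case: h0 => -[_ ->] _; rewrite ?invg1. Qed.

Lemma moved_ex x f e s : LI x (partner x) f -> sign x = sign c -> s \in S -> residue [fset s]%fset x e ->
  exists g, moved s x f e g.
Proof.
move=> lf sx sS re; apply: (LI_move hcox h2 hth lf sS re).
  exact: partner_adj sx sS re.
by apply: partner_opp; rewrite (residue_sign re).
Qed.

Lemma moved_good x f e g s : good x f -> s \in S -> residue [fset s]%fset x e ->
  moved s x f e g -> good e g.
Proof.
move=> gx sS re [lg eg]; have [sx lf _ _] := gx; have [d1 d2] := good_step gx sS re.
have as1 := adm1 sS; have ss : s \in [fset s]%fset by rewrite inE.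
have ry := partner_adj sx sS re.
split; [by rewrite (residue_sign re)|by []| |].
  by rewrite (eg _ as1 ss) //; left.
by rewrite (eg _ as1 ss) //; right.
Qed.

Lemma reach_good x f : reach x f -> good x f.
Proof.
elim=> {x f} [|x f s e g _ gx sS se xe _ _ m].
  have l := h0.2 _ (adm0 S); have rc := residue_refl fset0 c; have rd := residue_refl fset0 d.
  rewrite /good partner_c; split=> //; first by rewrite (loc_dist l); [|right|left].
  by rewrite distxx (dist_sym hcox c) ; case: h0 => -[_ ->] _; rewrite invg1.
by apply: (moved_good gx sS _ m); apply/(panelP hcox _ _ sS); right.
Qed.

Lemma reach_ex x : sign x = sign c -> exists f, reach x f.
Proof.
move=> sx.
pose P v := forall x, sign x = sign c -> dist c x = v -> exists f, reach x f.
apply: (@gen_ind _ _ hcox S P _ _ _ _ (generatedT hcox (dist c x))) => // [y sy|u s _ sS lus IHu y sy dy].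
  by move/(dist_eq1 (esym sy)) => <-; exists f0; exact: reach0.
have [z [sz dz zy _]] := dist_ind_last hcox sy sS dy.
have [f rf] := IHu z sz dz; have [_ lf _ _] := reach_good rf.
have rzy : residue [fset s]%fset z y by apply/(panelP hcox _ _ sS); right; rewrite sz.
have [g mg] := moved_ex lf sz sS rzy.
by exists g; apply: (reachS rf sS _ zy _ _ mg); rewrite ?sz // ?dy dz.
Qed.

Definition near x f g := forall J, adm J -> forall a, residue J x a \/ residue J (partner x) a ->
  f a = g a.

Lemma LI_rigid x y f g J : LI x y f -> LI x y g -> f x = g x -> f y = g y ->
  (forall s e, s \in S -> residue [fset s]%fset x e -> f e = g e) -> adm J ->
  forall a, residue J x a \/ residue J y a -> f a = g a.
Proof.
move=> lf lg ex ey agree aJ; have [JS _] := aJ.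
apply: (rigid hcox hth JS lf.1 (loc_iso (lf.2 _ aJ)) (loc_iso (lg.2 _ aJ))) => // s e sJ.
by apply: agree; apply: (fsubsetP JS).
Qed.

(** The definition of [moved] settles the types containing [s]. A panel of type [k] around [e] lies
    in a residue of type [s], [k], so rigidity gives the remaining types. *)
Lemma near_moved x f1 f2 e g1 g2 s : sign x = sign c -> s \in S -> residue [fset s]%fset x e ->
  near x f1 f2 -> moved s x f1 e g1 -> moved s x f2 e g2 -> near e g1 g2.
Proof.
move=> sx sS re n12 [l1 m1] [l2 m2].
have ry := partner_adj sx sS re.
have key J a : adm J -> s \in J -> residue J e a \/ residue J (partner e) a -> g1 a = g2 a.
  move=> aJ sJ ra; have [JS _] := aJ.
  have sJ1 : ([fset s] `<=` J)%fset by rewrite fsub1set.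
  have ra' : residue J x a \/ residue J (partner x) a.
    by case: ra => ra; [left|right]; apply: (residue_trans hcox JS (residueS sJ1 _) ra).
  by rewrite (m1 J) // (m2 J) // (n12 J).
have ss : s \in [fset s]%fset by rewrite inE.
have as1 := adm1 sS.
move=> J aJ; apply: (LI_rigid l1 l2 _ _ _ aJ).
- by apply: (key _ _ as1 ss); left; exact: residue_refl.
- by apply: (key _ _ as1 ss); right; exact: residue_refl.
move=> k h kS rh; apply: (key [fset s; k]%fset) (adm2 sS kS) _ _; first by rewrite !inE eqxx.
left; apply: residueS rh; apply/fsubsetP => j; rewrite !inE => /eqP ->; rewrite eqxx orbT //.
Qed.

Lemma third_opp2 s x z y e h : s \in S -> opposite x y -> opposite z y ->
  residue [fset s]%fset x e -> residue [fset s]%fset z h ->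
  exists k, [/\ residue [fset s]%fset y k, opposite e k & opposite h k].
Proof.
move=> sS xy zy re rh.
have [a [ra da]] := panel_opp_ex hcox sS xy re; have [b [rb db]] := panel_opp_ex hcox sS zy rh.
have [k [rk ka kb]] := panel_third y a b hth sS.
have main x' e' a' : opposite x' y -> residue [fset s]%fset x' e' -> residue [fset s]%fset y a' ->
    dist e' a' = s -> k <> a' -> opposite e' k.
  move=> xy' re' ra' da' ka'; split; first exact: opp_sign xy' re' rk.
  have [//|dk] := panel_opp hcox sS xy' re' rk; case: ka'.
  exact: (panel_opp_uniq hcox sS (opp_sign xy' re' (residue_refl _ y)) rk ra' dk da').
by exists k; split; [|exact: main xy re ra da ka|exact: main zy rh rb db kb].
Qed.

(** Switching [g] from [z] to [x] keeps its values near [g0]. The result and [f] then share a base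
    pair and agree on all panels around [g0], which lie in residues of types containing [i], so
    [LI_rigid] applies. *)
Lemma join_E2 x z (g0 : chamber D) f g i K : LI x g0 f -> LI z g0 g -> adm K -> residue K z x ->
  f x = g x -> i \in S ->
  (forall J a, adm J -> i \in J -> residue J g0 a -> f a = g a) ->
  forall J a, adm J -> residue J g0 a -> f a = g a.
Proof.
move=> lf lg aK rzx ex iS agree J a aJ ra.
have [k [lk ek ak]] := LI_switch hcox h2 lg aK rzx lf.1.
have as1 := adm1 iS; have ii : i \in [fset i]%fset by rewrite inE.
have eg0 : f g0 = k g0.
  by rewrite (ak _ _ as1 (residue_refl _ _)); apply: (agree _ _ as1 ii); exact: residue_refl.
rewrite (LI_rigid (LI_sym hcox lf) (LI_sym hcox lk) eg0 _ _ aJ (or_introl ra)); first exact: ak aJ ra.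
  by rewrite ek.
move=> s e sS re; have rse : residue [fset i; s]%fset g0 e.
  by apply: residueS re; apply/fsubsetP => j; rewrite !inE => /eqP ->; rewrite eqxx orbT.
rewrite (ak _ _ (adm2 iS sS) rse); apply: (agree _ _ (adm2 iS sS) _ rse).
by rewrite !inE eqxx.
Qed.

(** * Parallel galleries in a rank two residue *)

Section RankTwo.
Variables (K : {fset W}) (p : chamber D) (f1 : chamber D -> chamber D').
Hypothesis aK : adm K.
Hypothesis sp : sign p = sign c.
Hypothesis lp : LI p (partner p) f1.

Let KS : (K `<=` S)%fset. Proof. by case: aK. Qed.

(** Inside the two [K]-residues all moves of types in [K] leave [f1] unchanged; only the values
    outside could depend on the gallery. *)
Definition on_K f := forall a, residue K p a \/ residue K (partner p) a -> f a = f1 a.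

Definition coherent x f := [/\ residue K p x, LI x (partner x) f & on_K f].

Lemma coherent_base : coherent p f1.
Proof. by split=> //; exact: residue_refl. Qed.

Lemma partner_res x : residue K p x -> residue K (partner p) (partner x).
Proof.
move=> rx; apply: (@residue_ind _ _ hcox _ K p (fun z => residue K (partner p) (partner z)) KS _ _ x rx) => [|a b s ra sK rab ryx]; first exact: residue_refl.
have sS := fsubsetP KS s sK.
have sK1 : ([fset s] `<=` K)%fset by rewrite fsub1set.
apply: (residue_trans hcox KS ryx); apply: (residueS sK1).
by apply: partner_adj => //; rewrite (residue_sign ra).
Qed.

Lemma coherent_step x f e g i : i \in K -> coherent x f -> residue [fset i]%fset x e -> moved i x f e g -> coherent e g.
Proof.
move=> iK [rx lf ff] re [lg mg].
have sK1 : ([fset i] `<=` K)%fset by rewrite fsub1set.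
split=> //; first exact: (residue_trans hcox KS rx (residueS sK1 re)).
move=> a ra; rewrite (mg K) //; first exact: ff.
have rxx := residue_sym hcox rx; have ryx := residue_sym hcox (partner_res rx).
by case: ra => ra; [left|right]; [exact: (residue_trans hcox KS rxx ra)|exact: (residue_trans hcox KS ryx ra)].
Qed.

(* The local isometry f at (x, partner x), with partner x replaced by k. *)
Definition switched x f k g := [/\ LI x k g, g k = f1 k & forall J a, adm J -> residue J x a -> g a = f a].

Lemma switched_ex x f k : coherent x f -> residue K (partner p) k -> opposite x k -> exists g, switched x f k g.
Proof.
move=> [rx lf ff] rk xk.
have ryk : residue K (partner x) k := residue_trans hcox KS (residue_sym hcox (partner_res rx)) rk.
have [g [lg eg ag]] := LI_switch hcox h2 (LI_sym hcox lf) aK ryk (opposite_sym hcox xk).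
exists g; split; [exact: LI_sym|by rewrite eg ff //; right|by move=> J a; exact: ag].
Qed.

(** On the side of [x] the switch keeps the values of [f]; on the other side [loc_det] recovers
    those of [f1] from them and from the value at [k]. *)
Lemma switched_K x f k g : coherent x f -> residue K (partner p) k -> switched x f k g -> on_K g.
Proof.
move=> [rx lf ff] rk [lg ek ag].
have rxp := residue_sym hcox rx.
have gx a : residue K p a -> g a = f1 a.
  move=> ra; rewrite (ag K) //; first by apply: ff; left.
  exact: (residue_trans hcox KS rxp ra).
move=> a [|ra]; first exact: gx.
have lK : loc K k p g.
  by apply: (loc_base hcox KS (residue_refl _ k) rxp); apply: loc_sym; exact: lg.2.
have lK1 : loc K k p f1.
  by apply: (loc_base hcox KS rk (residue_refl _ p)); apply: loc_sym; exact: lp.2.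
have lKx : loc K k x g by apply: loc_sym; exact: lg.2.
have lKx1 : loc K k x f1.
  by apply: (loc_base hcox KS (residue_refl _ k) rx lK1).
have rka := residue_trans hcox KS (residue_sym hcox rk) ra.
apply: (loc_det hcox (adm_sph hcox h2 aK) (opposite_sym hcox lg.1) lKx lKx1 _ (residue_refl _ k) ek rka).
by move=> m rm; apply: gx; exact: (residue_trans hcox KS rx rm).
Qed.

(** The invariant of the parallel galleries: seen from a common opposite chamber, the two local
    isometries coincide. *)
Definition joined x fx z fz := exists k fa fb, [/\ residue K (partner p) k, switched x fx k fa, switched z fz k fb
  & forall J a, adm J -> residue J k a -> fa a = fb a].

Lemma joined_of x fx z fz k i fa fb : i \in K -> coherent x fx -> coherent z fz -> residue K (partner p) k ->
  switched x fx k fa -> switched z fz k fb ->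
  (forall J a, adm J -> i \in J -> residue J k a -> fa a = fb a) -> joined x fx z fz.
Proof.
move=> iK kx kz rk sx sz agree; exists k, fa, fb; split=> //.
have iS := fsubsetP KS i iK; have [rx _ _] := kx; have [rz _ _] := kz.
have rzx := residue_trans hcox KS (residue_sym hcox rz) rx.
have [lfa _ _] := sx; have [lfb _ _] := sz.
apply: (join_E2 lfa lfb aK rzx _ iS agree).
by rewrite (switched_K kx rk sx) ?(switched_K kz rk sz) //; left.
Qed.

(* Both functions are determined on the i-residue of k by their values near x. *)
Lemma switched_move x f e g k h fa fb i : i \in K -> coherent x f -> residue [fset i]%fset x e ->
  moved i x f e g -> residue K (partner p) k -> residue [fset i]%fset k h ->
  switched x f k fa -> switched e g h fb ->
  forall J a, adm J -> i \in J -> residue J h a -> fb a = fa a.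
Proof.
move=> iK kx re m rk rh sx se J a aJ iJ ra.
have ke := coherent_step iK kx re m; have [lg mg] := m; have [JS _] := aJ.
have sK1 : ([fset i] `<=` K)%fset by rewrite fsub1set.
have sJ1 : ([fset i] `<=` J)%fset by rewrite fsub1set.
have rhK : residue K (partner p) h := residue_trans hcox KS rk (residueS sK1 rh).
have [lfa _ afa] := sx; have [lfb efb afb] := se.
have lb : loc J h e fb by apply: loc_sym; exact: lfb.2.
have la : loc J h e fa.
  by apply: (loc_base hcox JS (residueS sJ1 rh) (residueS sJ1 re)); apply: loc_sym; exact: lfa.2.
have eh : fb h = fa h.
  by rewrite efb (switched_K kx rk sx) //; right.
apply: (loc_det hcox (adm_sph hcox h2 aJ) (opposite_sym hcox lfb.1) lb la _ (residue_refl _ h) eh ra).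
move=> n rn; have rxn := residue_trans hcox JS (residueS sJ1 re) rn.
by rewrite (afb J) // (afa J) // (mg J) //; left.
Qed.

Lemma joined_base z fz i : i \in K -> residue [fset i]%fset p z -> moved i p f1 z fz -> joined p f1 z fz.
Proof.
move=> iK rz m; have iS := fsubsetP KS i iK; have kz := coherent_step iK coherent_base rz m.
have [k [rk pk zk]] := third_opp2 iS lp.1 lp.1 (residue_refl _ p) rz.
have sK1 : ([fset i] `<=` K)%fset by rewrite fsub1set.
have rkK := residueS sK1 rk.
have [fa sa] := switched_ex coherent_base rkK pk; have [fb sb] := switched_ex kz rkK zk.
apply: (joined_of iK coherent_base kz rkK sa sb) => J a aJ iJ ra.
exact/esym/(switched_move iK coherent_base rz m rkK (residue_refl _ k) sa sb aJ iJ ra).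
Qed.

(** A chamber [n] in the [i]-panel of [k] is opposite both new chambers. Neither move alters the
    values near [n] on types containing [i], and [joined_of] extends the agreement to all types. *)
Lemma joined_step x fx z fz e fe h fh i : i \in K -> coherent x fx -> coherent z fz ->
  residue [fset i]%fset x e -> residue [fset i]%fset z h ->
  moved i x fx e fe -> moved i z fz h fh -> joined x fx z fz -> joined e fe h fh.
Proof.
move=> iK kx kz re rh me mh [k [fa [fb [rk sa sb agree]]]].
have iS := fsubsetP KS i iK; have ke := coherent_step iK kx re me; have kh := coherent_step iK kz rh mh.
have [[xk _] _ _] := sa; have [[zk _] _ _] := sb.
have [n [rn en hn]] := third_opp2 iS xk zk re rh.
have sK1 : ([fset i] `<=` K)%fset by rewrite fsub1set.
have rnK := residue_trans hcox KS rk (residueS sK1 rn).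
have [ga sga] := switched_ex ke rnK en; have [gb sgb] := switched_ex kh rnK hn.
apply: (joined_of iK ke kh rnK sga sgb) => J a aJ iJ ra; have [JS _] := aJ.
have sJ1 : ([fset i] `<=` J)%fset by rewrite fsub1set.
rewrite (switched_move iK kx re me rk rn sa sga aJ iJ ra) (switched_move iK kz rh mh rk rn sb sgb aJ iJ ra).
by apply: (agree J) => //; exact: (residue_trans hcox JS (residueS sJ1 rn) ra).
Qed.

(** Coincidence near [k] gives by [loc_det] coincidence on the residues of [x] of types containing
    [i]. These contain [q] and all panels around it. *)
Lemma joined_end x fx q fq f i : i \in K -> coherent x fx -> coherent q fq -> residue [fset i]%fset x q ->
  moved i x fx q f -> joined x fx q fq -> near q f fq.
Proof.
move=> iK kx kq rq m [k [fa [fb [rk sa sb agree]]]].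
have iS := fsubsetP KS i iK; have kqf := coherent_step iK kx rq m.
have [lf mf] := m; have [rpq lq fq1] := kq; have [_ _ f_1] := kqf.
have sK1 : ([fset i] `<=` K)%fset by rewrite fsub1set.
have [la ea aa] := sa; have [lb eb ab] := sb; have [rpx _ _] := kx.
have key J a : adm J -> i \in J -> residue J q a -> f a = fq a.
  move=> aJ iJ ra; have [JS _] := aJ.
  have sJ1 : ([fset i] `<=` J)%fset by rewrite fsub1set.
  have rqJ := residueS sJ1 rq; have rxa := residue_trans hcox JS rqJ ra.
  rewrite (mf J) //; last by left.
  rewrite -(aa J) // -(ab J) //.
  have l1 := la.2 _ aJ.
  have l2 : loc J x k fb.
    by apply: (loc_base hcox JS (residue_sym hcox rqJ) (residue_refl _ k)); exact: lb.2.
  apply: (loc_det hcox (adm_sph hcox h2 aJ) la.1 l1 l2 _ (residue_refl _ x) _ rxa).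
    by move=> n; exact: agree.
  by rewrite (switched_K kx rk sa) ?(switched_K kq rk sb) //; left.
have ii : i \in [fset i]%fset by rewrite inE.
move=> J aJ; apply: (LI_rigid lf lq _ _ _ aJ).
- exact: (key _ _ (adm1 iS) ii (residue_refl _ q)).
- by rewrite f_1 ?fq1 //; right; exact: partner_res.
move=> s e sS re; have rse : residue [fset i; s]%fset q e.
  by apply: residueS re; apply/fsubsetP => j; rewrite !inE => /eqP ->; rewrite eqxx orbT.
by apply: (key _ _ (adm2 iS sS) _ rse); rewrite !inE eqxx.
Qed.

End RankTwo.

Lemma reach_inv q f : reach q f -> q = c /\ f = f0 \/
  exists x s fx, [/\ reach x fx, s \in S, sign q = sign x /\ dist x q = s,
    dist c q = dist c x * s /\ len (dist c q) = (len (dist c x)).+1 & moved s x fx q f].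
Proof.
case=> [|x fx s e g rx sS se de ce le m]; [by left|right].
by exists x, s, fx; split.
Qed.

Lemma moved_near_l s x f (k : chamber D -> chamber D') e g : moved s x f e g -> near x f k -> moved s x k e g.
Proof.
move=> [lg m] n; split=> // J aJ sJ a ra; rewrite (m J) //; exact: (n J).
Qed.

Lemma moved_near_r s x f e g (k : chamber D -> chamber D') : s \in S -> sign x = sign c -> residue [fset s]%fset x e ->
  moved s x f e g -> near e k g -> LI e (partner e) k -> moved s x f e k.
Proof.
move=> sS sx re [lg m] n lk; split=> // J aJ sJ a ra; rewrite -(m J) //; apply: (n J) => //.
have [JS _] := aJ; have ry := partner_adj sx sS re.
have sJ1 : ([fset s] `<=` J)%fset by rewrite fsub1set.
by case: ra => ra; [left|right];
  apply: (residue_trans hcox JS (residue_sym hcox (residueS sJ1 _)) ra).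
Qed.

Definition uniq_at x := forall f g, reach x f -> reach x g -> near x f g.

(* Two predecessors x and y of q span with q a rank 2 residue, in which p is
   closest to c.  A gallery from p towards x and one from p through y to q, one
   step ahead of the former, are followed in parallel; [joined] is preserved. *)
Lemma uniq_step q : sign q = sign c ->
  (forall x, sign x = sign c -> (len (dist c x) < len (dist c q))%N -> uniq_at x) -> uniq_at q.
Proof.
move=> sq IH f g rf rg.
have l0 : len (dist c c) = 0%N by rewrite distxx (len1 hcox).
have [[eq ->]|[x [s [fx [rx sS [sx dx] [cx lx] mx]]]]] := reach_inv rf.
  have [[_ ->] //|[x [s [fx [_ _ _ [_ lx] _]]]]] := reach_inv rg.
  by move: lx; rewrite eq l0.
have [[eq _]|[y [t [fy [ry tS [sy dy] [cy ly] my]]]]] := reach_inv rg.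
  by move: lx; rewrite eq l0.
have sxc : sign x = sign c by rewrite -sx.
have syc : sign y = sign c by rewrite -sy.
have rxq : residue [fset s]%fset x q by apply/(panelP hcox _ _ sS); right.
have ryq : residue [fset t]%fset y q by apply/(panelP hcox _ _ tS); right.
have ux : uniq_at x by apply: IH => //; rewrite lx.
have uy : uniq_at y by apply: IH => //; rewrite ly.
have [est|nst] := pselect (s = t).
  rewrite -est in ryq cy my.
  have rxy := residue_trans hcox (sub1 sS) rxq (residue_sym hcox ryq).
  have exy : x = y.
    apply: (shorter_uniq hcox sS (esym sxc) rxy); first by rewrite -cx lx.
    by apply: (mulIg s); rewrite -cx.
  rewrite -exy in my ry; apply: (near_moved sxc sS rxq _ mx my); exact: ux.
pose K := [fset s; t]%fset; have aK : adm K := adm2 sS tS.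
have sK := adm_sph hcox h2 aK; have [KS _] := sK.
have sinK : s \in K by rewrite !inE eqxx.
have tinK : t \in K by rewrite !inE eqxx orbT.
have sK1 : ([fset s] `<=` K)%fset by rewrite fsub1set.
have tK1 : ([fset t] `<=` K)%fset by rewrite fsub1set.
have [p [rqp proj]] := proj_same_ex hcox KS (esym sq).
have rpq := residue_sym hcox rqp; have sp : sign p = sign c by rewrite (residue_sign rqp).
have rpx := residue_trans hcox KS rpq (residue_sym hcox (residueS sK1 rxq)).
have rpy := residue_trans hcox KS rpq (residue_sym hcox (residueS tK1 ryq)).
have [eq lq] := proj _ rpq; have [ex lex] := proj _ rpx; have [ey ley] := proj _ rpy.
have px : dist p x = dist p q * s.
  apply: (mulgI (dist c p)); rewrite -ex; apply: (mulIg s).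
  by rewrite -cx eq -!mulA (gen2 hcox sS) mulg1.
have py : dist p y = dist p q * t.
  apply: (mulgI (dist c p)); rewrite -ey; apply: (mulIg t).
  by rewrite -cy eq -!mulA (gen2 hcox tS) mulg1.
have gq : generated K (dist p q) by case: rpq.
have lpx : len (dist p q) = (len (dist p q * s)).+1 by rewrite -px; move: lex lq lx; clear=> *; lia.
have lpy : len (dist p q) = (len (dist p q * t)).+1 by rewrite -py; move: ley lq ly; clear=> *; lia.
have er : dist p q = longest K.
  apply: longest_uniq => // j; rewrite !inE => /orP[/eqP ->|/eqP ->]; first by rewrite lpx.
  by rewrite lpy.
set r := dist p q in er px py gq lpx lpy lq.
have exst z : exists f, sign z = sign c -> reach z f.
  have [sz|nz] := pselect (sign z = sign c); last by exists f0.
  by have [k rk] := reach_ex sz; exists k.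
have [st hst] := choice exst.
have rp : reach p (st p) := hst _ sp.
have [_ lp _ _] := reach_good rp.
have Klow z : residue K p z -> (len (dist p z) < len r)%N ->
   sign z = sign c /\ (len (dist c z) < len (dist c q))%N.
  move=> rz lz; split; first by rewrite (residue_sign rz).
  by have [_ ->] := proj _ rz; move: lz lq; clear=> *; lia.
(* The choices [st] are independent of each other, but by uniqueness closer to [c] each agrees near
   its chamber with the move of the previous one, and [moved] depends on nothing else. *)
have stmv z e i : i \in K -> residue K p z -> residue K p e -> sign e = sign z -> dist z e = i ->
    dist p e = dist p z * i -> len (dist p e) = (len (dist p z)).+1 ->
    (len (dist p e) < len r)%N -> moved i z (st z) e (st e).
  move=> iK rz re se de pe le lt; have iS := fsubsetP KS i iK.
  have [se' lte] := Klow _ re lt; have sz : sign z = sign c by rewrite -se.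
  have [_ lz _ _] := reach_good (hst _ sz).
  have rze : residue [fset i]%fset z e by apply/(panelP hcox _ _ iS); right.
  have [k mk] := moved_ex lz sz iS rze.
  have [e1 l1] := proj _ rz; have [e2 l2] := proj _ re.
  have rk : reach e k.
    apply: (reachS (hst _ sz) iS se de _ _ mk); first by rewrite e1 e2 pe mulA.
    by move: l1 l2 le; clear=> *; lia.
  have [_ le' _ _] := reach_good (hst _ se').
  apply: (moved_near_r iS sz rze mk _ le').
  by apply: IH => //; exact: hst.
have stkf z : residue K p z -> (len (dist p z) < len r)%N -> coherent K p (st p) z (st z).
  move=> [ez gz].
  pose P v := forall z, dist p z = v -> sign z = sign p -> (len v < len r)%N ->
    coherent K p (st p) z (st z).
  apply: (@gen_ind _ _ hcox K P KS _ _ _ gz z (erefl _) ez) => [z' e sz' _|u i gu iK lui IHu z' dz sz' lt].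
    by rewrite -((dist_eq1 (esym sz')).1 e); exact: coherent_base.
  have iS := fsubsetP KS i iK.
  have [b [sb db dbz _]] := dist_ind_last hcox sz' iS dz.
  have kb := IHu _ db sb; rewrite lui in lt; have kb' := kb (ltnW lt).
  have rb : residue K p b by split=> //; rewrite db.
  have rz : residue K p z' by split=> //; rewrite dz; apply: generatedM => //; exact: generated_gen.
  have m : moved i b (st b) z' (st z') by apply: stmv; rewrite ?dz ?db ?sz' ?lui.
  by apply: (coherent_step aK sp iK kb' _ m); apply/(panelP hcox _ _ iS); right; rewrite sb.
(* Galleries of the same type [v], one from [p] and one from its [i]-neighbour, stay joined as long
   as [i * v] is shorter than [r]. *)
have claim i : i \in K -> forall v, generated K v -> forall x z, dist p x = v -> dist p z = i * v ->
    sign x = sign p -> sign z = sign p -> len (i * v) = (len v).+1 -> (len (i * v) < len r)%N ->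
    joined K p (st p) x (st x) z (st z).
  move=> iK v gv; have iS := fsubsetP KS i iK.
  pose P v := forall x z, dist p x = v -> dist p z = i * v ->
    sign x = sign p -> sign z = sign p -> len (i * v) = (len v).+1 -> (len (i * v) < len r)%N ->
    joined K p (st p) x (st x) z (st z).
  apply: (@gen_ind _ _ hcox K P KS _ _ v gv) => [a b|u j gu jK luj IHu a b da db sa sb lb ltb].
    move=> /[swap]; rewrite mulg1 => db /[swap] sa /[swap] sb.
    rewrite (len_gen hcox iS) => da _ lt; rewrite -((dist_eq1 (esym sa)).1 da).
    have rb : residue [fset i]%fset p b by apply/(panelP hcox _ _ iS); right.
    have iK1 : ([fset i] `<=` K)%fset by rewrite fsub1set.
    apply: (joined_base aK sp lp iK rb); apply: stmv => //; rewrite ?distxx ?mul1g //.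
    - exact: residue_refl.
    - exact: residueS rb.
    - by rewrite db (len_gen hcox iS) (len1 hcox).
    - by rewrite db (len_gen hcox iS).
  have jS := fsubsetP KS j jK.
  have gi : generated K i by exact: generated_gen.
  have gj : generated K j by exact: generated_gen.
  have liu : len (i * u) = (len u).+1.
    have := lenM hcox i u; rewrite (len_gen hcox iS) => h1.
    have := lenM hcox (i * u) j; rewrite (len_gen hcox jS) => h3.
    by move: lb; rewrite mulA; move: h1 h3 luj; clear=> *; lia.
  rewrite mulA in db lb ltb.
  have [a0 [sa0 da0 a0a _]] := dist_ind_last hcox sa jS da.
  have [b0 [sb0 db0 b0b _]] := dist_ind_last hcox sb jS db.
  have inv0 : joined K p (st p) a0 (st a0) b0 (st b0).
    by apply: IHu => //; move: ltb; rewrite lb liu luj; clear=> *; lia.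
  have ra0 : residue K p a0 by split=> //; rewrite da0.
  have rb0 : residue K p b0 by split=> //; rewrite db0; exact: generatedM.
  have ra : residue K p a by split=> //; rewrite da; exact: generatedM.
  have rb : residue K p b by split=> //; rewrite db; exact: (generatedM (generatedM gi gu) gj).
  have ma : moved j a0 (st a0) a (st a).
    by apply: stmv; rewrite ?sa ?da ?da0 ?luj // -luj; move: ltb lb liu luj; clear=> *; lia.
  have mb : moved j b0 (st b0) b (st b).
    by apply: stmv; rewrite ?sb ?db ?db0 //; rewrite lb luj liu.
  apply: (joined_step aK sp lp jK _ _ _ _ ma mb inv0).
  - by apply: stkf; rewrite ?da0 //; move: ltb lb liu luj; clear=> *; lia.
  - by apply: stkf; rewrite ?db0 //; move: ltb lb liu luj; clear=> *; lia.
  - by apply/(panelP hcox _ _ jS); right; rewrite sa0.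
  - by apply/(panelP hcox _ _ jS); right; rewrite sb0.
have gs : generated K s := generated_gen sinK.
have rr : r * r = 1 by rewrite er longest2.
(* [i] is chosen so that [i * (r * s) = r]: after the first step [i], the gallery through [y] to [q]
   has the same type as the one from [p] to [x]. Their common last letter is [t], and removing it
   leaves the pair [x0], [y]. *)
pose i := r * (s * r).
have gi : generated K i := generatedM gq (generatedM gs gq).
have li : len i = 1%N.
  have := len_longest hcox sK (generatedM gs gq); rewrite -er -/i.
  have := len_longest_l hcox sK gs; rewrite -er (len_gen hcox sS); clear=> *; lia.
have iK : i \in K by apply: (gen_simple hcox KS _ gi); exact: len_le1 li.
have iS := fsubsetP KS i iK.
have irs : i * (r * s) = r by rewrite /i -!mulA (mulA r r) rr mul1g (gen2 hcox sS) mulg1.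
have rs1 : r * s <> 1.
  move=> e; have es : r = s by rewrite -(mulg_gen hcox r sS) e mul1g.
  move: lpy; rewrite es (len_gen hcox sS) => -[/esym /(len_eq0 hcox) e2]; case: nst.
  by rewrite -(mulg_gen hcox s tS) e2 mul1g.
have [j [jK gj lj]] := gen_descent hcox KS (generatedM gq gs) rs1.
have ej : j = t.
  move: jK lj; rewrite !inE => /orP[/eqP -> | /eqP -> //].
  by rewrite (mulg_gen hcox) // lpx; clear=> *; lia.
subst j.
have rx0 : dist p x = (r * s * t) * t by rewrite (mulg_gen hcox).
have [x0 [sx0 dx0 x0x _]] := dist_ind_last hcox (residue_sign rpx) tS rx0.
have irst : i * (r * s * t) = r * t by rewrite mulA irs.
have inv0 : joined K p (st p) x0 (st x0) y (st y).
  apply: (claim i iK _ gj) => //; rewrite ?irst //.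
  - exact: residue_sign rpy.
  - by move: lpx lpy lj; clear=> *; lia.
  - by rewrite [X in (_ < X)%N]lpy.
have rx0' : residue K p x0 by split=> //; rewrite dx0.
have m0 : moved t x0 (st x0) x (st x).
  apply: stmv; rewrite ?px ?dx0 ?(mulg_gen hcox) //.
  - by rewrite sx0 (residue_sign rpx).
  - by rewrite [X in (_ < X)%N]lpx.
have my' : moved t y (st y) q g by apply: (moved_near_l my); apply: uy => //; exact: hst.
have mx' : moved s x (st x) q f by apply: (moved_near_l mx); apply: ux => //; exact: hst.
have kx : coherent K p (st p) x (st x) by apply: stkf => //; rewrite px [X in (_ < X)%N]lpx.
have ky : coherent K p (st p) y (st y) by apply: stkf => //; rewrite py [X in (_ < X)%N]lpy.
have kq : coherent K p (st p) q g := coherent_step aK sp tinK ky ryq my'.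
have kx0 : coherent K p (st p) x0 (st x0).
  by apply: stkf => //; rewrite dx0; move: lpx lj; clear=> *; lia.
have rx0x : residue [fset t]%fset x0 x.
  by apply/(panelP hcox _ _ tS); right; rewrite sx0 (residue_sign rpx).
apply: (joined_end aK sp lp sinK kx kq rxq mx').
exact: (joined_step aK sp lp tinK kx0 ky rx0x ryq m0 my' inv0).
Qed.

Lemma reach_uniq q : sign q = sign c -> uniq_at q.
Proof.
have [n] := ubnP (len (dist c q)); elim: n q => // n IHn q lt sq.
apply: uniq_step => // x sx lx; apply: IHn => //; move: lt lx; clear=> *; lia.
Qed.

Lemma st_ex : exists st : chamber D -> chamber D -> chamber D',
  forall x, sign x = sign c -> reach x (st x).
Proof.
have exst z : exists f, sign z = sign c -> reach z f.
  have [sz|nz] := pselect (sign z = sign c); last by exists f0.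
  by have [k rk] := reach_ex sz; exists k.
by have [st hst] := choice exst; exists st.
Qed.

Variable st : chamber D -> chamber D -> chamber D'.
Hypothesis hst : forall x, sign x = sign c -> reach x (st x).

Lemma st_moved x e s : s \in S -> sign x = sign c -> sign e = sign x -> dist x e = s ->
  dist c e = dist c x * s -> len (dist c e) = (len (dist c x)).+1 -> moved s x (st x) e (st e).
Proof.
move=> sS sx se de ce le.
have se' : sign e = sign c by rewrite se.
have [_ lx _ _] := reach_good (hst sx).
have rxe : residue [fset s]%fset x e by apply/(panelP hcox _ _ sS); right.
have [k mk] := moved_ex lx sx sS rxe.
have rk : reach e k by apply: (reachS (hst sx) sS se de ce le mk).
have [_ le' _ _] := reach_good (hst se').
apply: (moved_near_r sS sx rxe mk _ le').
by apply: (reach_uniq se') => //; exact: hst.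
Qed.

(** If neither of the two chambers is the one of the panel nearest to [c], both are compared with
    that nearest chamber [y]. *)
Lemma st_adj x e s J a : s \in S -> sign x = sign c -> residue [fset s]%fset x e ->
  adm J -> s \in J -> residue J x a \/ residue J (partner x) a -> st e a = st x a.
Proof.
move=> sS sx re aJ sJ ra; have [JS _] := aJ.
have sJ1 : ([fset s] `<=` J)%fset by rewrite fsub1set.
have tr y : sign y = sign c -> residue [fset s]%fset y x -> residue J y a \/ residue J (partner y) a.
  move=> sy ryx; have ry2 := partner_adj sy sS ryx.
  by case: ra => ra; [left|right]; apply: (residue_trans hcox JS (residueS sJ1 _) ra).
case: ((panelP hcox _ _ sS).1 re) => [<-//|[se de]].
have se' : sign e = sign c by rewrite se.
case: (step hcox c se sS de) => ce.
  have lt : (len (dist c x * s) < len (dist c x))%N.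
    case: (len_mulr_or hcox (dist c x) sS) => l; last by rewrite l.
    have := step_up hcox (esym sx) se sS de; rewrite l ce => /(_ (ltnSn _)) e1.
    by move: l; rewrite -e1; lia.
  have [y [sy xy cy]] := ex_adj c x sS.
  have sy' : sign y = sign c by rewrite sy.
  have ry : residue [fset s]%fset y x by apply: (residue_sym hcox); apply/(panelP hcox _ _ sS); right.
  have ly : len (dist c x) = (len (dist c y)).+1.
    by rewrite cy; case: (len_mulr_or hcox (dist c x) sS) lt => ->; clear=> *; lia.
  have cx : dist c x = dist c y * s by rewrite cy (mulg_gen hcox).
  have dyx : dist y x = s by rewrite (adj_sym hcox sS sy xy).
  have [_ m1] := st_moved sS sy' (esym sy) dyx cx ly.
  have rye := residue_trans hcox (sub1 sS) ry re.
  case: ((panelP hcox _ _ sS).1 rye) => [eye|[sye dye]].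
    by move: ly; rewrite eye ce; clear=> *; lia.
  have [_ m2] := st_moved sS sy' sye dye (etrans ce cx) (etrans (congr1 len ce) ly).
  by rewrite (m1 J) ?(m2 J) //; exact: tr.
case: (len_mulr_or hcox (dist c x) sS) => l.
  have le : len (dist c e) = (len (dist c x)).+1 by rewrite ce.
  by have [_ m] := st_moved sS sx se de ce le; apply: (m J).
have le : len (dist c x) = (len (dist c e)).+1 by rewrite ce.
have ce' : dist c x = dist c e * s by rewrite ce (mulg_gen hcox).
have [_ m] := st_moved sS se' (esym se) (adj_sym hcox sS se de) ce' le.
by rewrite (m J) //; apply: tr => //; exact: residue_sym re.
Qed.

Definition Om x := st x x.

Lemma Om_sign x : sign x = sign c -> sign (Om x) = sign x.
Proof.
move=> sx; have [_ lx _ _] := reach_good (hst sx).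
by apply: (loc_sign (lx.2 _ (adm0 S))); left; exact: residue_refl.
Qed.

Lemma Om_panel x e s : s \in S -> sign x = sign c -> residue [fset s]%fset x e -> Om e = st x e.
Proof.
move=> sS sx re; apply: (st_adj sS sx re (adm1 sS)); first by rewrite inE.
by left.
Qed.

Lemma Om_dist x e : sign x = sign c -> sign e = sign c -> dist (Om x) (Om e) = dist x e.
Proof.
move=> sx se.
pose P v := forall e, dist x e = v -> sign e = sign x -> dist (Om x) (Om e) = v.
apply: (@gen_ind _ _ hcox S P _ _ _ _ (generatedT hcox (dist x e)) e (erefl _)) => //;
  last by rewrite se.
  by move=> y /dist_eq1 dy sy; rewrite dy ?distxx.
move=> u s _ sS lus IHu y dy sy.
have [z [sz dz zy _]] := dist_ind_last hcox sy sS dy.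
have sz' : sign z = sign c by rewrite sz.
have rzy : residue [fset s]%fset z y by apply/(panelP hcox _ _ sS); right; rewrite sz.
have [_ lz _ _] := reach_good (hst sz').
have dO : dist (Om z) (Om y) = s.
  rewrite (Om_panel sS sz' rzy) (loc_dist (lz.2 _ (adm1 sS))) //; left=> //.
  exact: residue_refl.
have sO h : sign h = sign x -> sign (Om h) = sign x by move=> sh; rewrite Om_sign ?sh.
rewrite (step_up hcox (y := Om z) _ _ sS dO) ?(IHu z) ?lus // !sO //.
Qed.

Lemma Om_onto (x' : chamber D') : sign x' = sign c -> exists2 x, sign x = sign c & Om x = x'.
Proof.
move=> sx'; have sOc : sign (Om c) = sign c by rewrite Om_sign.
pose P v := forall x' : chamber D', dist (Om c) x' = v -> sign x' = sign (Om c) ->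
  exists2 x, sign x = sign c & Om x = x'.
apply: (@gen_ind _ _ hcox S P _ _ _ _ (generatedT hcox (dist (Om c) x')) x' (erefl _)) => //;
  last by rewrite sx'.
  by move=> y dy sy; exists c => //; apply/dist_eq1.
move=> u s _ sS lus IHu y dy sy.
have [z [sz dz zy _]] := dist_ind_last hcox sy sS dy.
have [x sx ex] := IHu z dz sz.
have [_ lx _ _] := reach_good (hst sx).
have [_ _ onto _] := lx.2 _ (adm1 sS).
have rzy : residue [fset s]%fset (st x x) y.
  by rewrite -/(Om x) ex; apply/(panelP hcox _ _ sS); right; rewrite sz.
have [e re ee] := onto _ rzy.
by exists e; [rewrite (residue_sign re)|rewrite (Om_panel sS sx re)].
Qed.

(** Steps of types in [J] do not change values on the [J]-residue of [c], so there every [st a] has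
    the values of [st c], hence of [f0]. *)
Lemma Om_E2 J a : adm J -> residue J c a -> Om a = f0 a.
Proof.
move=> aJ ra; have [JS _] := aJ.
suff h : residue J c a /\ forall b, residue J c b -> st a b = st c b.
  rewrite /Om h.2 //; apply: (reach_uniq (erefl _) (hst (erefl _)) reach0 aJ); by left.
apply: (@residue_ind _ _ hcox _ J c (fun a => residue J c a /\ forall b, residue J c b -> st a b = st c b) JS _ _ a ra).
  by split=> //; exact: residue_refl.
move=> x e s rx sJ re [_ IH]; have sS := fsubsetP JS s sJ.
have sJ1 : ([fset s] `<=` J)%fset by rewrite fsub1set.
split; first exact: (residue_trans hcox JS rx (residueS sJ1 re)).
move=> b rb; rewrite -IH //; apply: (st_adj sS (residue_sign rx) re aJ sJ); left.
exact: (residue_trans hcox JS (residue_sym hcox rx) rb).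
Qed.

Lemma Om_base x : sign x = sign c -> dist d' (Om x) = dist d x.
Proof. by move=> sx; case: (reach_good (hst sx)). Qed.

End HalfExtension.

Lemma half_extension (W : groupType) (S : {fset W}) (D D' : twin_building S)
    (c d : chamber D) (f0 : chamber D -> chamber D') :
  coxeter_system S -> two_spherical S -> thick D -> LI c d f0 ->
  exists Om : chamber D -> chamber D',
    [/\ forall x, sign x = sign c -> sign (Om x) = sign x,
        forall x y, sign x = sign c -> sign y = sign c -> dist (Om x) (Om y) = dist x y,
        forall x', sign x' = sign c -> exists2 x, sign x = sign c & Om x = x',
        forall x, sign x = sign c -> dist (f0 d) (Om x) = dist d x
      & forall J a, adm S J -> residue J c a -> Om a = f0 a].
Proof.
move=> hcox h2 hth h0.
have [yy hyy] := choice (apt_ex hcox h0).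
have [st hst] := st_ex hcox h2 hth h0 hyy.
exists (Om st); split.
- exact: (Om_sign hcox h0 hyy hst).
- exact: (Om_dist hcox h2 hth h0 hyy hst).
- exact: (Om_onto hcox h2 hth h0 hyy hst).
- exact: (Om_base hcox h0 hyy hst).
- exact: (Om_E2 hcox h2 hth h0 hyy hst).
Qed.

(** * Crossing walls *)

Section Panels.
Variables (W : groupType) (S : {fset W}).
Hypothesis hcox : coxeter_system S.
Variable D : twin_building S.
Implicit Types (s t u v w i j : W) (J K : {fset W}).
Implicit Types (x y z q e h a b k m p : chamber D) (P Q R : set (chamber D)).

Local Notation len := (len S).
Local Notation longest := (longest S).

Lemma residue_type_sub J K x y : (J `<=` S)%fset -> (K `<=` S)%fset ->
  residue J x `<=` residue K y -> (J `<=` K)%fset.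
Proof.
move=> JS KS sub; apply/fsubsetP => j jJ; have jS := fsubsetP JS j jJ.
have ryx : residue K y x by apply: sub; exact: residue_refl.
have [z [sz xz _]] := ex_adj x x jS.
have ryz : residue K y z by apply: sub; split=> //; rewrite xz; exact: generated_gen.
have [_] := residue_trans hcox KS (residue_sym hcox ryx) ryz.
by rewrite xz; exact: (gen_simple hcox KS jS).
Qed.

Lemma residue_type J K x y : (J `<=` S)%fset -> (K `<=` S)%fset ->
  residue J x = residue K y -> J = K.
Proof.
move=> JS KS e; apply/eqP; rewrite eqEfsubset; apply/andP; split.
  by apply: (residue_type_sub (x := x) (y := y) JS KS) => z; rewrite e.
by apply: (residue_type_sub (x := y) (y := x) KS JS) => z; rewrite e.
Qed.

Lemma adjacent_data J R P Q : adjacent_via J R P Q ->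
  exists x y i j, [/\ spherical S J, R = residue J x, residue J x y, dist x y = longest J &
    [/\ P = residue [fset i]%fset x, Q = residue [fset j]%fset y, i \in J, j \in J
      & i = longest J * j * longest J]].
Proof.
move=> [[i [iS [x1 Px1]]] [j [jS [y1 Qy1]]] _ [sJ [JS [z Rz]] PR QR
  [J1 [J2 [[J1S [x2 Px2]] [J2S [y2 Qy2]] eJ [x [y [Px Qy dxy]]]]]]]].
have e1 : J1 = [fset i]%fset := (residue_type J1S iS (etrans (esym Px2) Px1)).
have e2 : J2 = [fset j]%fset := (residue_type J2S jS (etrans (esym Qy2) Qy1)).
have rx : residue J z x by rewrite -Rz; exact: PR.
have ry : residue J z y by rewrite -Rz; exact: QR.
have eR : R = residue J x by rewrite Rz; exact: residue_eq.
have eP : P = residue [fset i]%fset x.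
  by rewrite Px1; apply: residue_eq => //; rewrite -Px1.
have eQ : Q = residue [fset j]%fset y.
  by rewrite Qy1; apply: residue_eq => //; rewrite -Qy1.
exists x, y, i, j; split=> //.
  exact: (residue_trans hcox JS (residue_sym hcox rx) ry).
split=> //.
- apply: (fsubsetP (residue_type_sub (x := x1) (y := z) iS JS _) i); last by rewrite inE.
  by rewrite -Px1 -Rz.
- apply: (fsubsetP (residue_type_sub (x := y1) (y := z) jS JS _) j); last by rewrite inE.
  by rewrite -Qy1 -Rz.
- have : [set` J1] i by rewrite e1 /= inE.
  by rewrite eJ e2 => -[u /=]; rewrite inE => /eqP -> <-.
Qed.

Section Rank2.
Variables (J : {fset W}) (x y : chamber D) (i j : W).
Hypothesis sJ : spherical S J.
Hypothesis dxy : dist x y = longest J.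
Hypothesis rxy : residue J x y.
Hypothesis iJ : i \in J.
Hypothesis jJ : j \in J.
Hypothesis eij : i = longest J * j * longest J.

Let r := longest J.
Let JS : (J `<=` S)%fset. Proof. by case: sJ. Qed.
Let iS : i \in S. Proof. exact: (fsubsetP JS). Qed.
Let jS : j \in S. Proof. exact: (fsubsetP JS). Qed.

Lemma len_jr : (len (j * r)).+1 = len r.
Proof.
have := len_longest_l hcox sJ (generated_gen jJ); rewrite (len_gen hcox jS) /r; clear=> *; lia.
Qed.

Let ri : r * i = j * r. Proof. by rewrite eij !mulA longest2 // mul1g. Qed.
Let jri : j * r * i = r. Proof. by rewrite -mulA ri mulA (gen2 hcox jS) mul1g. Qed.

(** Since [r * i = j * r], a step in either panel can only toggle between the two values. The
    shorter one, [j * r], marks mutual projections. *)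
Lemma opp_panel_dist z p : residue [fset i]%fset x z -> residue [fset j]%fset y p ->
  dist p z = r \/ dist p z = j * r.
Proof.
move=> rz rp.
have dpx : dist p x = r \/ dist p x = j * r.
  have dx : dist x p = r \/ dist x p = r * j.
    case: ((panelP hcox _ _ jS).1 rp) => [<-|[sp dp]]; first by left.
    by have := step hcox x sp jS dp; rewrite dxy.
  by rewrite (dist_sym hcox x p); case: dx => ->; [left|right]; rewrite ?invgM ?(genV hcox jS) longestV.
case: ((panelP hcox _ _ iS).1 rz) => [<-//|[sz dz]].
have := step hcox p sz iS dz; case: dpx => ->; rewrite ?ri ?jri => -[->|->]; auto.
Qed.

Lemma opp_panel_ex p v : residue [fset j]%fset y p -> v = r \/ v = j * r ->
  exists z, residue [fset i]%fset x z /\ dist p z = v.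
Proof.
move=> rp hv; have rx := residue_refl [fset i]%fset x.
have [z [sz dz pz]] := ex_adj p x iS.
have rz : residue [fset i]%fset x z by apply/(panelP hcox _ _ iS); right.
move: pz; case: (opp_panel_dist rx rp) => e; rewrite e ?ri ?jri; case: hv => -> pz;
  by [exists x|exists z].
Qed.

Lemma opp_panel_uniq z p q : residue [fset i]%fset x z -> residue [fset j]%fset y p ->
  residue [fset j]%fset y q -> dist p z = j * r -> dist q z = j * r -> p = q.
Proof.
move=> rz rp rq dp dq.
have rpq : residue [fset j]%fset p q.
  exact: (residue_trans hcox (sub1 jS) (residue_sym hcox rp) rq).
have l : (len (r * j)).+1 = len r by rewrite -len_jr -(lenV hcox (r * j)) invgM (genV hcox jS) longestV.
have e : dist z p = r * j by rewrite (dist_sym hcox p z) dp invgM (genV hcox jS) longestV.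
apply: (shorter_uniq hcox (q := z) jS) => //; last by rewrite e (dist_sym hcox q z) dq invgM (genV hcox jS) longestV.
  by rewrite (residue_sign rz) (residue_sign rp) (residue_sign rxy).
by rewrite e (mulg_gen hcox) // l.
Qed.

End Rank2.

Lemma opposite_residues_panel Q d s : s \in S -> opposite_residues Q (panel s d) ->
  exists z h, [/\ Q = residue [fset s]%fset z, residue [fset s]%fset d h & opposite z h].
Proof.
move=> sS [J [[JS [x Qx]] [_ [y Py]] [z [h [Qz Ph zh]]]]].
have eJ : [fset s]%fset = J := residue_type (sub1 sS) JS Py.
exists z, h; split=> //; rewrite Qx -eJ; apply: residue_eq; rewrite ?eJ //.
by rewrite -Qx.
Qed.

Lemma panel_opposite_residues z d s : s \in S -> opposite z d ->
  opposite_residues (residue [fset s]%fset z) (panel s d).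
Proof.
move=> sS zd; exists [fset s]%fset; split; try by split; [exact: sub1|eexists].
by exists z, d; split=> //; exact: residue_refl.
Qed.

Lemma coproj_is_proj J R x e p : R = residue J x -> (J `<=` S)%fset -> sign e <> sign p -> residue J x p ->
  coproj J e p -> is_proj R e p.
Proof.
move=> -> JS ne rp cp; split=> // z rz.
have -> : (sign e == sign p) = false by apply/eqP.
by have [] := coproj_dist hcox JS ne cp (residue_trans hcox JS (residue_sym hcox rp) rz).
Qed.

End Panels.

Section Wall.
Variables (W : groupType) (S : {fset W}).
Hypothesis hcox : coxeter_system S.
Variables D D' : twin_building S.
Implicit Types (s t u v w i j : W) (J K : {fset W}).
Implicit Types (x y z q e h a b k m p : chamber D) (P Q R : set (chamber D)).

Local Notation len := (len S).
Local Notation longest := (longest S).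

Variables (eps : bool) (Om : chamber D -> chamber D').
Hypothesis Os : forall x, sign x = eps -> sign (Om x) = sign x.
Hypothesis Od : forall x y, sign x = eps -> sign y = eps -> dist (Om x) (Om y) = dist x y.
Hypothesis Oo : forall x' : chamber D', sign x' = eps -> exists2 x, sign x = eps & Om x = x'.

Lemma Om_res J x z : sign x = eps -> residue J x z -> residue J (Om x) (Om z).
Proof.
move=> sx [sz g]; split; first by rewrite !Os ?sz.
by rewrite Od ?sz.
Qed.

Lemma Om_res_onto J x (z' : chamber D') : sign x = eps -> residue J (Om x) z' ->
  exists z, residue J x z /\ Om z = z'.
Proof.
move=> sx [sz' g]; have [z sz ez] : exists2 z, sign z = eps & Om z = z'.
  by apply: Oo; rewrite sz' Os.
exists z; split=> //; split; first by rewrite sz sx.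
by rewrite -Od // ez.
Qed.

(** Codistances to the half already mapped characterize the image of [e]: by
    [opposite_half_separates] at most one such chamber exists. *)
Definition twin_image e (e' : chamber D') := sign e' = sign e /\
  forall x, sign x = eps -> dist e' (Om x) = dist e x.

Section OneWall.
Variables (d : chamber D) (d' : chamber D') (s : W) (f : chamber D -> chamber D').
Hypothesis sd : eps <> sign d.
Hypothesis dd' : twin_image d d'.
Hypothesis sS : s \in S.
Hypothesis fP : forall e, panel s d e -> residue [fset s]%fset d' (f e).
Hypothesis fd : f d = d'.

Local Notation P := (panel s d).

Definition carries Q := forall e z, P e -> Q z -> dist (f e) (Om z) = dist e z.

(* z is a projection of e, which lies in the other half, to Q. *)
Definition farthest e Q z := forall y, Q y -> (len (dist e y) <= len (dist e z))%N.

(** Injectivity of the projection from [P] to [Q]. *)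
Definition separates Q := forall e1 e2 z, P e1 -> P e2 -> Q z ->
  farthest e1 Q z -> farthest e2 Q z -> e1 = e2.

Lemma f_sign e : P e -> sign (f e) = sign e.
Proof. by move=> Pe; rewrite (residue_sign (fP Pe)) dd'.1 (residue_sign Pe). Qed.

Lemma P_neq e z : P e -> sign z = eps -> sign e <> sign z.
Proof. by move=> Pe ->; rewrite (residue_sign Pe); exact: nesym. Qed.

Section OneStep.
Variables (J : {fset W}) (x y : chamber D) (i j : W).
Hypothesis sJ : spherical S J.
Hypothesis dxy : dist x y = longest J.
Hypothesis rxy : residue J x y.
Hypothesis iJ : i \in J.
Hypothesis jJ : j \in J.
Hypothesis eij : i = longest J * j * longest J.
Hypothesis sx : sign x = eps.

Local Notation Q1 := (residue [fset i]%fset x).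
Local Notation Q2 := (residue [fset j]%fset y).

Hypothesis hproj : forall e p, P e -> residue J x p -> coproj J e p -> Q2 p.

Let JS : (J `<=` S)%fset. Proof. by case: sJ. Qed.
Let jS : j \in S. Proof. exact: (fsubsetP JS). Qed.

Lemma proj_ex e : P e -> exists p, [/\ residue J x p, coproj J e p & Q2 p].
Proof.
by move=> Pe; have [p [rp cp]] := proj_opp_ex hcox e x sJ; exists p; split=> //; apply: (hproj Pe).
Qed.

Let Q1J z : Q1 z -> residue J x z.
Proof. by apply: residueS; apply/fsubsetP => k; rewrite inE => /eqP ->. Qed.
Let Q2J z : Q2 z -> residue J x z.
Proof.
move=> rz; apply: (residue_trans hcox JS rxy).
by apply: residueS rz; apply/fsubsetP => k; rewrite inE => /eqP ->.
Qed.

Lemma proj_dist e p z : P e -> residue J x p -> coproj J e p -> residue J x z ->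
  dist e z = dist e p * dist p z /\ (len (dist e z) + len (dist p z))%N = len (dist e p).
Proof.
move=> Pe rp cp rz; apply: (coproj_dist hcox JS _ cp).
  by apply: (P_neq Pe); rewrite (residue_sign rp).
exact: (residue_trans hcox JS (residue_sym hcox rp) rz).
Qed.

Lemma im_dist e p z : P e -> residue J x p -> coproj J (f e) (Om p) -> residue J x z ->
  dist (f e) (Om z) = dist (f e) (Om p) * dist p z /\
  (len (dist (f e) (Om z)) + len (dist p z))%N = len (dist (f e) (Om p)).
Proof.
move=> Pe rp cp rz; have sp : sign p = eps by rewrite (residue_sign rp).
have sz : sign z = eps by rewrite (residue_sign rz).
rewrite -(Od sp sz); apply: (coproj_dist hcox JS _ cp).
  by rewrite (f_sign Pe) (Os sp); exact: P_neq.
by apply: Om_res => //; exact: (residue_trans hcox JS (residue_sym hcox rp) rz).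
Qed.

(** The projection of [e] to the rank two residue lies in [Q2], where codistances are carried, so
    its image is the projection of [f e]; this determines the codistances to [Q1]. *)
Lemma carries_down : carries Q2 -> carries Q1.
Proof.
move=> cQ e z Pe Qz; have [p [rp cp Qp]] := proj_ex Pe.
have ep := cQ _ _ Pe Qp.
have cp' : coproj J (f e) (Om p) by move=> k kJ; rewrite ep; exact: cp.
by rewrite (im_dist Pe rp cp' (Q1J Qz)).1 ep (proj_dist Pe rp cp (Q1J Qz)).1.
Qed.

Lemma far_Q1 e p z : P e -> residue J x p -> coproj J e p -> Q2 p -> Q1 z ->
  dist p z = j * longest J -> farthest e Q1 z.
Proof.
move=> Pe rp cp Qp Qz dz z2 Qz2.
have [_] := proj_dist Pe rp cp (Q1J Qz); have [_] := proj_dist Pe rp cp (Q1J Qz2).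
have := len_jr hcox sJ jJ; rewrite dz.
by case: (opp_panel_dist hcox sJ dxy iJ jJ eij Qz2 Qp) => ->; clear=> *; lia.
Qed.

Lemma separates_proj e1 e2 p : separates Q1 -> P e1 -> P e2 -> residue J x p -> Q2 p ->
  coproj J e1 p -> coproj J e2 p -> e1 = e2.
Proof.
move=> sep P1 P2 rp Qp c1 c2.
have [z [Qz dz]] := opp_panel_ex hcox sJ dxy iJ jJ eij Qp (or_intror erefl).
by apply: (sep _ _ z P1 P2 Qz); apply: (far_Q1 _ rp _ Qp Qz dz).
Qed.

(** A farthest chamber of [Q2] is the projection to the whole residue. Chambers of [P] sharing it
    also share a farthest chamber of [Q1], the one at distance [j * longest J]. *)
Lemma separates_up : separates Q1 -> separates Q2.
Proof.
move=> sep e1 e2 q P1 P2 Qq far1 far2.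
have eqp e : P e -> farthest e Q2 q -> coproj J e q.
  move=> Pe far; have [p [rp cp Qp]] := proj_ex Pe.
  suff -> : q = p by [].
  apply/esym/dist_eq1; first by rewrite (residue_sign rp) (residue_sign (Q2J Qq)).
  apply: (len_eq0 hcox); have := far _ Qp; have [_] := proj_dist Pe rp cp (Q2J Qq).
  by clear=> *; lia.
exact: (separates_proj sep P1 P2 (Q2J Qq) Qq (eqp _ P1 far1) (eqp _ P2 far2)).
Qed.

(* The image of d is known, so the projection pd of d and the distance from f e
   to its image are known.  Hence f e projects to the image of the panel Q2, and
   the distances to Q1 tell to which chamber. *)
Lemma carries_up : separates Q1 -> carries Q1 -> carries Q2.
Proof.
move=> sep cQ e q Pe Qq.
have Pd : P d := residue_refl _ d.
have sq : sign q = eps by rewrite (residue_sign (Q2J Qq)).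
have [->|ned] := pselect (e = d); first by rewrite fd dd'.2.
have [pd [rpd cpd Qpd]] := proj_ex Pd; have [pe [rpe cpe Qpe]] := proj_ex Pe.
have spd : sign pd = eps by rewrite (residue_sign rpd).
have spe : sign pe = eps by rewrite (residue_sign rpe).
have rdd := residue_trans hcox (sub1 jS) (residue_sym hcox Qpe) Qpd.
have dj : dist pe pd = j.
  case: ((panelP hcox _ _ jS).1 rdd) => [ee|[]//].
  by case: ned; rewrite ee in cpe; apply: (separates_proj sep Pe Pd rpd Qpd cpe cpd).
have dj' : dist pd pe = j by rewrite (dist_sym hcox pe) dj (genV hcox jS).
set w := dist d pd; set v := dist e pe.
have [epd lepd] := proj_dist Pe rpe cpe rpd; rewrite dj -/v in epd lepd.
have [dpe ldpe] := proj_dist Pd rpd cpd rpe; rewrite dj' -/w in dpe ldpe.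
rewrite (len_gen hcox jS) in lepd ldpe.
have [//|[se de]] := (panelP hcox d e sS).1 Pe; first by move=> /esym.
(* The alternative [v * j = w] would make each of [v] and [w] longer than the other. *)
have epd2 : v * j = s * w.
  have := step hcox pd se sS de; rewrite (dist_sym hcox d) -/w (dist_sym hcox e) epd => -[|h].
    move=> /invg_inj h.
    have vw : v = w * j by rewrite -h (mulg_gen hcox).
    by move: lepd ldpe; rewrite epd dpe -vw h; clear=> *; lia.
  by rewrite -[v * j]invgK h invgM invgK (genV hcox sS).
have ev : v = s * w * j by rewrite -epd2 (mulg_gen hcox).
have lsw : len w = (len (s * w)).+1 /\ len v = len w.
  have lv : len v = (len (s * w)).+1 by move: lepd; rewrite epd epd2; clear=> *; lia.
  have := lenM hcox s (w * j); rewrite mulA -ev (len_gen hcox sS) -dpe => h.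
  by case: (len_mull_or hcox w sS) ldpe lv h => ->; clear=> *; lia.
have nfe : d' <> f e.
  move=> efe; case: ned.
  have [z [Qz dz]] := opp_panel_ex hcox sJ dxy iJ jJ eij Qpe (or_intror erefl).
  have far := far_Q1 Pe rpe cpe Qpe Qz dz.
  apply: (sep _ _ z Pe Pd Qz far) => z2 Qz2.
  have same z3 : Q1 z3 -> dist d z3 = dist e z3.
    by move=> Qz3; rewrite -(cQ _ _ Pe Qz3) -efe dd'.2 // (residue_sign Qz3).
  by rewrite !same //; exact: far.
have [//|[sfe dfe]] := (panelP hcox d' (f e) sS).1 (fP Pe).
have fpd : dist (f e) (Om pd) = s * w.
  rewrite (dist_sym hcox (Om pd)) (step_down hcox (y := d') (s := s)) //.
  - by rewrite (dist_sym hcox d') invgM invgK (genV hcox sS) dd'.2.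
  - by rewrite (Os spd) spd dd'.1.
  - rewrite (dist_sym hcox d') dd'.2 // -/w (lenV hcox) -(genV hcox sS) -invgM (lenV hcox).
    by rewrite lsw.1.
(* [q'] is the chamber at the codistance [v] expected of the image of [pe], with preimage [p]; [h]
   is the preimage of the actual projection of [f e]. They are now identified with [pe] by means of
   [Q1]. *)
have [q' [sq' dq' fq']] := ex_adj (f e) (Om pd) jS.
have rq' : residue J (Om pd) q' by split=> //; rewrite dq'; exact: generated_gen.
have [p [rp ep]] := Om_res_onto spd rq'.
have rxp := residue_trans hcox JS rpd rp; have sp : sign p = eps by rewrite (residue_sign rxp).
have Qp : Q2 p.
  apply: (residue_trans hcox (sub1 jS) Qpd); apply/(panelP hcox _ _ jS); right.
  by split; [rewrite sp spd|rewrite -Od // ep].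
have [h' [rh' ch']] := proj_opp_ex hcox (f e) (Om pd) sJ.
have [h [rh eh]] := Om_res_onto spd rh'.
have rxh := residue_trans hcox JS rpd rh; have sh : sign h = eps by rewrite (residue_sign rxh).
rewrite -eh in ch'.
have lfp : len (dist (f e) (Om p)) = len v by rewrite ep fq' fpd -ev.
have grh z : residue J x z -> (len (dist h z) <= len (longest J))%N.
  move=> rz; apply: (longestP hcox sJ).2.
  by case: (residue_trans hcox JS (residue_sym hcox rxh) rz).
(* A chamber [z1] of [Q1] opposite [pe] in the residue bounds the length at [h] by that of [v],
   which is attained at [p]. *)
have eph : h = p.
  have [z1 [Qz1 dz1]] := opp_panel_ex hcox sJ dxy iJ jJ eij Qpe (or_introl erefl).
  apply/dist_eq1; first by rewrite sh sp.
  apply: (len_eq0 hcox).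
  have [_] := im_dist Pe rxh ch' (Q1J Qz1); rewrite (cQ _ _ Pe Qz1).
  have [_] := proj_dist Pe rpe cpe (Q1J Qz1); rewrite dz1 -/v.
  have [_] := im_dist Pe rxh ch' rxp; rewrite lfp; have := grh _ (Q1J Qz1).
  by clear=> *; lia.
have epp : p = pe.
  have [z [Qz dz]] := opp_panel_ex hcox sJ dxy iJ jJ eij Qpe (or_intror erefl).
  have ddp : dist p z = j * longest J; last exact: (opp_panel_uniq hcox sJ rxy jJ Qz Qp Qpe ddp dz).
  have [_] := im_dist Pe rxh ch' (Q1J Qz); rewrite (cQ _ _ Pe Qz) eph lfp.
  have [_] := proj_dist Pe rpe cpe (Q1J Qz); rewrite dz -/v.
  case: (opp_panel_dist hcox sJ dxy iJ jJ eij Qz Qp) => -> //.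
  by have := len_jr hcox sJ jJ; clear=> *; lia.
rewrite eph epp in ch' *.
rewrite (im_dist Pe rpe ch' (Q2J Qq)).1 (proj_dist Pe rpe cpe (Q2J Qq)).1.
by rewrite -epp ep fq' fpd epp -/v ev.
Qed.

End OneStep.

Definition half Q := forall z, Q z -> sign z = eps.

Lemma adjacent_data_proj J R Q1 Q2 : adjacent_via J R Q1 Q2 -> proj_set R P = Q2 -> half Q1 ->
  exists x y i j, [/\ spherical S J, residue J x y, dist x y = longest J, sign x = eps &
    [/\ Q1 = residue [fset i]%fset x, Q2 = residue [fset j]%fset y, i \in J, j \in J
      & i = longest J * j * longest J]] /\
    forall e p, P e -> residue J x p -> coproj J e p -> residue [fset j]%fset y p.
Proof.
move=> adj pr hf; have [x [y [i [j [sJ eR rxy dxy [e1 e2 iJ jJ eij]]]]]] := adjacent_data hcox adj.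
have sx : sign x = eps by apply: hf; rewrite e1; exact: residue_refl.
exists x, y, i, j; split=> // e p Pe rp cp; rewrite -e2 -pr; exists e => //.
have [JS _] := sJ; apply: (coproj_is_proj hcox eR JS _ rp cp).
by apply: (P_neq Pe); rewrite (residue_sign rp).
Qed.

Lemma adjacent_half J R Q1 Q2 : adjacent_via J R Q1 Q2 -> half Q1 -> half Q2.
Proof.
move=> adj hf z; have [x [y [i [j [sJ _ rxy _ [e1 -> _ _ _]]]]]] := adjacent_data hcox adj.
move=> rz; rewrite (residue_sign rz) (residue_sign rxy); apply: hf.
by rewrite e1; exact: residue_refl.
Qed.

Lemma path_half Ps Js (k : nat) : P_compatible_path P Ps Js -> half (nth set0 Ps 0) ->
  (k <= size Js)%N -> half (nth set0 Ps k).
Proof.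
move=> [_ _ [_ _ st]] h0; elim: k => // k IHk lk.
by have [R [adj _]] := st k lk; apply: (adjacent_half adj); apply: IHk; exact: ltnW.
Qed.

Lemma path_up Ps Js (k : nat) : P_compatible_path P Ps Js -> half (nth set0 Ps 0) ->
  separates (nth set0 Ps 0) -> carries (nth set0 Ps 0) -> (k <= size Js)%N ->
  separates (nth set0 Ps k) /\ carries (nth set0 Ps k).
Proof.
move=> pp h0 s0 c0; elim: k => // k IHk lk.
have [sk ck] := IHk (ltnW lk); have hk := path_half pp h0 (ltnW lk).
have [_ _ [_ _ /(_ k lk) [R [adj pr]]]] := pp.
have [x [y [i [j [[sJ rxy dxy sx [e1 e2 iJ jJ eij]] hpr]]]]] := adjacent_data_proj adj pr hk.
rewrite e1 in sk ck; rewrite e2; split.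
  exact: (separates_up sJ dxy rxy iJ jJ eij sx hpr sk).
exact: (carries_up sJ dxy rxy iJ jJ eij sx hpr sk ck).
Qed.

Lemma path_down Ps Js (k : nat) : P_compatible_path P Ps Js -> half (nth set0 Ps 0) ->
  carries (nth set0 Ps k) -> (k <= size Js)%N -> carries (nth set0 Ps 0).
Proof.
move=> pp h0; elim: k => // k IHk ck lk; apply: (IHk _ (ltnW lk)).
have hk := path_half pp h0 (ltnW lk).
have [_ _ [_ _ /(_ k lk) [R [adj pr]]]] := pp.
have [x [y [i [j [[sJ rxy dxy sx [e1 e2 iJ jJ eij]] hpr]]]]] := adjacent_data_proj adj pr hk.
rewrite e2 in ck; rewrite e1.
exact: (carries_down sJ iJ sx hpr ck).
Qed.

Lemma opposite_half Q : opposite_residues Q P -> half Q.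
Proof.
move=> /(opposite_residues_panel hcox sS) [z [h [-> rh [ne _]]]] q rq.
move: ne sd; rewrite (residue_sign rh) (residue_sign rq).
by case: (sign z) (sign d) eps => [] [] [].
Qed.

Lemma opposite_separates Q : opposite_residues Q P -> separates Q.
Proof.
move=> /(opposite_residues_panel hcox sS) [z [h [-> rh zh]]] e1 e2 q P1 P2 rq.
have hz := opposite_sym hcox zh.
have toh e : P e -> residue [fset s]%fset h e.
  by move=> Pe; exact: (residue_trans hcox (sub1 sS) (residue_sym hcox rh) Pe).
have key e : P e -> farthest e (residue [fset s]%fset z) q -> dist q e = s.
  move=> /toh re far; rewrite (dist_sym hcox e) -(genV hcox sS); congr (_^-1).
  case: (panel_opp hcox sS hz re rq) => // d1.
  have [k [rk dk]] := panel_opp_ex hcox sS hz re.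
  by have := far _ rk; rewrite dk d1 (len1 hcox) (len_gen hcox sS).
move=> /(key _ P1) d1 /(key _ P2) d2.
exact: (panel_opp_uniq hcox sS (opp_sign zh rq (residue_refl _ h)) (toh _ P1) (toh _ P2) d1 d2).
Qed.

(** Up the first path to [T], down the second. Only the way up needs injectivity of the projection,
    which holds for panels opposite [P]. *)
Lemma wall_adjacent_carries Q1 Q2 : opposite_residues Q1 P -> opposite_residues Q2 P ->
  wall_adjacent d s Q1 Q2 -> carries Q1 -> carries Q2.
Proof.
move=> o1 o2 [T [Ps1 [Ps2 [Js [p1 p2 [e1 t1] [e2 t2]]]]]] c1.
have [_ cT] : separates (nth set0 Ps1 (size Js)) /\ carries (nth set0 Ps1 (size Js)).
  by apply: (path_up p1); rewrite ?e1 //; [exact: opposite_half|exact: opposite_separates].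
rewrite -e2; apply: (path_down (k := size Js) p2); rewrite ?t2 ?e2 -?t1 //.
exact: opposite_half.
Qed.

Lemma connected_carries Q1 Q2 : wall_connected D ->
  is_panel Q1 -> opposite_residues Q1 P -> is_panel Q2 -> opposite_residues Q2 P ->
  carries Q1 -> carries Q2.
Proof.
move=> hw p1 o1 p2 o2; have := hw d s sS Q1 Q2 (conj p1 o1) (conj p2 o2).
elim=> {p1 o1 p2 o2} [Q Q' [[_ oQ] [_ oQ']] | |Q Q' Q2' _ IH1 _ IH2 /IH1 /IH2] //.
exact: wall_adjacent_carries.
Qed.

(** Every chamber opposite [e] lies in a panel opposite [P], so opposition to [e] is preserved.
    Other codistances follow by induction on length: [z] is the unique farthest chamber of a panel
    whose remaining chambers are already settled. *)
Lemma carries_twin z0 : wall_connected D -> opposite z0 d ->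
  carries (residue [fset s]%fset z0) -> forall e, P e -> twin_image e (f e).
Proof.
move=> hw z0d c0 e Pe; split; first exact: f_sign.
have pan z : is_panel (residue [fset s]%fset z).
  by exists s; split; [exact: sub1|exists z].
have opp z : sign z = eps -> dist e z = 1 -> dist (f e) (Om z) = 1.
  move=> sz dz; rewrite -dz; have ze : opposite z e.
    by apply: (opposite_sym hcox); split=> //; exact: P_neq.
  have oz : opposite_residues (residue [fset s]%fset z) P.
    by rewrite /panel (residue_eq hcox (sub1 sS) Pe); exact: panel_opposite_residues.
  have o0 := panel_opposite_residues sS z0d.
  exact: (connected_carries hw (pan z0) o0 (pan z) oz c0 Pe (residue_refl _ z)).
move=> z; have [n] := ubnP (len (dist e z)); elim: n z => // n IHn z lt sz.
have [d1|d1] := pselect (dist e z = 1); first by rewrite d1; exact: opp.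
have [j [jS _ lj]] := gen_descent hcox (fsubset_refl S) (generatedT hcox _) d1.
have [y [sy dzy ey]] := ex_adj e z jS.
have sy' : sign y = eps by rewrite sy.
have fy : dist (f e) (Om y) = dist e z * j.
  by rewrite -ey; apply: IHn => //; rewrite ey; move: lt lj; clear=> *; lia.
have [x' [sx' yx' fx']] := ex_adj (f e) (Om y) jS.
rewrite fy (mulg_gen hcox) // in fx'.
have rx' : residue [fset j]%fset (Om y) x' by apply/(panelP hcox _ _ jS); right.
have [x [rx ex]] := Om_res_onto sy' rx'.
have sx := residue_sign rx.
have ryz : residue [fset j]%fset z y by apply/(panelP hcox _ _ jS); right.
case: ((panelP hcox _ _ jS).1 (residue_trans hcox (sub1 jS) ryz rx)) => [ezx|[_ dzx]].
  by rewrite {1}ezx ex.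
have exx : dist e x = dist e z * j.
  by apply: (step_down hcox _ _ jS dzx); rewrite ?sx ?sy ?lj //; exact: P_neq.
have e1 : dist e z = dist e z * j.
  rewrite -{1}fx' -ex -{1}exx; apply: IHn; last by rewrite sx.
  by rewrite exx; move: lt lj; clear=> *; lia.
by move: lj; rewrite -e1; clear=> *; lia.
Qed.

End OneWall.

Lemma opposite_ex (d : chamber D) : eps <> sign d -> (exists z : chamber D, sign z = eps) ->
  exists z, sign z = eps /\ opposite z d.
Proof.
move=> sd [x sx]; have [z [sz _ dz]] := ex_chain hcox d x (dist d x)^-1.
exists z; split; first by rewrite sz.
apply: (opposite_sym hcox); split; last by rewrite dz mulgV.
by rewrite sz sx; exact: nesym.
Qed.

Hypothesis eps_ex : exists z : chamber D, sign z = eps.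

(** The map on the panel of [d] is prescribed by one opposite panel, through the projection
    bijections between opposite panels; [carries_twin] extends it to all codistances. *)
Lemma twin_image_step (d : chamber D) (d' : chamber D') s e : wall_connected D -> eps <> sign d ->
  twin_image d d' -> s \in S -> residue [fset s]%fset d e ->
  exists e' : chamber D', residue [fset s]%fset d' e' /\ twin_image e e'.
Proof.
move=> hw sd dd' sS re.
have [z [sz zd]] := opposite_ex sd eps_ex; have dz := opposite_sym hcox zd.
have zd' : opposite (Om z) d'.
  split; first by rewrite dd'.1 (Os sz) sz.
  by rewrite (dist_sym hcox d') dd'.2 // (dist_sym hcox z); case: zd => _ ->; rewrite !invg1.
have exf a : exists a' : chamber D', panel s d a -> [/\ residue [fset s]%fset d' a', a = d -> a' = d' &
    forall q, residue [fset s]%fset z q -> dist a' (Om q) = dist a q].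
  have [Pa|nPa] := pselect (panel s d a); last by exists d'.
  have [k [rk dk]] := panel_opp_ex hcox sS dz Pa.
  have sk : sign k = eps by rewrite (residue_sign rk).
  have rk' := Om_res sz rk.
  have [a' [ra' da']] := panel_opp_ex hcox sS zd' rk'.
  have sa : sign a <> sign k := opp_sign dz Pa rk.
  have sa' : sign a' <> sign (Om k) by apply/nesym/(opp_sign zd' rk' ra').
  have da2 : dist a' (Om k) = s by rewrite (dist_sym hcox (Om k)) da' (genV hcox sS).
  exists a' => _; split=> //.
    move=> ead; apply: (panel_opp_uniq hcox sS (opp_sign zd' rk' (residue_refl _ d')) ra' (residue_refl _ d') da').
    by rewrite (dist_sym hcox d') dd'.2 // -ead dk (genV hcox sS).
  move=> q rq; have rkq := residue_trans hcox (sub1 sS) (residue_sym hcox rk) rq.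
  case: ((panelP hcox _ _ sS).1 rkq) => [<-|[sq dkq]]; first by rewrite da2.
  have low : (len (s * s) < len s)%N by rewrite (gen2 hcox sS) (len1 hcox) (len_gen hcox sS).
  rewrite (step_down hcox sa sq sS dkq) dk //.
  have sq' : sign (Om q) = sign (Om k) by rewrite !Os ?sq.
  by rewrite (step_down hcox sa' sq' sS) ?da2 // Od // sq.
have [f hf] := choice exf.
exists (f e); split; first by case: (hf e re).
apply: (@carries_twin d d' s f sd dd' sS _ _ z hw zd) => //.
- by move=> a Pa; case: (hf a Pa).
- by case: (hf d (residue_refl _ d)) => _ h _; exact: h.
- by move=> a q Pa Qq; case: (hf a Pa) => _ _; apply.
Qed.

End Wall.

(** Choose [x] in the other half at codistance [dist a b] from [a] so that the way from [x] through
    [a] to [b] ends at codistance 1. Comparing with the codistance from [b] gives [dist a b = 1]. *)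
Lemma opposite_half_separates (W : groupType) (S : {fset W}) (D : twin_building S)
    (a b z : chamber D) : coxeter_system S -> sign a = sign b -> sign z <> sign a ->
  (forall x, sign x = sign z -> dist a x = dist b x) -> a = b.
Proof.
move=> hcox sab sz agree.
have [x [sx _ ax]] := ex_chain hcox a z ((dist a z)^-1 * dist a b).
rewrite mulVKg in ax.
have xa : dist x a = (dist a b)^-1 by rewrite (dist_sym hcox a) ax.
have xb : dist x b = 1.
  have := chain_sub hcox (x := x) (y := a) (z := b); rewrite xa mulVg.
  by rewrite (len1 hcox) (lenV hcox) add0n sx => ->.
apply/(dist_eq1 sab); rewrite -ax agree //.
by rewrite (dist_sym hcox x) xb invg1.
Qed.

Lemma adjacency_isometry (W : groupType) (S : {fset W}) (D D' : twin_building S) (eps : bool)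
    (f : chamber D -> chamber D') : coxeter_system S ->
  (forall x, sign x = eps -> sign (f x) = eps) ->
  (forall s x y, s \in S -> sign x = eps -> sign y = eps -> dist x y = s ->
     dist (f x) (f y) = s) ->
  forall x y, sign x = eps -> sign y = eps -> dist (f x) (f y) = dist x y.
Proof.
move=> hcox fs fa x y sx sy.
pose P v := forall y, dist x y = v -> sign y = eps -> dist (f x) (f y) = v.
apply: (@gen_ind _ _ hcox S P _ _ _ _ (generatedT hcox (dist x y)) y (erefl _)) => //.
  by move=> z /dist_eq1 h sz; rewrite h ?distxx // sx sz.
move=> u s _ sS lus IHu z dz sz.
have [k [sk dk kz _]] := dist_ind_last hcox (etrans sz (esym sx)) sS dz.
have sk' : sign k = eps by rewrite sk.
rewrite (step_up hcox (y := f k) _ _ sS (fa s k z sS sk' sz kz)) ?(IHu k) ?lus ?fs //.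
Qed.

Lemma bool_neq (a b e : bool) : e <> b -> (a <> e <-> a = b).
Proof. by case: a b e => [] [] [] h; split=> // /(_ erefl). Qed.

Lemma wall_extension (W : groupType) (S : {fset W}) (D D' : twin_building S)
    (c d : chamber D) (d' : chamber D') (Om : chamber D -> chamber D') :
  coxeter_system S -> wall_connected D -> sign c <> sign d -> sign d' = sign d ->
  (forall x, sign x = sign c -> sign (Om x) = sign x) ->
  (forall x y, sign x = sign c -> sign y = sign c -> dist (Om x) (Om y) = dist x y) ->
  (forall x', sign x' = sign c -> exists2 x, sign x = sign c & Om x = x') ->
  (forall x, sign x = sign c -> dist d' (Om x) = dist d x) ->
  exists psi : chamber D -> chamber D',
    [/\ isometry [set: chamber D] [set: chamber D'] psi,
        forall x, sign x = sign c -> psi x = Om x & psi d = d'].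
Proof.
move=> hcox hw cd sd' Os Od Oo Ob; set eps := sign c in cd Os Od Oo Ob *.
have eps_ex : exists z : chamber D, sign z = eps by exists c.
pose T := @twin_image _ _ D D' eps Om.
have Td : T d d' by [].
have nd (x : chamber D) : sign x <> eps <-> sign x = sign d by exact: bool_neq.
have nd' (x : chamber D') : sign x <> eps <-> sign x = sign d by exact: bool_neq.
have stepT s a a' b : T a a' -> sign a = sign d -> s \in S -> residue [fset s]%fset a b ->
    exists b', residue [fset s]%fset a' b' /\ T b b'.
  move=> Ta sa sS rb; apply: (twin_image_step hcox Os Od Oo eps_ex hw _ Ta sS rb).
  by rewrite sa.
have exT e : sign e = sign d -> exists e', T e e'.
  move=> se; pose Q v := forall e, dist d e = v -> sign e = sign d -> exists e', T e e'.
  apply: (@gen_ind _ _ hcox S Q _ _ _ _ (generatedT hcox (dist d e)) e (erefl _)) => //.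
    by move=> z dz sz; exists d'; rewrite -((dist_eq1 (esym sz)).1 dz).
  move=> u s _ sS lus IHu z dz sz.
  have [k [sk dk kz _]] := dist_ind_last hcox sz sS dz.
  have [k' Tk] := IHu k dk sk.
  have rkz : residue [fset s]%fset k z by apply/(panelP hcox _ _ sS); right; rewrite sk.
  by have [b' [_ Tb]] := stepT _ _ _ _ Tk sk sS rkz; exists b'.
have uniqT e e1 e2 : sign e = sign d -> T e e1 -> T e e2 -> e1 = e2.
  move=> se [s1 t1] [s2 t2]; have soc : sign (Om c) = eps by rewrite Os.
  apply: (opposite_half_separates (z := Om c) hcox); rewrite ?s1 ?s2 ?se ?soc //.
  by move=> x' sx'; have [x sx <-] := Oo x' sx'; rewrite t1 ?t2.
have injT e1 e2 e' : sign e1 = sign d -> T e1 e' -> T e2 e' -> e1 = e2.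
  move=> se [s1 t1] [s2 t2].
  apply: (opposite_half_separates (z := c) hcox); rewrite -?s1 -?s2 ?s1 ?se //.
  by move=> x sx; rewrite -t1 ?t2.
have exP x : exists x' : chamber D', (sign x = eps -> x' = Om x) /\ (sign x = sign d -> T x x').
  have [e|/nd n] := pselect (sign x = eps).
    by exists (Om x); split=> // e2; case: cd; rewrite -e -e2.
  by have [x' Tx] := exT x n; exists x'; split=> // e; case: cd; rewrite -e -n.
have [psi hpsi] := choice exP.
have pO x : sign x = eps -> psi x = Om x by case: (hpsi x).
have pT x : sign x = sign d -> T x (psi x) by case: (hpsi x).
have psd : psi d = d' by apply: (uniqT d) => //; exact: pT.
have psign x : sign (psi x) = sign x.
  have [e|/nd n] := pselect (sign x = eps); first by rewrite pO // Os.
  by case: (pT x n).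
have padj s x y : s \in S -> sign x = sign d -> sign y = sign d -> dist x y = s ->
     dist (psi x) (psi y) = s.
  move=> sS sx sy dxy.
  have rxy : residue [fset s]%fset x y by apply/(panelP hcox _ _ sS); right; rewrite sx.
  have [y' [ry' Ty]] := stepT _ _ _ _ (pT x sx) sx sS rxy.
  rewrite (uniqT y _ _ sy (pT y sy) Ty).
  case: ((panelP hcox _ _ sS).1 ry') => [e|[] //].
  case: (adj_neq hcox sS dxy); rewrite -e in Ty.
  exact: (injT _ _ _ sx (pT x sx) Ty).
have piso : forall x y, dist (psi x) (psi y) = dist x y.
  move=> x y; have [ex|/nd nx] := pselect (sign x = eps);
    have [ey|/nd ny] := pselect (sign y = eps).
  - by rewrite !pO // Od.
  - by rewrite (pO x) // (dist_sym hcox (psi y)) (pT y ny).2 // -(dist_sym hcox).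
  - by rewrite (pO y) // (pT x nx).2.
  - apply: (adjacency_isometry (eps := sign d) hcox) => //.
    by move=> z sz; rewrite psign.
have pinj x y : psi x = psi y -> x = y.
  move=> e; apply/dist_eq1; first by rewrite -(psign x) e psign.
  by rewrite -piso e distxx.
have psurj x' : exists x, psi x = x'.
  have [ex|/nd' nx] := pselect (sign x' = eps).
    by have [x sx <-] := Oo _ ex; exists x; exact: pO.
  pose Q v := forall x' : chamber D', dist d' x' = v -> sign x' = sign d' -> exists x, psi x = x'.
  apply: (@gen_ind _ _ hcox S Q _ _ _ _ (generatedT hcox (dist d' x')) x' (erefl _)) => //; last by rewrite sd'.
    by move=> z dz sz; exists d; rewrite psd; apply/dist_eq1.
  move=> u s _ sS lus IHu h' dh sh.
  have [k' [sk dk kh hk]] := dist_ind_last hcox sh sS dh.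
  have [k ek] := IHu k' dk sk.
  have skd : sign k = sign d by rewrite -psign ek sk sd'.
  have ndk : eps <> sign k by rewrite skd.
  (* [h'] is recovered from its projection to an opposite panel in the first half, where
     surjectivity is known. *)
  have [z [sz zk]] := opposite_ex hcox ndk eps_ex.
  have kz' : opposite (psi k) (psi z).
    by split; [rewrite !psign sz; exact: nesym|rewrite piso; case: (opposite_sym hcox zk)].
  have rkh : residue [fset s]%fset (psi k) h' by apply/(panelP hcox _ _ sS); right; rewrite ek sk sh.
  have [q' [rq' dq']] := panel_opp_ex hcox sS kz' rkh.
  have [q sq eq] : exists2 q, sign q = eps & psi q = q'.
    have [|q sq <-] := Oo q'; last by exists q => //; exact: pO.
    by rewrite (residue_sign rq') psign.
  have rq : residue [fset s]%fset z q.
    by case: rq' => _; rewrite -eq piso; split=> //; rewrite sq.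
  have [h [rh dh']] := panel_opp_ex hcox sS zk rq.
  exists h.
  have rh' : residue [fset s]%fset (psi k) (psi h).
    by have [s1 g1] := rh; split; [rewrite !psign|rewrite piso].
  have kq := opp_sign (opposite_sym hcox kz') rq' (residue_refl _ (psi k)).
  apply: (panel_opp_uniq hcox sS kq rh' rkh).
    by rewrite -eq piso.
  by rewrite (dist_sym hcox h') dq' (genV hcox sS).
exists psi; split=> //; split=> //.
split=> //; first by move=> x y _ _; exact: pinj.
by move=> x' _; have [x ex] := psurj x'; exists x.
Qed.

(** * Recognizing the base chamber in rank at least three *)

Section Supports.
Variables (W : groupType) (S : {fset W}).
Hypothesis hcox : coxeter_system S.
Local Notation len := (len S).

(** A generator outside the support of [u] lengthens [u], hence is a descent of [u * t] and lies in
    every [K] whose subgroup contains the product. *)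
Lemma generated_mulr_notin (J K : {fset W}) (u t : W) : (J `<=` S)%fset -> (K `<=` S)%fset ->
  generated J u -> t \in S -> t \notin J -> generated K (u * t) -> t \in K /\ generated K u.
Proof.
move=> JS KS gu tS tJ gut.
have l : len (u * t) = (len u).+1.
  case: (len_mulr_or hcox u tS) => // l; case/negP: tJ.
  by apply: (descent_in hcox JS gu tS); rewrite l.
have tK : t \in K by apply: (descent_in hcox KS gut tS); rewrite (mulg_gen hcox) // l.
by split=> //; rewrite -(mulg_gen hcox u tS); apply: generatedM => //; exact: generated_gen.
Qed.

Lemma fset_pick (J : {fset W}) : (#|` J| < #|` S|)%N -> exists t, t \in S /\ t \notin J.
Proof.
move=> lt; apply: contrapT => no.
have : (S `<=` J)%fset.
  by apply/fsubsetP => t tS; apply/negPn/negP => tJ; apply: no; exists t.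
by move/fsubset_leq_card; rewrite leqNgt lt.
Qed.

(* Otherwise multiply w by a generator, or by two if w is one, outside its
   support: the product has support of size at least 3. *)
Lemma adm_absorb w : (3 <= #|` S|)%N ->
  (forall K v, adm S K -> generated K v -> exists2 J, adm S J & generated J (w * v)) -> w = 1.
Proof.
move=> rk absorb; apply: contrapT => w1.
have not_gen a : a \in S -> w <> a.
  move=> aS wa.
  have [u [uS ua]] : exists t, t \in S /\ t \notin [fset a]%fset.
    by apply: fset_pick; rewrite cardfs1; apply: leq_trans rk.
  have [t [tS tau]] : exists t, t \in S /\ t \notin [fset a; u]%fset.
    by apply: fset_pick; rewrite cardfs2; case: (a != u); apply: leq_trans rk.
  have gu : generated [fset u; t]%fset u by apply: generated_gen; rewrite !inE eqxx.
  have gt : generated [fset u; t]%fset t by apply: generated_gen; rewrite !inE eqxx orbT.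
  have [K [KS cK]] := absorb _ _ (adm2 uS tS) (generatedM gu gt).
  rewrite wa mulA => g3.
  have g2 : generated [fset a; u]%fset (a * u).
    by apply: generatedM; apply: generated_gen; rewrite !inE eqxx ?orbT.
  have [auS _] := adm2 aS uS; have [aS1 _] := adm1 aS.
  have g1 : generated [fset a]%fset a by apply: generated_gen; rewrite !inE.
  have [tK guK] := generated_mulr_notin auS KS g2 tS tau g3.
  have [uK gaK] := generated_mulr_notin aS1 KS g1 uS ua guK.
  have aK := gen_simple hcox KS aS gaK.
  have sub : ([fset t; a; u] `<=` K)%fset.
    by apply/fsubsetP => j; rewrite !inE => /orP[/orP[] /eqP ->|/eqP ->].
  have := fsubset_leq_card sub; rewrite -fsetUA cardfsU1 tau cardfs2.
  move: ua; rewrite inE eq_sym => ->; move: cK; clear=> *; lia.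
have [J aJ] := absorb _ _ (adm0 S) (@generated1 _ fset0); rewrite mulg1 => gJ.
have [JS cJ] := aJ.
have [t [tS tJ]] := fset_pick (leq_ltn_trans cJ rk).
have gt : generated [fset t]%fset t by apply: generated_gen; rewrite inE.
have [K [KS cK] gK] := absorb _ _ (adm1 tS) gt.
have [tK gwK] := generated_mulr_notin JS KS gJ tS tJ gK.
have gI := generatedI hcox JS KS gJ gwK.
have IS : (J `&` K `<=` S)%fset by apply: fsubset_trans JS; exact: fsubsetIl.
have [j [jI _ _]] := gen_descent hcox IS gI w1.
have jS := fsubsetP IS j jI.
(* [K] has at most two elements and contains [t], which is not in [J]; this leaves room for one
   common element. *)
have Ij : (J `&` K `<=` [fset j])%fset.
  apply/fsubsetP => k kI; rewrite inE; apply/negPn/negP => kj.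
  have sub : ([fset t; k; j] `<=` K)%fset.
    apply/fsubsetP => i; rewrite !inE => /orP[/orP[] /eqP -> //|/eqP ->].
      by move: kI; rewrite inE => /andP[].
    by move: jI; rewrite inE => /andP[].
  have := fsubset_leq_card sub; rewrite -fsetUA cardfsU1 cardfs2 kj.
  have -> : t \notin [fset k; j]%fset.
    apply/negP; rewrite !inE => /orP[] /eqP e; case/negP: tJ; rewrite e;
    by [move: kI; rewrite inE => /andP[]|move: jI; rewrite inE => /andP[]].
  by move: cK; clear=> *; lia.
have [//|wj] := (generated1P hcox w jS).1 (generatedS Ij gI).
exact: (not_gen j).
Qed.

End Supports.

Lemma E2P (W : groupType) (S : {fset W}) (D : twin_building S) (x a : chamber D) :
  coxeter_system S -> E_ 2 x a <-> exists2 J, adm S J & residue J x a.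
Proof.
move=> hcox; split=> [[R [Rx [J [[JS [y Ry]] cJ]]] Ra]|[J [JS cJ] ra]].
  exists J; first by split.
  by rewrite -(residue_eq hcox JS (x := y)) -?Ry.
exists (residue J x) => //; split; first exact: residue_refl.
by exists J; split=> //; split=> //; exists x.
Qed.

Local Close Scope group_scope.

Theorem corollary18 (W : groupType) (S : {fset W})
    (hcox : coxeter_system S) (h2 : two_spherical S) (hrank : (3 <= #|` S|)%N)
    (D D' : twin_building S)
    (hthick : thick D) (hthick' : thick D') (hwall : wall_connected D)
    (cp : Cplus D) (cm : Cminus D) (cp' : Cplus D') (cm' : Cminus D')
    (hopp : opposite (inl cp : chamber D) (inr cm : chamber D))
    (hopp' : opposite (inl cp' : chamber D') (inr cm' : chamber D'))
    (phi : chamber D -> chamber D')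
    (hphi : isometry (E_ 2 (inl cp : chamber D) `|` [set (inr cm : chamber D)])
                     (E_ 2 (inl cp' : chamber D') `|` [set (inr cm' : chamber D')])
                     phi) :
  exists! psi : chamber D -> chamber D',
    isometry [set: chamber D] [set: chamber D'] psi /\
    (forall x, (E_ 2 (inl cp : chamber D) `|` [set (inr cm : chamber D)]) x ->
       psi x = phi x).
Proof.
move: hopp hopp' hphi.
set c : chamber D := inl cp; set d : chamber D := inr cm.
set c' : chamber D' := inl cp'; set d' : chamber D' := inr cm'.
move=> cd cd' [[pfun pinj psurj] psign pdist].
set X := _ `|` _ in pfun pinj psurj psign pdist *; set X' := _ `|` _ in pfun psurj.
have XE J a : adm S J -> residue J c a -> X a.
  by move=> aJ ra; left; apply/(E2P _ _ hcox); exists J.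
have Xc : X c := XE _ _ (adm0 S) (residue_refl _ c).
have Xd : X d by right.
have XT a : X a -> sign a -> exists2 J, adm S J & residue J c a.
  by case=> [/(E2P _ _ hcox) //|->].
have XT' a : X' a -> sign a -> exists2 J, adm S J & residue J c' a.
  by case=> [/(E2P _ _ hcox) //|->].
have pd : phi d = d'.
  have [|//] : X' (phi d) by exact: pfun.
  by move=> /(E2P _ _ hcox) [J _ [+ _]]; rewrite psign.
(* With [w = dist (phi c) c'], a chamber of E_2(c') at distance [v] from [c'] is the image of a
   chamber of E_2(c), so [w * v] has support of size at most two; [adm_absorb] then gives
   [w = 1]. *)
have pc : phi c = c'.
  have [J aJ [_ _]] := XT' _ (pfun _ Xc) (psign _ Xc).
  apply/dist_eq1; first by rewrite psign.
  apply: (adm_absorb hcox hrank) => K v aK gv.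
  have [y [sy dy ey]] := ex_chain hcox (phi c) c' v.
  have X'y : X' y by left; apply/(E2P _ _ hcox); exists K => //; split=> //; rewrite dy.
  have [x Xx ex] := psurj _ X'y.
  have sx : sign x by rewrite -psign // ex sy.
  have [L aL [_ gL]] := XT _ Xx sx.
  by exists L => //; rewrite -ey -ex pdist.
have hl J : adm S J -> half_loc J c phi.
  move=> aJ; split=> [a ra|a b ra rb|a' ra'].
  - by apply: psign; exact: XE ra.
  - by apply: pdist; [exact: XE ra|exact: XE rb].
  rewrite pc in ra'.
  have [a Xa ea] : (phi @` X) a' by apply: psurj; left; apply/(E2P _ _ hcox); exists J.
  exists a => //; have [s1 g1] := ra'; split; first by rewrite -(psign _ Xa) ea s1.
  by rewrite -pdist // pc ea.
have dm J m : adm S J -> residue J c m -> dist (phi d) (phi m) = dist d m.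
  by move=> aJ rm; apply: pdist => //; exact: XE rm.
(* Here [c] is the side where the map is known, and the values around [d] are constructed. *)
have [f [lf fd ff]] := ext_local hcox h2 (opposite_sym hcox cd) hl (psign _ Xd) dm.
have [Om [Os Od Oo Ob OE]] := half_extension hcox h2 hthick (LI_sym hcox lf).
have sdd : sign (f d) = sign d by rewrite fd psign.
have [psi [iso pO psd]] := wall_extension hcox hwall cd.1 sdd Os Od Oo Ob.
have ext x : X x -> psi x = phi x.
  move=> Xx; have [sx|sx] := boolP (sign x).
    have [J aJ rx] := XT _ Xx sx.
    by rewrite pO ?(residue_sign rx) // (OE J) // (ff J).
  case: Xx sx => [/(E2P _ _ hcox) [J _ [-> _]] //|-> _].
  by rewrite psd fd.
exists psi; split=> // psi2 [iso2 ext2]; apply: funext => x.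
have on g : isometry [set: chamber D] [set: chamber D'] g -> iso_on S c d g.
  by case=> _ g1 g2 a b _ _; split; [exact: g1|exact: g2].
(* For [K = S] the two residues are the two halves, and the panels around [c] lie in E_2(c), where
   both extensions equal [phi]. *)
apply: (rigid hcox hthick (fsubset_refl S) cd (on _ iso) (on _ iso2)).
- by rewrite ext ?ext2.
- by rewrite ext ?ext2.
- move=> s e sS re; have Xe : X e by exact: XE (adm1 sS) re.
  by rewrite ext ?ext2.
- case: x => x; [left|right]; split=> //; exact: generatedT.
Qed.
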